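(* Let $M$ be a Frobenius manifold of dimension $3$, let $U\subset M$ be an open set such that the algebra $T_pM$ is semi-simple for each $p\in U$, and let $S\subset U$ be a (complex analytic) surface transverse to the unity vector field $e$. Then the booklet 3-web on $S$ is hexagonal (flat): every point of $S$ has a neighbourhood in $S$ which is mapped by a biholomorphism onto an open subset of $\mathbb C^2$ so that the three families of web leaves are mapped to three families of parallel lines with pairwise distinct directions.
   Context: A Frobenius manifold is a complex analytic manifold $M$ equipped with the following analytic objects: a commutative and associative multiplication $\cdot$ on each tangent space $T_pM$; a flat non-degenerate symmetric bilinear inner product $\langle\ ,\ \rangle$ on $TM$ which is invariant, $\langle u\cdot v,w\rangle=\langle u,v\cdot w\rangle$; a unity vector field $e$ with $e\cdot v=v$ for all $v\in TM$ and $\nabla e=0$; an Euler vector field $E$ which is linear, $\nabla(\nabla E)=0$; such that (1) the one-parameter group generated by $E$ rescales the multiplication and the inner product (i.e. the Lie derivatives along $E$ of the multiplication and of the inner product are constant multiples of them), and (2) with $c(u,v,w):=\langle u\cdot v,w\rangle$, the 4-tensor $(\nabla_z c)(u,v,w)$ is symmetric in $u,v,w,z$. Here $\nabla$ is the Levi-Civita connection of $\langle\ ,\ \rangle$. If $T_pM$ is semi-simple for all $p\in U$ and $\dim M=3$, then locally on $U$ there are idempotent vector fields $e_1,e_2,e_3$, with $e_i\cdot e_j=\delta_{ij}e_i$, forming a frame of $TM$, and $e=e_1+e_2+e_3$. For a surface $S\subset U$ transverse to $e$, the three planes spanned by $\{e,e_i\}$, $i=1,2,3$, cut three directions on each $T_pS$.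 The integral curves of these three direction fields form the booklet 3-web on $S$. *)

(* Defs.v *)
From HB Require Import structures.
From mathcomp Require Import all_boot all_order all_algebra.
From mathcomp Require Import all_classical all_reals all_analysis.
From mathcomp Require Import complex.

Set Implicit Arguments.
Unset Strict Implicit.
Unset Printing Implicit Defensive.

Import Order.TTheory GRing.Theory Num.Theory.
Import numFieldNormedType.Exports.

Local Open Scope classical_set_scope.
Local Open Scope ring_scope.

(* R[i] under a name whose type is [numClosedFieldType]: it is through this
   structure that the complex numbers get their normed topology. *)
Definition Cplx (R : realType) : numClosedFieldType := R[i].

Section Holomorphic.
Context {R : realType}.
Local Notation C := (Cplx R).

(* [differentiable] and ['D_v] are taken over the field of complex numbers, so
   this says that f is smooth on the open set A with complex linear
   differentials. *)
Fixpoint holomorphic_upto {V W : normedModType C} (k : nat)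
    (A : set V) (f : V -> W) : Prop :=
  if k is k'.+1 then
    (forall x, A x -> differentiable f x) /\
    (forall v, holomorphic_upto k' A (fun x => 'D_v f x))
  else forall x, A x -> {for x, continuous f}.

Definition holomorphic {V W : normedModType C} (A : set V) (f : V -> W) : Prop :=
  forall k, holomorphic_upto k A f.

End Holomorphic.

Section Coordinates.
Context {R : realType} {n : nat}.
Local Notation C := (Cplx R).
Local Notation vect := 'rV[C]_n.
Local Notation vfield := ('rV[C]_n -> 'rV[C]_n).
Local Notation product := ('rV[C]_n -> 'rV[C]_n -> 'rV[C]_n -> 'rV[C]_n).
Local Notation metric := ('rV[C]_n -> 'M[C]_n).

Implicit Types (X Y Z W : vfield) (m : product) (g : metric).

Definition lie_bracket X Y : vfield :=
  fun x => 'D_(X x) Y x - 'D_(Y x) X x.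

Definition fmul m X Y : vfield := fun x => m x (X x) (Y x).

Definition inner g X Y : vect -> C :=
  fun x => (X x *m g x *m (Y x)^T) 0 0.

(* The Christoffel symbols contracted with u and v:
   2 g(christoffel g x u v, w) = D_u g(v, w) + D_v g(u, w) - D_w g(u, v)
   for all constant u, v, w. *)
Definition christoffel g (x u v : vect) : vect :=
  2^-1 *: (\row_k ('D_u (inner g (cst v) (cst (delta_mx 0 k))) x
                 + 'D_v (inner g (cst u) (cst (delta_mx 0 k))) x
                 - 'D_(delta_mx 0 k) (inner g (cst u) (cst v)) x))
  *m invmx (g x).

Definition nabla g X Y : vfield :=
  fun x => 'D_(X x) Y x + christoffel g x (X x) (Y x).

Definition curvature g X Y Z : vfield :=
  fun x => nabla g X (nabla g Y Z) x - nabla g Y (nabla g X Z) x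
           - nabla g (lie_bracket X Y) Z x.

Definition hessian g X Y Z : vfield :=
  fun x => nabla g X (nabla g Y Z) x - nabla g (nabla g X Y) Z x.

Definition lie_product m Z X Y : vfield :=
  fun x => lie_bracket Z (fmul m X Y) x
           - fmul m (lie_bracket Z X) Y x - fmul m X (lie_bracket Z Y) x.

Definition lie_metric g Z X Y : vect -> C :=
  fun x => 'D_(Z x) (inner g X Y) x
           - inner g (lie_bracket Z X) Y x - inner g X (lie_bracket Z Y) x.

Definition ctensor m g X Y Z : vect -> C := inner g (fmul m X Y) Z.

Definition nabla_ctensor m g W X Y Z : vect -> C :=
  fun x => 'D_(W x) (ctensor m g X Y Z) x
           - ctensor m g (nabla g W X) Y Z x
           - ctensor m g X (nabla g W Y) Z x
           - ctensor m g X Y (nabla g W Z) x.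

(* The constants dm and dg are the weights of the multiplication and of the
   metric under the flow of E. *)
Record frobenius_on (A : set vect) (m : product) (g : metric)
    (e E : vfield) (dm dg : C) : Prop := FrobeniusOn {
  frob_mul_holomorphic : forall u v, holomorphic A (fun x => m x u v);
  frob_mul_linear : forall x, A x -> forall a u v w,
    m x (a *: u + v) w = a *: m x u w + m x v w;
  frob_mulC : forall x, A x -> forall u v, m x u v = m x v u;
  frob_mulA : forall x, A x -> forall u v w, m x u (m x v w) = m x (m x u v) w;
  frob_metric_holomorphic : holomorphic A g;
  frob_metric_sym : forall x, A x -> (g x)^T = g x;
  frob_metric_unit : forall x, A x -> g x \in unitmx;
  frob_flat : forall X Y Z, holomorphic A X -> holomorphic A Y ->
    holomorphic A Z -> forall x, A x -> curvature g X Y Z x = 0;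
  frob_invariant : forall x, A x -> forall u v w,
    inner g (fmul m (cst u) (cst v)) (cst w) x
    = inner g (cst u) (fmul m (cst v) (cst w)) x;
  frob_unity : forall x, A x -> forall v, m x (e x) v = v;
  frob_unity_flat : forall X, holomorphic A X ->
    forall x, A x -> nabla g X e x = 0;
  frob_Euler_linear : forall X Y, holomorphic A X -> holomorphic A Y ->
    forall x, A x -> hessian g X Y E x = 0;
  frob_Euler_mul : forall X Y, holomorphic A X -> holomorphic A Y ->
    forall x, A x -> lie_product m E X Y x = dm *: m x (X x) (Y x);
  frob_Euler_metric : forall X Y, holomorphic A X -> holomorphic A Y ->
    forall x, A x -> lie_metric g E X Y x = dg * inner g X Y x;
  (* adjacent transpositions generate all permutations of the arguments *)
  frob_nabla_c_sym : forall W X Y Z, holomorphic A W -> holomorphic A X ->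
    holomorphic A Y -> holomorphic A Z -> forall x, A x ->
    [/\ nabla_ctensor m g W X Y Z x = nabla_ctensor m g X W Y Z x,
        nabla_ctensor m g W X Y Z x = nabla_ctensor m g W Y X Z x &
        nabla_ctensor m g W X Y Z x = nabla_ctensor m g W X Z Y x]
}.

Definition is_ideal (mu : vect -> vect -> vect) (I : {vspace vect}) : Prop :=
  forall u v, v \in I -> mu u v \in I.

(* The regular module of the commutative algebra (C^n, mu) is semi-simple. *)
Definition semisimple (mu : vect -> vect -> vect) : Prop :=
  forall I : {vspace vect}, is_ideal mu I ->
  exists J : {vspace vect},
    [/\ is_ideal mu J, (I + J = fullv)%VS & (I :&: J = 0)%VS].

End Coordinates.

(* A complex analytic manifold of dimension n given by a holomorphic atlas;
   [unchart i] is the inverse of [chart i] and is meaningful only on the image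
   of [chart_dom i]. *)
Record complex_manifold (R : realType) (n : nat) := ComplexManifold {
  carrier :> topologicalType;
  chart_index : Type;
  chart_dom : chart_index -> set carrier;
  chart : chart_index -> carrier -> 'rV[Cplx R]_n;
  unchart : chart_index -> 'rV[Cplx R]_n -> carrier;
  manifold_hausdorff : hausdorff_space carrier;
  manifold_second_countable : @second_countable carrier;
  chart_dom_open : forall i, open (chart_dom i);
  chart_dom_cover : forall p, exists i, chart_dom i p;
  chart_image_open : forall i, open (chart i @` chart_dom i);
  chartK : forall i p, chart_dom i p -> unchart i (chart i p) = p;
  chart_continuous : forall i p, chart_dom i p -> {for p, continuous (chart i)};
  unchart_continuous : forall i x, (chart i @` chart_dom i) x ->
    {for x, continuous (unchart i)};
  transition_holomorphic : forall i j,
    holomorphic (chart i @` (chart_dom i `&` chart_dom j))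
                (chart j \o unchart i)
}.

Section Manifold.
Context {R : realType} {n : nat} (M : complex_manifold R n).
Local Notation C := (Cplx R).
Local Notation vect := 'rV[C]_n.
Local Notation idx := (chart_index M).

Definition transition (i j : idx) : vect -> vect := chart j \o unchart i.

(* A vector field is the family of its coordinate expressions. *)
Definition vector_field_on (A : set M) (X : idx -> vect -> vect) : Prop :=
  (forall i, holomorphic (chart i @` (chart_dom i `&` A)) (X i)) /\
  (forall i j p, A p -> chart_dom i p -> chart_dom j p ->
    X j (chart j p) = 'D_(X i (chart i p)) (transition i j) (chart i p)).

(* The tensors are given by their expressions in the charts of the atlas;
   [frob_mul i x] is the multiplication of the tangent space at the point of
   coordinates x in the chart i, and [frob_metric i x] is the Gram matrix. *)
Record frobenius_structure := FrobeniusStructure {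
  frob_mul : idx -> vect -> vect -> vect -> vect;
  frob_metric : idx -> vect -> 'M[C]_n;
  frob_e : idx -> vect -> vect;
  frob_E : idx -> vect -> vect;
  frob_mul_weight : C;
  frob_metric_weight : C;
  frob_e_field : vector_field_on setT frob_e;
  frob_E_field : vector_field_on setT frob_E;
  frob_mul_transition : forall i j p, chart_dom i p -> chart_dom j p ->
    forall u v,
    'D_(frob_mul i (chart i p) u v) (transition i j) (chart i p) =
    frob_mul j (chart j p) ('D_u (transition i j) (chart i p))
                           ('D_v (transition i j) (chart i p));
  frob_metric_transition : forall i j p, chart_dom i p -> chart_dom j p ->
    forall u v,
    inner (frob_metric i) (cst u) (cst v) (chart i p) =
    inner (frob_metric j) (cst ('D_u (transition i j) (chart i p)))
                          (cst ('D_v (transition i j) (chart i p))) (chart j p);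
  frob_axioms : forall i,
    frobenius_on (chart i @` chart_dom i) (frob_mul i) (frob_metric i)
      (frob_e i) (frob_E i) frob_mul_weight frob_metric_weight
}.

Definition semisimple_at (F : frobenius_structure) (p : M) : Prop :=
  forall i, chart_dom i p -> semisimple (frob_mul F i (chart i p)).

Definition idempotent_frame (F : frobenius_structure) (N : set M)
    (eps : 'I_n -> idx -> vect -> vect) : Prop :=
  [/\ forall k, vector_field_on N (eps k),
      (forall i p, N p -> chart_dom i p -> forall k l,
        frob_mul F i (chart i p) (eps k i (chart i p)) (eps l i (chart i p))
        = if k == l then eps k i (chart i p) else 0) &
      (forall i p, N p -> chart_dom i p ->
        (\matrix_k eps k i (chart i p)) \in unitmx)].

Definition holomorphic_curve (D : set C) (gamma : C -> M) : Prop :=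
  (forall t, D t -> {for t, continuous gamma}) /\
  (forall i, holomorphic (D `&` gamma @^-1` chart_dom i) (chart i \o gamma)).

(* h maps the open subset V biholomorphically onto the open set h(V) of C^n,
   with inverse hinv. *)
Definition biholomorphic (V : set M) (h : M -> vect) (hinv : vect -> M) : Prop :=
  [/\ open V /\ open (h @` V),
      (forall p, V p -> hinv (h p) = p),
      (forall p, V p -> {for p, continuous h}) /\
      (forall x, (h @` V) x -> {for x, continuous hinv}),
      (forall i, holomorphic (chart i @` (chart_dom i `&` V)) (h \o unchart i)) &
      (forall i, holomorphic (h @` (chart_dom i `&` V)) (chart i \o hinv))].

End Manifold.

Section Maps.
Context {R : realType} {s n : nat}.
Variables (S : complex_manifold R s) (M : complex_manifold R n).
Local Notation C := (Cplx R).

Definition holomorphic_map (f : S -> M) : Prop :=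
  continuous f /\
  forall i j, holomorphic (chart i @` (chart_dom i `&` f @^-1` chart_dom j))
                          (chart j \o f \o unchart i).

Definition tangent_map (f : S -> M) (i : chart_index S) (j : chart_index M)
    (p : S) (v : 'rV[C]_s) : 'rV[C]_n :=
  'D_v (chart j \o f \o unchart i) (chart i p).

Definition immersion (f : S -> M) : Prop :=
  holomorphic_map f /\
  forall p i j, chart_dom i p -> chart_dom j (f p) ->
  forall v, tangent_map f i j p v = 0 -> v = 0.

(* f is the inclusion of S; transversality means that e is nowhere tangent to S,
   which for s.+1 = n says that e and the tangent space of S span that of M. *)
Definition transverse_to_unity (F : frobenius_structure M) (f : S -> M) : Prop :=
  forall p i j, chart_dom i p -> chart_dom j (f p) ->
  forall v, tangent_map f i j p v <> frob_e F j (chart j (f p)).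

(* Curves t |-> gamma t in V, with D connected, whose velocity is a non-zero
   vector of the intersection of the tangent space of S with span{e, e_k}. *)
Definition web_curve (F : frobenius_structure M) (f : S -> M)
    (eps : 'I_n -> chart_index M -> 'rV[C]_n -> 'rV[C]_n) (k : 'I_n)
    (V : set S) (D : set C) (gamma : C -> S) : Prop :=
  [/\ open D, connected D, gamma @` D `<=` V, holomorphic_curve D gamma &
      forall t i j, D t -> chart_dom i (gamma t) -> chart_dom j (f (gamma t)) ->
        let v := 'D_1 (chart i \o gamma) t in
        let x := chart j (f (gamma t)) in
        v != 0 /\
        tangent_map f i j (gamma t) v \in (<[frob_e F j x]> + <[eps k j x]>)%VS].

(* The leaf through q of the k-th foliation of the web restricted to V, as the
   union of all the connected integral curves through q. *)
Definition web_leaf (F : frobenius_structure M) (f : S -> M)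
    (eps : 'I_n -> chart_index M -> 'rV[C]_n -> 'rV[C]_n) (k : 'I_n)
    (V : set S) (q : S) : set S :=
  [set r | exists D gamma, [/\ web_curve F f eps k V D gamma,
                              (gamma @` D) q & (gamma @` D) r]].

End Maps.

(* The k-th leaf through q, q in V, goes to the line through h q directed by
   a k, intersected with h(V); a leaf being connected, it is one connected
   component of this intersection. *)
Definition booklet_web_hexagonal_at (R : realType)
    (M : complex_manifold R 3) (F : frobenius_structure M)
    (S : complex_manifold R 2) (f : S -> M) (p : S) : Prop :=
  exists (N : set M) (eps : 'I_3 -> chart_index M -> 'rV[Cplx R]_3 -> 'rV[Cplx R]_3)
         (V : set S) (h : S -> 'rV[Cplx R]_2) (hinv : 'rV[Cplx R]_2 -> S)
         (a : 'I_3 -> 'rV[Cplx R]_2),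
  [/\ open N /\ idempotent_frame F N eps,
      V p /\ f @` V `<=` N,
      biholomorphic V h hinv,
      (forall k l, k != l -> free [:: a k; a l]) &
      (forall k q, V q ->
        h @` web_leaf F f eps k V q =
        connected_component
          (h @` V `&` [set h q + t *: a k | t in [set: Cplx R]]) (h q))].

(* Main.v *)
From HB Require Import structures.
From mathcomp Require Import all_boot all_order all_algebra.
From mathcomp Require Import all_classical all_reals all_analysis.
From mathcomp Require Import complex ring lra.
Require Import Defs.

Set Implicit Arguments.
Unset Strict Implicit.
Unset Printing Implicit Defensive.

Import Order.TTheory GRing.Theory Num.Theory.
Import numFieldNormedType.Exports.

Local Open Scope classical_set_scope.
Local Open Scope ring_scope.

(** On the semi-simple locus the idempotent fields e_0, e_1, e_2 commute, so that
    they are the coordinate fields of canonical coordinates u_0, u_1, u_2. As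
    the unity is e_0 + e_1 + e_2, it kills the differences u_i - u_j, and the
    plane spanned by the unity and e_k is the kernel of d(u_i - u_j) for
    {i, j, k} = {0, 1, 2}. Hence the k-th leaves on S are the level curves of
    u_i - u_j. The three differences add up to zero, so that in the map
    (u_0 - u_1, u_1 - u_2), a local biholomorphism of S since S is transverse
    to the unity, each of the three families consists of parallel lines.

    The fields commute because of the symmetry of the covariant derivative of c
    in two arguments ([potentiality]): put there e_i, e_j, e_k and multiply by
    e_k; the connection disappears and what remains says that [e_i, e_j] e_k
    vanishes ([frame_bracket]). The coframe dual to the idempotents is therefore
    closed ([coframe_closed]), and the canonical coordinates are its primitives
    ([canonical_coordinates]).

    Three existence results feed this argument. At one point, a semi-simple
    algebra has no nilpotents, its multiplication operators are simultaneously
    diagonalizable, and their eigenvectors are idempotents up to scaling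
    ([semisimple_idempotents]). These idempotents extend holomorphically to
    nearby points, as solutions of v v = v ([idempotent_extension]), by the
    holomorphic inverse function theorem ([inverse_function]), which also turns
    (u_0 - u_1, u_1 - u_2) into a chart of S. Closed holomorphic forms have
    primitives ([closed_form_primitive]): midpoint sums along segments converge,
    and Goursat's subdivision of triangles makes their limit additive.

    Finally a web curve has an image on which a linear form is constant, since
    its derivative vanishes on a connected domain ([web_curve_line]), and
    conversely lines lift to web curves ([line_web_curve]); the chart of S being
    chosen with a ball as image, the leaves are exactly the intersections of
    lines with this ball ([leaf_image]). *)

(** * Real norms over the complex field *)

Section RealNorm.
Context {R : realType}.
Local Notation C := (Cplx R).

(** The embedding of the reals, with [C] rather than [R[i]] as codomain so that
    its values carry the norm and the topology of [C]. *)
Definition cofr (x : R) : C := x%:C%C.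

Lemma cofrI : injective cofr. Proof. by move=> x y []. Qed.
Lemma cofr0 : cofr 0 = 0. Proof. by []. Qed.
Lemma cofr1 : cofr 1 = 1. Proof. by []. Qed.
Lemma cofrD x y : cofr (x + y) = cofr x + cofr y.
Proof. by rewrite /cofr rmorphD. Qed.
Lemma cofrN x : cofr (- x) = - cofr x.
Proof. by rewrite /cofr rmorphN. Qed.
Lemma cofrB x y : cofr (x - y) = cofr x - cofr y.
Proof. by rewrite cofrD cofrN. Qed.
Lemma cofrM x y : cofr (x * y) = cofr x * cofr y.
Proof. by rewrite /cofr rmorphM. Qed.
Lemma cofrV x : cofr x^-1 = (cofr x)^-1.
Proof. by rewrite /cofr fmorphV. Qed.
Lemma ler_cofr x y : (cofr x <= cofr y) = (x <= y).
Proof. exact: lecR. Qed.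
Lemma ltr_cofr x y : (cofr x < cofr y) = (x < y).
Proof. exact: ltcR. Qed.

(** Norms over [C] have values in [C], which is only partially ordered;
    estimates are carried out on the real number that such a norm is. *)
Definition rnorm {V : normedZmodType C} (v : V) : R := complex.Re (`|v| : R[i]).

Lemma rnormE (V : normedZmodType C) (v : V) : `|v| = cofr (rnorm v).
Proof. by rewrite /rnorm /cofr RRe_real // ger0_real. Qed.

Lemma rnorm_ge0 (V : normedZmodType C) (v : V) : 0 <= rnorm v.
Proof. by have := normr_ge0 v; rewrite rnormE -cofr0 ler_cofr. Qed.

Lemma rnorm0 (V : normedZmodType C) : rnorm (0 : V) = 0.
Proof. by rewrite /rnorm normr0. Qed.

Lemma rnorm_eq0 (V : normedZmodType C) (v : V) : rnorm v = 0 -> v = 0.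
Proof. by move=> v0; apply/eqP; rewrite -normr_eq0 rnormE v0. Qed.

Lemma rnormN (V : normedZmodType C) (v : V) : rnorm (- v) = rnorm v.
Proof. by rewrite /rnorm normrN. Qed.

Lemma rnormBC (V : normedZmodType C) (v w : V) : rnorm (v - w) = rnorm (w - v).
Proof. by rewrite -rnormN opprB. Qed.

Lemma rnormD (V : normedZmodType C) (v w : V) : rnorm (v + w) <= rnorm v + rnorm w.
Proof.
by have := ler_normD v w; rewrite !rnormE -cofrD ler_cofr.
Qed.

Lemma rnormB (V : normedZmodType C) (v w : V) : rnorm (v - w) <= rnorm v + rnorm w.
Proof. by rewrite -(rnormN w) rnormD. Qed.

Lemma rnorm_tri (V : normedZmodType C) (v w z : V) : rnorm (v - z) <= rnorm (v - w) + rnorm (w - z).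
Proof. by rewrite -[v in leLHS](subrK w) -addrA rnormD. Qed.

Lemma rnorm_leD (V : normedZmodType C) (v w : V) (e : R) :
  rnorm (v - w) <= e -> rnorm v <= rnorm w + e.
Proof.
by move=> vw; have := rnormD (v - w) w; rewrite subrK => /le_trans; apply; rewrite addrC lerD2l.
Qed.

Lemma rnormZ (V : normedModType C) (a : C) (v : V) : rnorm (a *: v) = rnorm a * rnorm v.
Proof.
apply: cofrI; by rewrite cofrM -!rnormE normrZ.
Qed.

Lemma rnormM (a b : C) : rnorm (a * b) = rnorm a * rnorm b.
Proof. by apply: cofrI; rewrite cofrM -!rnormE normrM. Qed.

Lemma rnormV (a : C) : rnorm a^-1 = (rnorm a)^-1.
Proof. by apply: cofrI; rewrite cofrV -!rnormE normfV. Qed.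

Lemma rnorm_real (t : R) : rnorm (cofr t) = `|t|.
Proof.
apply: cofrI; rewrite -rnormE normc_def /=.
by rewrite expr0n addr0 sqrtr_sqr.
Qed.

Lemma Re_le_nr (z : C) : complex.Re z <= rnorm z.
Proof.
apply: le_trans (ler_norm _) _.
by have := normc_ge_Re z; rewrite rnormE ler_cofr.
Qed.

Lemma nbhs_rnormP (V : normedModType C) (x : V) (A : set V) :
  nbhs x A <-> exists2 e : R, 0 < e & forall y, rnorm (y - x) < e -> A y.
Proof.
split.
  move=> /nbhs_normP [e /= e0 xA].
  exists (complex.Re e); first by move: e0; rewrite ltcE => /andP[].
  move=> y yx; apply: xA => /=; rewrite distrC rnormE.
  by move: e0; rewrite !ltcE /= => /andP[-> _].
case=> e e0 xA; apply/nbhs_normP; exists (cofr e) => /=; first by rewrite -cofr0 ltr_cofr.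
by move=> y /=; rewrite distrC rnormE ltr_cofr; apply: xA.
Qed.

Lemma cvg_rnormP (T : Type) (F : set_system T) {FF : Filter F}
    (V : normedModType C) (f : T -> V) (l : V) :
  f @ F --> l <-> forall e : R, 0 < e -> \forall t \near F, rnorm (f t - l) < e.
Proof.
split.
  by move=> fl e e0; apply: (fl [set z | rnorm (z - l) < e]); apply/nbhs_rnormP; exists e.
move=> fl A /nbhs_rnormP[e e0 eA]; apply: filterS (fl e e0) => t /=; exact: eA.
Qed.

Lemma continuous_rnormP (V W : normedModType C) (f : V -> W) (x : V) :
  {for x, continuous f} <->
  forall e : R, 0 < e -> exists2 d : R, 0 < d &
    forall y, rnorm (y - x) < d -> rnorm (f y - f x) < e.
Proof.
split=> [fx e e0|fx].
  have := iffLR (@cvg_rnormP _ _ (nbhs_filter x) _ f (f x)) fx _ e0.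
  by move=> /nbhs_rnormP[d d0 xd]; exists d.
by apply: (iffRL (@cvg_rnormP _ _ (nbhs_filter x) _ f (f x))) => e /fx[d d0 xd];
  apply/nbhs_rnormP; exists d.
Qed.

Lemma open_rnormP (V : normedModType C) (A : set V) :
  open A <-> forall x, A x -> exists2 e : R, 0 < e & forall y, rnorm (y - x) < e -> A y.
Proof.
rewrite openE; split=> AA x /AA; first by move=> /nbhs_rnormP.
by move=> xA; apply/nbhs_rnormP.
Qed.

Definition nball {V : normedModType C} (x : V) (r : R) : set V :=
  [set y | rnorm (y - x) < r].

Lemma nballxx (V : normedModType C) (x : V) r : 0 < r -> nball x r x.
Proof. by rewrite /nball /= subrr rnorm0. Qed.

Lemma open_nball (V : normedModType C) (x : V) r : open (nball x r).
Proof.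
apply/open_rnormP => y; rewrite /nball /= => yr; exists (r - rnorm (y - x)).
  by rewrite subr_gt0.
move=> z zy; apply: le_lt_trans (rnorm_tri z y x) _; lra.
Qed.

Lemma nball_nbhs (V : normedModType C) (x : V) r : 0 < r -> nbhs x (nball x r).
Proof. by move=> r0; apply: open_nbhs_nbhs; split; [exact: open_nball|exact: nballxx]. Qed.

Lemma convex_nball (V : normedModType C) (c x y : V) (r t : R) :
  0 <= t <= 1 -> nball c r x -> nball c r y ->
  nball c r (x + cofr t *: (y - x)).
Proof.
rewrite /nball /= => /andP[t0 t1] xr yr.
have -> : x + cofr t *: (y - x) - c = cofr (1 - t) *: (x - c) + cofr t *: (y - c).
  have -> : y - x = (y - c) - (x - c) by rewrite opprB addrA subrK.
  rewrite addrAC; move: (x - c) (y - c) => X Y.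
  by rewrite cofrB cofr1 scalerBl scale1r scalerBr -addrA [- _ + _]addrC.
have := rnormD (cofr (1 - t) *: (x - c)) (cofr t *: (y - c)).
rewrite !rnormZ !rnorm_real (ger0_norm t0) (@ger0_norm _ (1 - t)) ?subr_ge0 //.
move/le_lt_trans; apply; have [->|t1'] := eqVneq t 1; first lra.
have : 0 < (1 - t) * (r - rnorm (x - c)) by rewrite mulr_gt0 ?subr_gt0 // lt_neqAle t1'.
have : 0 <= t * (r - rnorm (y - c)) by rewrite mulr_ge0 // subr_ge0 ltW.
lra.
Qed.

Lemma rnorm_entry m n (M : 'M[C]_(m, n)) i j : rnorm (M i j) <= rnorm M.
Proof.
rewrite -ler_cofr -!rnormE [leRHS]/Num.norm /= mx_normE.
by rewrite -[leLHS]nngE num_le;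
  apply: (@le_bigmax _ _ _ _ (fun ij => (`|M ij.1 ij.2|)%:nng) (i, j)).
Qed.

Lemma rnorm_mx_le m n (M : 'M[C]_(m, n)) (r : R) :
  0 <= r -> (forall i j, rnorm (M i j) <= r) -> rnorm M <= r.
Proof.
move=> r0 Mr; have [M0|M0] := eqVneq (mx_norm M) 0.
  by rewrite (mx_norm_eq0 M0) rnorm0.
have [[i j] /= e] := mx_norm_neq0 M0.
by rewrite /rnorm [`|M|]e; exact: Mr.
Qed.

Lemma rnorm_sum (V : normedZmodType C) (I : finType) (F : I -> V) :
  rnorm (\sum_i F i) <= \sum_i rnorm (F i).
Proof.
elim/big_ind2 : _ => //[|a b c d ab cd]; first by rewrite rnorm0.
by apply: le_trans (rnormD _ _) _; exact: lerD.
Qed.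

Lemma rnorm_mulmx m n p (M : 'M[C]_(m, n)) (N : 'M[C]_(n, p)) :
  rnorm (M *m N) <= n%:R * (rnorm M * rnorm N).
Proof.
apply: rnorm_mx_le => [|i j]; first by rewrite !mulr_ge0 ?rnorm_ge0.
rewrite mxE; apply: le_trans (rnorm_sum _) _.
apply: (@le_trans _ _ (\sum_(k < n) (rnorm M * rnorm N))).
  by apply: ler_sum => k _; rewrite rnormM ler_pM ?rnorm_ge0 ?rnorm_entry.
by rewrite sumr_const card_ord mulr_natl.
Qed.

End RealNorm.

(** Arithmetic on norms, whose operands are abstracted beforehand. *)
Ltac rnorm_gen := repeat match goal with |- context [rnorm ?v] => move: (rnorm v) end;
  repeat match goal with
  | H : is_true (_ <= _) |- _ => clear H
  | H : is_true (_ < _) |- _ => clear H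
  end; intros.
Ltac rnorm_lra := rnorm_gen; lra.
Ltac rnorm_nra := rnorm_gen; nra.

(** * Geometric convergence, differentials, mean value inequality *)

Section GeometricCauchy.
Context {R : realType}.
Local Notation C := (Cplx R).

(** The sequences v n - 2 K / 2 ^ n and v n + 2 K / 2 ^ n are respectively
    nondecreasing and nonincreasing, and enclose the limit. *)
Lemma real_geometric_cvg (v : nat -> R) (K : R) :
  (forall n, `|v n.+1 - v n| <= K * 2^-1 ^+ n) ->
  exists l, forall n, `|l - v n| <= 2 * K * 2^-1 ^+ n.
Proof.
move=> vK.
pose w n := v n - 2 * K * 2^-1 ^+ n; pose z n := v n + 2 * K * 2^-1 ^+ n.
have K0 : 0 <= K by have := vK 0%N; rewrite expr0 mulr1; apply: le_trans.
have ph k : 0 <= (2^-1 : R) ^+ k by rewrite exprn_ge0 // invr_ge0.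
have half : (2 : R)^-1 = 1 / 2 by rewrite div1r.
have wS n : w n <= w n.+1.
  by rewrite /w exprS; have := vK n; rewrite ler_norml; set p := _ ^+ n; rewrite half; lra.
have zS n : z n.+1 <= z n.
  by rewrite /z exprS; have := vK n; rewrite ler_norml; set p := _ ^+ n; rewrite half; lra.
have wh m n : (m <= n)%N -> w m <= w n.
  by apply: (@homo_leq _ w (fun x y => x <= y)) => // y x u; apply: le_trans.
have zh m n : (m <= n)%N -> z n <= z m.
  by apply: (@homo_leq _ z (fun x y => y <= x)) => // y x u yx uy; apply: le_trans uy yx.
have wz m n : w m <= z n.
  have wzn k : w k <= z k.
    by have := ph k; rewrite /w /z; nra.
  case: (leqP m n) => mn; first exact: le_trans (wh _ _ mn) (wzn n).
  exact: le_trans (wzn m) (zh _ _ (ltnW mn)).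
have hs : has_sup (range w).
  split; first by exists (w 0%N), 0%N.
  by exists (z 0%N) => _ [m _ <-].
exists (sup (range w)) => n.
have h1 : w n <= sup (range w) by apply: ub_le_sup; [case: hs|exists n].
have h2 : sup (range w) <= z n by apply: ge_sup; [case: hs|move=> _ [m _ <-]].
by rewrite ler_norml; move: h1 h2; rewrite /w /z; lra.
Qed.

Lemma rnorm_le_ReIm (z : C) : rnorm z <= `|complex.Re z| + `|complex.Im z|.
Proof.
have -> : rnorm z = rnorm (cofr (complex.Re z) + ('i%C : C) * cofr (complex.Im z)).
  by rewrite {1}(complexE z).
apply: le_trans (rnormD _ _) _; rewrite rnormM !rnorm_real /=.
have -> : rnorm ('i%C : C) = 1.
  by rewrite /rnorm normc_def /= expr0n expr1n add0r sqrtr1.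
by rewrite mul1r.
Qed.

Lemma Im_le_nr (z : C) : `|complex.Im z| <= rnorm z.
Proof.
rewrite -ler_cofr -rnormE normc_def /= /cofr lecR -sqrtr_sqr ler_sqrt ?lerDr ?sqr_ge0//.
by rewrite addr_ge0 ?sqr_ge0.
Qed.

Lemma normRe_le_nr (z : C) : `|complex.Re z| <= rnorm z.
Proof. by have := normc_ge_Re z; rewrite rnormE ler_cofr. Qed.

Lemma complex_geometric_cvg (v : nat -> C) (K : R) :
  (forall n, rnorm (v n.+1 - v n) <= K * 2^-1 ^+ n) ->
  exists l, forall n, rnorm (l - v n) <= 4 * K * 2^-1 ^+ n.
Proof.
move=> vK.
have [a aP] : exists l, forall n, `|l - complex.Re (v n)| <= 2 * K * 2^-1 ^+ n.
  apply: real_geometric_cvg => n; apply: le_trans (vK n).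
  by apply: le_trans (normRe_le_nr _); rewrite raddfB.
have [b bP] : exists l, forall n, `|l - complex.Im (v n)| <= 2 * K * 2^-1 ^+ n.
  apply: real_geometric_cvg => n; apply: le_trans (vK n).
  by apply: le_trans (Im_le_nr _); rewrite raddfB.
exists (Complex a b) => n; apply: le_trans (rnorm_le_ReIm _) _.
have := aP n; have := bP n.
case: (v n) => c d /=; set p := _ ^+ n; lra.
Qed.

Lemma mx_geometric_cvg p q (v : nat -> 'M[C]_(p, q)) (K : R) :
  (forall n, rnorm (v n.+1 - v n) <= K * 2^-1 ^+ n) ->
  exists l, forall n, rnorm (l - v n) <= 4 * K * 2^-1 ^+ n.
Proof.
move=> vK.
have K0 : 0 <= K by have := vK 0%N; rewrite expr0 mulr1; apply: le_trans; exact: rnorm_ge0.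
have ex i j : exists l, forall n, rnorm (l - v n i j) <= 4 * K * 2^-1 ^+ n.
  apply: complex_geometric_cvg => n; apply: le_trans (vK n).
  by apply: le_trans (rnorm_entry _ i j); rewrite !mxE.
pose L i j := sval (cid (ex i j)).
exists (\matrix_(i, j) L i j) => n; apply: rnorm_mx_le => [|i j].
  by rewrite !mulr_ge0 ?exprn_ge0 ?invr_ge0 ?ler0n.
by rewrite !mxE; exact: (svalP (cid (ex i j))).
Qed.

Lemma geometric_small (K e : R) : 0 < e -> exists n, K * 2^-1 ^+ n < e.
Proof.
move=> e0; have [K0|K0] := leP K 0.
  by exists 0%N; rewrite expr0 mulr1; exact: le_lt_trans e0.
have [n Kn] : exists n : nat, K / e < n%:R.
  exists (Num.bound (K / e)); have := archi_boundP (x := K / e).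
  by apply; rewrite divr_ge0 // ltW.
exists n; rewrite exprVn ltr_pdivrMr ?exprn_gt0 //.
rewrite ltr_pdivrMr // in Kn; rewrite mulrC; apply: lt_le_trans Kn _.
by rewrite ler_pM2r // -natrX ler_nat ltnW // ltn_expl.
Qed.

Lemma le_of_geometric (K e x : R) : 0 <= K -> (forall n, x <= e + K * 2^-1 ^+ n) -> x <= e.
Proof.
move=> K0 xn; rewrite leNgt; apply/negP => ex.
have [n] : exists n, K * 2^-1 ^+ n < x - e by apply: geometric_small; rewrite subr_gt0.
by have := xn n; lra.
Qed.

End GeometricCauchy.

Section Differentials.
Context {R : realType}.
Local Notation C := (Cplx R).

Lemma diff_rnorm (V W : normedModType C) (f : V -> W) (x : V) (e : R) :
  differentiable f x -> 0 < e -> exists2 d : R, 0 < d & forall y, rnorm (y - x) < d ->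
    rnorm (f y - f x - 'd f x (y - x)) <= e * rnorm (y - x).
Proof.
move=> /diff_locally/eqaddoP fx e0.
have /fx : (0 : C) < cofr e by rewrite -cofr0 ltr_cofr.
move=> /nbhs_rnormP[d d0 xd]; exists d => // y yx.
have := xd (y - x); rewrite subr0 => /(_ yx) /=.
rewrite !fctE /= subrK opprD addrA.
by rewrite !rnormE -cofrM ler_cofr.
Qed.

Lemma rnorm_diff (V W : normedModType C) (f : V -> W) (L : {linear V -> W}) (x : V) :
  continuous L ->
  (forall e : R, 0 < e -> exists2 d : R, 0 < d & forall y, rnorm (y - x) < d ->
    rnorm (f y - f x - L (y - x)) <= e * rnorm (y - x)) ->
  differentiable f x /\ 'd f x = L :> (V -> W).
Proof.
move=> Lc fL.
have fxL : f \o shift x = cst (f x) + L +o_ 0 id.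
  apply/eqaddoP => e e0; have re0 : 0 < complex.Re e by move: e0; rewrite ltcE => /andP[].
  have [d d0 xd] := fL _ re0.
  have -> : e = cofr (complex.Re e) by rewrite /cofr RRe_real // gtr0_real.
  apply/nbhs_rnormP; exists d => // y; rewrite subr0 => yd.
  have := xd (y + x); rewrite addrK => /(_ yd).
  by rewrite !fctE /= -addrA -opprD !rnormE -cofrM ler_cofr.
have dE := diff_unique Lc fxL.
split=> //; apply/diff_locallyP; rewrite dE; split=> //.
Qed.

End Differentials.

Section MeanValue.
Context {R : realType}.
Local Notation C := (Cplx R).

(** Along a real segment, and after taking real parts, a complex differential
    becomes a real derivative, within reach of the real mean value theorem. *)
Lemma is_derive_Re (V : normedModType C) (g : V -> C) (a w : V) (c : C) (t : R) :
  rnorm c <= 1 -> differentiable g (a + cofr t *: w) ->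
  is_derive t (1 : R) (fun s => complex.Re (c * g (a + cofr s *: w)) : R)
    (complex.Re (c * 'd g (a + cofr t *: w) w)).
Proof.
move=> c1; set x := a + cofr t *: w => gx; set phi := fun s : R => _.
set l := complex.Re _.
have cv : (fun h : R => h^-1 *: ((phi \o shift t) (h *: (1:R)) - phi t)) @ 0^' --> l.
  apply/cvgrPdist_le => e e0.
  have w0 : 0 < rnorm w + 1 by rewrite ltr_wpDl ?rnorm_ge0.
  have [d d0 xd] := diff_rnorm gx (divr_gt0 e0 w0).
  near=> h.
  have h0 : h != 0 by near: h; exact: nbhs_dnbhs_neq.
  have hd : `|h| < d / (rnorm w + 1).
    near: h; apply: nbhs_dnbhs; apply/nbhs_ballP; exists (d / (rnorm w + 1)) => /=.
      by rewrite divr_gt0.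
    by move=> y; rewrite /ball /= sub0r normrN.
  have yx : a + cofr (h + t) *: w - x = cofr h *: w.
    by rewrite /x cofrD scalerDl opprD addrACA subrr add0r addrK.
  have := xd (a + cofr (h + t) *: w); rewrite yx rnormZ rnorm_real.
  have hw : `|h| * rnorm w < d.
    rewrite ltr_pdivlMr // in hd; apply: le_lt_trans hd.
    by rewrite ler_wpM2l // lerDl.
  move=> /(_ hw) est; rewrite distrC /=.
  have -> : h^-1 *: (phi (h *: (1 : R) + t) - phi t) - l =
     h^-1 * complex.Re (c * (g (a + cofr (h + t) *: w) - g x - 'd g x (cofr h *: w))).
    rewrite linearZ /= !mulrBr !raddfB /= /phi -/x [h *: 1]mulr1.
    have -> (z : C) : complex.Re (c * (cofr h *: z)) = h * complex.Re (c * z).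
      by rewrite [cofr h *: z]mulrC mulrA mulrC; case: (c * z) => a' b' /=; rewrite mul0r subr0.
    by rewrite -/l [h^-1 * (_ - _)]mulrBr mulKf // mulrBr.
  rewrite normrM normfV ler_pdivrMl ?normr_gt0 //.
  apply: le_trans (normRe_le_nr _) _; rewrite rnormM.
  apply: le_trans (ler_wpM2r (rnorm_ge0 _) c1) _; rewrite mul1r.
  apply: le_trans est _.
  rewrite mulrCA ler_wpM2l // mulrAC ler_pdivrMr // ler_wpM2l ?ltW //.
  by rewrite ltrDl.
apply: DeriveDef; first by apply/cvg_ex; exists l.
exact: cvg_lim cv.
Unshelve. all: by end_near. Qed.

(** Multiplied by the conjugate of its phase, the increment is a real number,
    and the mean value theorem applies to its real part. *)
Lemma scalar_mean_value (V : normedModType C) (f : V -> C) (a b : V) (K : R) :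
  (forall t : R, 0 <= t <= 1 -> differentiable f (a + cofr t *: (b - a)) /\
     rnorm ('d f (a + cofr t *: (b - a)) (b - a)) <= K) ->
  rnorm (f b - f a) <= K.
Proof.
move=> fK; set z := f b - f a.
have [c [c1 cz]] : exists c : C, rnorm c = 1 /\ c * z = cofr (rnorm z).
  have [->|z0] := eqVneq z 0.
    by exists 1; rewrite mulr0 rnorm0 cofr0 -cofr1 rnorm_real normr1.
  have nz : rnorm z != 0 by apply: contra_neq z0; exact: rnorm_eq0.
  exists (cofr (rnorm z) / z); rewrite divfK // rnormM rnormV rnorm_real.
  by rewrite ger0_norm ?rnorm_ge0 // divff.
pose phi (s : R) := complex.Re (c * f (a + cofr s *: (b - a))).
have dg (t : R) : 0 <= t <= 1 -> is_derive t (1 : R) phi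
    (complex.Re (c * 'd f (a + cofr t *: (b - a)) (b - a))).
  by move=> /fK[dft _]; apply: is_derive_Re => //; rewrite c1.
have [|||s s01] := @MVT R phi
    (fun t => complex.Re (c * 'd f (a + cofr t *: (b - a)) (b - a))) 0 1.
- exact: ltr01.
- by move=> t; rewrite in_itv /= => /andP[t0 t1]; apply: dg; rewrite !ltW.
- apply: derivable_within_continuous => t; rewrite in_itv /= => t01.
  by case: (dg t t01).
move: s01; rewrite in_itv /= => /andP[s0 s1].
have -> : phi 1 - phi 0 = rnorm z.
  rewrite /phi cofr0 cofr1 scale0r scale1r addr0 [a + _]addrC subrK -raddfB /= -mulrBr.
  by rewrite cz.
rewrite subr0 mulr1 => ->; apply: le_trans (Re_le_nr _) _.
by rewrite rnormM c1 mul1r; apply: (fK s _).2; rewrite !ltW.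
Qed.

End MeanValue.

(** * Calculus of holomorphic maps *)

Section GenericCalculus.
Context {K : numFieldType}.

Lemma differentiable_near (V W : normedModType K) (f g : V -> W) (x : V) :
  (\near x, f x = g x) -> differentiable f x ->
  differentiable g x /\ forall v, 'D_v g x = 'D_v f x.
Proof.
move=> fg fx; have fgx := nbhs_singleton fg.
have E : g \o shift x = cst (g x) + 'd f x +o_ 0 id.
  apply/eqaddoP => e e0; have /eqaddoP/(_ e e0) h := diff_locally fx.
  have fg0 : \forall h \near 0, f (h + x) = g (h + x).
    by move: fg; rewrite (near_shift 0) subr0.
  by apply: filterS2 fg0 h => y; rewrite /= !fctE /= -fgx => ->.
have dE := diff_unique (diff_continuous fx) E.
have gx : differentiable g x by apply/diff_locallyP; rewrite dE; split=> //; exact: diff_continuous.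
by split=> // v; rewrite (deriveE v gx) (deriveE v fx) dE.
Qed.

Lemma differentiable_lin_comp (V W Z : normedModType K) (f : V -> W) (L : W -> Z)
    (x : V) : linear L -> continuous L -> differentiable f x ->
  differentiable (L \o f) x /\ forall v, 'D_v (L \o f) x = L ('D_v f x).
Proof.
move=> Llin Lc fx.
pose glM := GRing.isLinear.Build _ _ _ _ _ Llin.
pose gL : {linear _ -> _} := HB.pack L glM.
have dL y : differentiable L y by apply: (@linear_differentiable _ _ _ gL).
have dLf : differentiable (L \o f) x by exact: differentiable_comp.
split=> [|v]; first exact: dLf.
rewrite (deriveE v dLf) (deriveE v fx) (diff_comp fx (dL _)) /=.
by have E := @diff_lin K W Z gL (f x) Lc; rewrite E.
Qed.

Lemma derive_linear (V W : normedModType K) (f : V -> W) (x : V) a u v :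
  differentiable f x -> 'D_(a *: u + v) f x = a *: 'D_u f x + 'D_v f x.
Proof. by move=> fx; rewrite (deriveE _ fx) linearP -!(deriveE _ fx). Qed.

Lemma deriveZv (V W : normedModType K) (f : V -> W) (x : V) a u :
  differentiable f x -> 'D_(a *: u) f x = a *: 'D_u f x.
Proof. by move=> fx; rewrite (deriveE _ fx) linearZ -(deriveE _ fx). Qed.

Lemma deriveDv (V W : normedModType K) (f : V -> W) (x : V) u v :
  differentiable f x -> 'D_(u + v) f x = 'D_u f x + 'D_v f x.
Proof. by move=> fx; rewrite (deriveE _ fx) linearD -!(deriveE _ fx). Qed.

Lemma deriveBv (V W : normedModType K) (f : V -> W) (x : V) u v :
  differentiable f x -> 'D_(u - v) f x = 'D_u f x - 'D_v f x.
Proof. by move=> fx; rewrite (deriveE _ fx) linearB -!(deriveE _ fx). Qed.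

Lemma derive_sumv (V W : normedModType K) (f : V -> W) (x : V)
    (I : finType) (a : I -> K) (w : I -> V) :
  differentiable f x -> 'D_(\sum_i a i *: w i) f x = \sum_i a i *: 'D_(w i) f x.
Proof.
move=> fx; rewrite (deriveE _ fx) linear_sum; apply: eq_bigr => i _.
by rewrite linearZ (deriveE _ fx).
Qed.

Lemma derive_rowE n (W : normedModType K) (f : 'rV[K]_n -> W) x (v : 'rV[K]_n) :
  differentiable f x -> 'D_v f x = \sum_j v 0 j *: 'D_(delta_mx 0 j) f x.
Proof.
move=> fx; rewrite {1}(row_sum_delta v) (deriveE _ fx) linear_sum.
by apply: eq_bigr => j _; rewrite linearZ (deriveE _ fx).
Qed.

Lemma derive_comp (U V W : normedModType K) (f : U -> V) (g : V -> W) (x : U) v :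
  differentiable f x -> differentiable g (f x) ->
  'D_v (g \o f) x = 'D_('D_v f x) g (f x).
Proof.
move=> fx gx; rewrite (deriveE v (differentiable_comp fx gx)).
by rewrite (deriveE v fx) (deriveE _ gx) (diff_comp fx gx).
Qed.

Lemma differentiable_fsum (V W : normedModType K) (I : Type) (r : seq I)
    (F : I -> V -> W) x : (forall i, differentiable (F i) x) ->
  differentiable (fun y => \sum_(i <- r) F i y) x /\
  forall v, 'D_v (fun y => \sum_(i <- r) F i y) x = \sum_(i <- r) 'D_v (F i) x.
Proof.
move=> dF; elim: r => [|i r [IH1 IH2]].
  have -> : (fun y => \sum_(i <- [::]) F i y) = cst 0 :> (V -> W).
    by apply/funext => y; rewrite big_nil.
  by split=> [|v]; [exact: differentiable_cst|rewrite derive_cst big_nil].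
have -> : (fun y => \sum_(j <- i :: r) F j y) =
   F i + (fun y => \sum_(j <- r) F j y) :> (V -> W).
  by apply/funext => y; rewrite big_cons.
split; first exact: differentiableD.
by move=> v; rewrite big_cons deriveD ?IH2 //; exact: diff_derivable.
Qed.

Lemma differentiable_scalarM (V : normedModType K) (f g : V -> K) x :
  differentiable f x -> differentiable g x ->
  differentiable (fun y => f y * g y) x /\
  forall v, 'D_v (fun y => f y * g y) x = 'D_v f x * g x + f x * 'D_v g x.
Proof.
move=> fx gx; have fg : differentiable (f * g) x by exact: differentiableM.
split=> [|v]; first exact: fg.
have -> : (fun y => f y * g y) = f * g by [].
rewrite (deriveM (diff_derivable fx) (diff_derivable gx)).
by rewrite addrC; congr (_ + _); rewrite -[LHS]mulrC.
Qed.

Lemma entry_linear m n i j : linear (fun M : 'M[K]_(m, n) => M i j : K).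
Proof. by move=> a u v; rewrite !mxE. Qed.

Lemma differentiable_entry (V : normedModType K) m n (f : V -> 'M[K]_(m, n)) x i j :
  differentiable f x ->
  differentiable (fun y => f y i j : K) x /\
  forall v, 'D_v (fun y => f y i j : K) x = ('D_v f x) i j.
Proof.
move=> fx; apply: (differentiable_lin_comp (entry_linear i j)) => //.
exact: coord_continuous.
Qed.

Lemma mx_differentiable (V : normedModType K) m n (f : V -> 'M[K]_(m, n)) x :
  (forall i j, differentiable (fun y => f y i j : K) x) -> differentiable f x.
Proof.
move=> fx; have -> : f = (fun y => \sum_i \sum_j f y i j *: delta_mx i j).
  by apply/funext => y; exact: matrix_sum_delta.
apply: (proj1 (differentiable_fsum _ _)) => i.
apply: (proj1 (differentiable_fsum _ _)) => j.
exact: differentiableZl.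
Qed.

Lemma differentiable_scale (V : normedModType K) m n (f : V -> K)
    (g : V -> 'M[K]_(m, n)) x :
  differentiable f x -> differentiable g x ->
  differentiable (fun y => f y *: g y) x /\
  forall v, 'D_v (fun y => f y *: g y) x = 'D_v f x *: g x + f x *: 'D_v g x.
Proof.
move=> fx gx; have E i j : (fun y => (f y *: g y) i j : K) = (fun y => f y * g y i j).
  by apply/funext => y; rewrite mxE.
have dij i j := differentiable_scalarM fx (differentiable_entry i j gx).1.
have dfg : differentiable (fun y => f y *: g y) x.
  by apply: mx_differentiable => i j; rewrite E; exact: (dij i j).1.
split=> [|v]; first exact: dfg.
apply/matrixP => i j; rewrite -(proj2 (differentiable_entry i j dfg) v) E.
by rewrite (dij i j).2 (differentiable_entry i j gx).2 !mxE.
Qed.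

Lemma differentiable_mulmx (V : normedModType K) m n p (f : V -> 'M[K]_(m, n))
    (g : V -> 'M[K]_(n, p)) x :
  differentiable f x -> differentiable g x ->
  differentiable (fun y => f y *m g y) x /\
  forall v, 'D_v (fun y => f y *m g y) x = 'D_v f x *m g x + f x *m 'D_v g x.
Proof.
move=> fx gx.
pose F i j k := fun y => f y i k * g y k j.
have FE y i j : (f y *m g y) i j = \sum_k F i j k y by rewrite mxE.
have dF i j k : differentiable (F i j k) x /\ forall v, 'D_v (F i j k) x =
    ('D_v f x) i k * g x k j + f x i k * ('D_v g x) k j.
  have [f1 f2] := differentiable_entry i k fx.
  have [g1 g2] := differentiable_entry k j gx.
  have [h1 h2] := differentiable_scalarM f1 g1.
  by split=> // v; rewrite h2 f2 g2.
have dfg : differentiable (fun y => f y *m g y) x.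
  apply: mx_differentiable => i j.
  have -> : (fun y => (f y *m g y) i j : K) = (fun y => \sum_k F i j k y).
    by apply/funext => y; exact: FE.
  by apply: (proj1 (differentiable_fsum _ _)) => k; case: (dF i j k).
split=> // v; apply/matrixP => i j.
rewrite -(proj2 (differentiable_entry i j dfg) v).
have -> : (fun y => (f y *m g y) i j : K) = (fun y => \sum_k F i j k y).
  by apply/funext => y; exact: FE.
rewrite (proj2 (differentiable_fsum _ _)); last by move=> k; case: (dF i j k).
rewrite !mxE -big_split; apply: eq_bigr => k _ /=.
by rewrite (proj2 (dF i j k)).
Qed.

End GenericCalculus.

Section Calculus.
Context {R : realType}.
Local Notation C := (Cplx R).

(** A linear map on matrices is bounded by the sum of the norms of its values
    on the elementary matrices. *)
Lemma lin_mx_continuous m n (W : normedModType C) (L : 'M[C]_(m, n) -> W) :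
  linear L -> continuous L.
Proof.
move=> Llin.
pose glM := GRing.isLinear.Build _ _ _ _ _ Llin.
pose gL : {linear _ -> _} := HB.pack L glM.
have Lb M : rnorm (L M) <= (\sum_i \sum_j rnorm (L (delta_mx i j))) * rnorm M.
  rewrite [M in X in X <= _]matrix_sum_delta -[L]/(gL : _ -> _) linear_sum mulr_suml.
  apply: le_trans (rnorm_sum _) _; apply: ler_sum => i _; rewrite linear_sum mulr_suml.
  apply: le_trans (rnorm_sum _) _; apply: ler_sum => j _; rewrite linearZ rnormZ mulrC.
  by rewrite ler_wpM2l ?rnorm_ge0 ?rnorm_entry.
move: (\sum_i _) Lb => K Lb x; apply/continuous_rnormP => e e0.
have K1 : 0 < `|K| + 1 by rewrite ltr_wpDl.
exists (e / (`|K| + 1)); first by rewrite divr_gt0.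
move=> y yx; have -> : L y - L x = L (y - x) by rewrite -[L]/(gL : _ -> _) raddfB.
rewrite ltr_pdivlMr // in yx; apply: le_lt_trans yx; apply: le_trans (Lb _) _.
by rewrite mulrC ler_wpM2l ?rnorm_ge0 // (le_trans (ler_norm K)) // lerDl.
Qed.

Lemma mx_mean_value (V : normedModType C) m n (f : V -> 'M[C]_(m, n)) (a b : V) (K : R) :
  (forall t : R, 0 <= t <= 1 -> differentiable f (a + cofr t *: (b - a)) /\
     rnorm ('D_(b - a) f (a + cofr t *: (b - a))) <= K) ->
  rnorm (f b - f a) <= K.
Proof.
move=> fK; have K0 : 0 <= K.
  by have [_] := fK 0 (introT andP (conj (lexx 0) ler01)); apply: le_trans; exact: rnorm_ge0.
apply: rnorm_mx_le => // i j; rewrite !mxE.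
apply: (@scalar_mean_value _ _ (fun y => f y i j)) => t t01.
have [ft fK'] := fK t t01; have [fij fv] := differentiable_entry i j ft.
split=> //; rewrite -deriveE // fv; apply: le_trans fK'; exact: rnorm_entry.
Qed.

End Calculus.

Section Hol.
Context {R : realType}.
Local Notation C := (Cplx R).
Local Notation hol := holomorphic_upto.
Implicit Types (V W Z : normedModType C).

Lemma hol_eq V W k (A : set V) (f g : V -> W) : open A ->
  (forall x, A x -> f x = g x) -> hol k A f -> hol k A g.
Proof.
move=> oA; have nearA x (f' g' : V -> W) : (forall x, A x -> f' x = g' x) ->
    A x -> \near x, f' x = g' x.
  by move=> fg Ax; apply: filterS (open_nbhs_nbhs (conj oA Ax)) => y; exact: fg.
elim: k f g => [|k IH] f g fg /=.
  move=> fc x Ax; rewrite /prop_for /continuous_at -(fg x Ax).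
  apply: cvg_trans (fc x Ax); apply: near_eq_cvg.
  by have := nearA x _ _ fg Ax; apply: filterS => y ->.
move=> [df Df]; split=> [x Ax|v].
  by case: (differentiable_near (nearA x _ _ fg Ax) (df x Ax)).
apply: IH (Df v) => x Ax.
by case: (differentiable_near (nearA x _ _ fg Ax) (df x Ax)).
Qed.

Lemma hol_sub V W k (A B : set V) (f : V -> W) : B `<=` A -> hol k A f -> hol k B f.
Proof.
move=> BA; elim: k f => [|k IH] f /=; first by move=> h x /BA; exact: h.
by move=> [df Df]; split=> [x /BA|v]; [exact: df|exact: IH].
Qed.

Lemma hol_S V W k (A : set V) (f : V -> W) : hol k.+1 A f -> hol k A f.
Proof.
elim: k f => [|k IH] f [df Df].
  by move=> x /df; exact: differentiable_continuous.
by split=> // v; apply: IH; exact: Df.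
Qed.

Lemma hol_cst V W k (A : set V) (c : W) : hol k A (cst c).
Proof.
elim: k c => [|k IH] c /=; first by move=> x _; exact: cst_continuous.
split=> [x _|v]; first exact: differentiable_cst.
by have -> : (fun x : V => 'D_v (cst c) x) = cst 0 by apply/funext => x; exact: derive_cst.
Qed.

Lemma holD V W k (A : set V) (f g : V -> W) : open A ->
  hol k A f -> hol k A g -> hol k A (fun x => f x + g x).
Proof.
move=> oA; elim: k f g => [|k IH] f g /=.
  by move=> fc gc x Ax; apply: continuousD; [exact: fc|exact: gc].
move=> [df Df] [dg Dg]; split=> [x Ax|v]; first exact: differentiableD (df x Ax) (dg x Ax).
apply: hol_eq oA _ (IH _ _ (Df v) (Dg v)) => x Ax.
by rewrite (@deriveD _ _ _ f g) //; apply: diff_derivable; [exact: df|exact: dg].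
Qed.

Lemma hol_sum V W k (A : set V) (I : Type) (r : seq I) (F : I -> V -> W) : open A ->
  (forall i, hol k A (F i)) -> hol k A (fun x => \sum_(i <- r) F i x).
Proof.
move=> oA hF; elim: r => [|i r IH].
  by apply: hol_eq oA _ (hol_cst k A 0) => x _; rewrite big_nil.
by apply: hol_eq oA _ (holD oA (hF i) IH) => x _; rewrite big_cons.
Qed.

Lemma hol_lin V W Z k (A : set V) (f : V -> W) (L : W -> Z) : open A ->
  linear L -> continuous L -> hol k A f -> hol k A (L \o f).
Proof.
move=> oA Ll Lc; elim: k f => [|k IH] f /=.
  by move=> fc x Ax; apply: continuous_comp; [exact: fc|exact: Lc].
move=> [df Df]; split=> [x Ax|v]; first by case: (differentiable_lin_comp Ll Lc (df x Ax)).
apply: hol_eq oA _ (IH _ (Df v)) => x Ax.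
by rewrite /= (proj2 (differentiable_lin_comp Ll Lc (df x Ax))).
Qed.

Lemma hol_id V k (A : set V) : open A -> hol k A id.
Proof.
move=> oA; case: k => [|k] /=; first by move=> x _; exact: cvg_id.
split=> [x _|v]; first exact: (@ex_diff _ _ _ _ _ _ _ (is_diff_id x)).
by apply: hol_eq oA _ (hol_cst k A v) => x _; rewrite derive_id.
Qed.

Lemma holM V k (A : set V) (f g : V -> C) : open A ->
  hol k A f -> hol k A g -> hol k A (fun x => f x * g x).
Proof.
move=> oA; elim: k f g => [|k IH] f g hf hg.
  by move=> x Ax; apply: continuousM; [exact: hf|exact: hg].
have [df Df] := hf; have [dg Dg] := hg; split=> [x Ax|v].
  exact: (proj1 (differentiable_scalarM (df x Ax) (dg x Ax))).
have h := holD oA (IH _ _ (Df v) (hol_S hg)) (IH _ _ (hol_S hf) (Dg v)).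
apply: hol_eq oA _ h => x Ax.
by rewrite (proj2 (differentiable_scalarM (df x Ax) (dg x Ax))).
Qed.

Lemma hol_entry V m n k (A : set V) (f : V -> 'M[C]_(m, n)) i j : open A ->
  hol k A f -> hol k A (fun x => f x i j : C).
Proof.
by move=> oA; apply: (hol_lin oA (entry_linear i j)); exact: coord_continuous.
Qed.

Lemma hol_Zl V W k (A : set V) (f : V -> C) (c : W) : open A ->
  hol k A f -> hol k A (fun x => f x *: c).
Proof.
move=> oA; apply: (@hol_lin V C W k A f (fun a => a *: c) oA).
  by move=> a u v /=; rewrite scalerDl scalerA.
exact: scalel_continuous.
Qed.

Lemma hol_mx V m n k (A : set V) (f : V -> 'M[C]_(m, n)) : open A ->
  (forall i j, hol k A (fun x => f x i j : C)) -> hol k A f.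
Proof.
move=> oA hf; have h : hol k A (fun y => \sum_i \sum_j f y i j *: (delta_mx i j : 'M[C]_(m, n))).
  by apply: hol_sum => // i; apply: hol_sum => // j; exact: hol_Zl.
by apply: hol_eq oA _ h => x _; rewrite -matrix_sum_delta.
Qed.

Lemma hol_mulmx V m n p k (A : set V) (f : V -> 'M[C]_(m, n)) (g : V -> 'M[C]_(n, p)) :
  open A -> hol k A f -> hol k A g -> hol k A (fun x => f x *m g x).
Proof.
move=> oA hf hg; apply: hol_mx => // i j.
have h : hol k A (fun x => \sum_l f x i l * g x l j : C).
  by apply: hol_sum => // l; apply: holM => //; exact: hol_entry.
by apply: hol_eq oA _ h => x _; rewrite mxE.
Qed.

Lemma hol_scale V m n k (A : set V) (f : V -> C) (g : V -> 'M[C]_(m, n)) :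
  open A -> hol k A f -> hol k A g -> hol k A (fun x => f x *: g x).
Proof.
move=> oA hf hg; apply: hol_mx => // i j.
by apply: hol_eq oA _ (holM oA hf (hol_entry i j oA hg)) => x _; rewrite mxE.
Qed.

Lemma hol_prod V k (A : set V) (I : Type) (r : seq I) (F : I -> V -> C) : open A ->
  (forall i, hol k A (F i)) -> hol k A (fun x => \prod_(i <- r) F i x).
Proof.
move=> oA hF; elim: r => [|i r IH].
  by apply: hol_eq oA _ (hol_cst k A (1 : C)) => x _; rewrite big_nil.
by apply: hol_eq oA _ (holM oA (hF i) IH) => x _; rewrite big_cons.
Qed.

Lemma hol_det V n k (A : set V) (f : V -> 'M[C]_n) : open A ->
  hol k A f -> hol k A (fun x => \det (f x) : C).
Proof.
move=> oA hf; apply: hol_sum => // s; apply: holM => //; first exact: hol_cst.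
by apply: hol_prod => // i; exact: hol_entry.
Qed.

Lemma holV V k (A : set V) (f : V -> C) : open A -> (forall x, A x -> f x != 0) ->
  hol k A f -> hol k A (fun x => (f x)^-1).
Proof.
move=> oA f0; elim: k => [|k IH] hf.
  by move=> x Ax; apply: continuousV; [exact: f0|exact: hf].
have [df Df] := hf; split=> [x Ax|v]; first exact: differentiableV (df x Ax) (f0 x Ax).
have h := holM oA (holM oA (hol_cst k A (-1 : C)) (Df v)) (holM oA (IH (hol_S hf)) (IH (hol_S hf))).
apply: hol_eq oA _ h => x Ax /=.
rewrite deriveV; [|exact: f0|exact/diff_derivable/df].
by rewrite /cst mulN1r mulNr mulrC scaleNr expr2 invfM.
Qed.

Lemma hol_invmx V n k (A : set V) (f : V -> 'M[C]_n) : open A ->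
  (forall x, A x -> f x \in unitmx) -> hol k A f -> hol k A (fun x => invmx (f x)).
Proof.
move=> oA fU hf.
have h : hol k A (fun x => (\det (f x))^-1 *: \adj (f x)).
  have d0 x : A x -> \det (f x) != 0 by move=> /fU; rewrite unitmxE unitfE.
  apply: (hol_scale oA (holV oA d0 (hol_det oA hf))).
  apply: (@hol_mx V n n k A (fun x => \adj (f x)) oA) => i j.
  have h : hol k A (fun x => cofactor (f x) j i : C).
    apply: holM => //; first exact: hol_cst.
    apply: hol_det => //; apply: hol_mx => // i' j'.
    by apply: hol_eq oA _ (hol_entry (lift j i') (lift i j') oA hf) => x _; rewrite !mxE.
  by apply: hol_eq oA _ h => x _; rewrite mxE.
by apply: hol_eq oA _ h => x Ax; rewrite /invmx fU.
Qed.

(** By the chain rule, the derivatives of the composite are combinations of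
    composites with the partial derivatives of [g]. *)
Lemma hol_comp V p q n k (A : set V) (B : set 'rV[C]_n) (f : V -> 'rV[C]_n)
    (g : 'rV[C]_n -> 'M[C]_(p, q)) : open A -> f @` A `<=` B ->
  hol k A f -> hol k B g -> hol k A (g \o f).
Proof.
move=> oA AB; elim: k g => [|k IH] g hf hg.
  move=> x Ax; apply: continuous_comp; first exact: hf.
  by apply: hg; apply: AB; exists x.
have [df Df] := hf; have [dg Dg] := hg.
have Bf x : A x -> B (f x) by move=> Ax; apply: AB; exists x.
split=> [x Ax|v]; first exact: differentiable_comp (df x Ax) (dg _ (Bf x Ax)).
have h : hol k A (fun x => \sum_j ('D_v f x) 0 j *: 'D_(delta_mx 0 j) g (f x)).
  apply: hol_sum => // j; apply: (@hol_scale V p q k A (fun x => 'D_v f x 0 j)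
     ('D_(delta_mx 0 j) g \o f)) => //.
    by apply: hol_entry => //; exact: Df.
  by apply: IH; [exact: hol_S|exact: Dg].
apply: hol_eq oA _ h => x Ax.
by rewrite (derive_comp v (df x Ax) (dg _ (Bf x Ax))) (derive_rowE _ (dg _ (Bf x Ax))).
Qed.

End Hol.

(** * The inverse function theorem *)

(** Row i is the derivative along the i-th basis vector, so that a differential
    acts on row vectors by multiplication on the right. *)
HB.lock Definition jac (R : realType) m n (f : 'rV[Cplx R]_m -> 'rV[Cplx R]_n)
    (x : 'rV[Cplx R]_m) : 'M[Cplx R]_(m, n) :=
  \matrix_(i, j) ('D_(delta_mx 0 i) f x) 0 j.
Arguments jac {R m n} f x.

Section InverseFunction.
Context {R : realType}.
Local Notation C := (Cplx R).
Local Notation hol := holomorphic_upto.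

Lemma derive_rnorm (V W : normedModType C) (f : V -> W) (x : V) (e : R) :
  differentiable f x -> 0 < e -> exists2 d : R, 0 < d & forall y, rnorm (y - x) < d ->
    rnorm (f y - f x - 'D_(y - x) f x) <= e * rnorm (y - x).
Proof.
move=> fx e0; have [d d0 xd] := diff_rnorm fx e0; exists d => // y yd.
have E := deriveE (y - x) fx; rewrite E; exact: xd.
Qed.

Lemma rnorm_derive_mx m n (f : 'rV[C]_m -> 'rV[C]_n) (G : 'M[C]_(m, n)) x :
  (forall e : R, 0 < e -> exists2 d : R, 0 < d & forall y, rnorm (y - x) < d ->
    rnorm (f y - f x - (y - x) *m G) <= e * rnorm (y - x)) ->
  differentiable f x /\ forall v, 'D_v f x = v *m G.
Proof.
move=> fG.
have [fx E] := @rnorm_diff R _ _ f (mulmxr G) x (lin_mx_continuous (linearP _)) fG.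
split=> // v; rewrite (deriveE v fx); exact: (congr1 (fun h => h v) E).
Qed.

Lemma derive_jac m n (f : 'rV[C]_m -> 'rV[C]_n) x v :
  differentiable f x -> 'D_v f x = v *m jac f x.
Proof.
move=> fx; rewrite (derive_rowE v fx); apply/rowP => j.
by rewrite summxE mxE jac.unlock; apply: eq_bigr => i _; rewrite !mxE.
Qed.

Lemma hol_jac m n (f : 'rV[C]_m -> 'rV[C]_n) (A : set 'rV[C]_m) k : open A ->
  hol k.+1 A f -> hol k A (jac f).
Proof.
move=> oA [_ Df]; apply: hol_mx => // i j.
apply: hol_eq oA _ (hol_entry 0 j oA (Df (delta_mx 0 i))) => x _.
by rewrite jac.unlock mxE.
Qed.

Lemma unit_inj n (J : 'M[C]_n) : (forall v : 'rV[C]_n, v *m J = 0 -> v = 0) ->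
  J \in unitmx.
Proof. by move=> Ji; rewrite -row_free_unit; exact: inj_row_free. Qed.

Section Local.
Variables (n : nat) (f : 'rV[C]_n -> 'rV[C]_n) (U : set 'rV[C]_n) (x0 : 'rV[C]_n).
Hypotheses (U_open : open U) (f_hol : holomorphic U f) (Ux0 : U x0).
Hypothesis jac_inj : forall v, 'D_v f x0 = 0 -> v = 0.

Let df x : U x -> differentiable f x. Proof. exact: (f_hol 1).1. Qed.
Let A := invmx (jac f x0).

Let J0_unit : jac f x0 \in unitmx.
Proof. by apply: unit_inj => v; rewrite -(derive_jac v (df Ux0)); exact: jac_inj. Qed.

Let J0A : jac f x0 *m A = 1%:M. Proof. exact: mulmxV J0_unit. Qed.
Let AJ0 : A *m jac f x0 = 1%:M. Proof. exact: mulVmx J0_unit. Qed.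

Lemma jac_near : exists2 rho : R, 0 < rho & forall x, nball x0 rho x ->
  U x /\ n%:R * rnorm (1%:M - jac f x *m A) <= 1 / 2.
Proof.
have hU : hol 0 U (fun x => 1%:M + (-1 : C) *: (jac f x *m A)).
  have hm := hol_mulmx U_open (hol_jac U_open (f_hol 1)) (hol_cst 0 U A).
  exact: (holD U_open (hol_cst 0 U 1%:M) (hol_scale U_open (hol_cst 0 U (-1 : C)) hm)).
have e0 : 0 < 1 / 2 / (n%:R + 1) :> R by rewrite !divr_gt0 // ltr_wpDl.
have /(@continuous_rnormP R)/(_ _ e0)[d d0 xd] := hU x0 Ux0.
have /open_rnormP/(_ _ Ux0)[d' d'0 xd'] := U_open.
exists (Num.min d d'); first by rewrite lt_min d0.
move=> x; rewrite /nball /= lt_min => /andP[/xd h1 /xd' ?]; split=> //.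
rewrite /cst J0A !scaleN1r subrr subr0 in h1.
apply: (@le_trans _ _ ((n%:R + 1) * (1 / 2 / (n%:R + 1)))); last first.
  by rewrite mulrC divfK // gt_eqF // ltr_wpDl.
by rewrite ler_pM ?rnorm_ge0 // ?lerDl // ltW.
Qed.

(** The fixed points of x |-> phi x + y A are the solutions of f x = y. *)
Let phi x := x - f x *m A.

(** The differential of [phi] is 1 - J A, where A inverts the value of the
    Jacobian J at the centre. *)
Lemma newton_contraction (rho : R) : (forall x, nball x0 rho x ->
    U x /\ n%:R * rnorm (1%:M - jac f x *m A) <= 1 / 2) ->
  forall x y, nball x0 rho x -> nball x0 rho y ->
  rnorm (phi y - phi x) <= 1 / 2 * rnorm (y - x).
Proof.
move=> rhoP x y xr yr; apply: mx_mean_value => t t01.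
have [Uz hz] := rhoP _ (convex_nball t01 xr yr).
move: (x + cofr t *: (y - x)) Uz hz => z Uz hz.
have did : differentiable (id : 'rV[C]_n -> _) z := @ex_diff _ _ _ _ _ _ _ (is_diff_id z).
have dcA : differentiable (cst A : 'rV[C]_n -> _) z := differentiable_cst _ _.
have [d1 d2] := differentiable_mulmx (df Uz) dcA.
split; first exact: differentiableB.
have -> : 'D_(y - x) phi z = (y - x) *m (1%:M - jac f z *m A).
  rewrite /phi (deriveB (diff_derivable did) (diff_derivable d1)) d2 derive_id.
  by rewrite derive_cst mulmx0 addr0 (derive_jac _ (df Uz)) mulmxBr mulmx1 mulmxA.
apply: le_trans (rnorm_mulmx _ _) _; rewrite mulrCA mulrC.
by rewrite ler_wpM2r ?rnorm_ge0.
Qed.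

(** As [phi] halves distances, the identity
    y - x = (phi y - phi x) + (f y - f x) A makes [f] expanding. *)
Lemma expansion_bound : exists2 L : R, 0 < L & forall rho : R,
  (forall x, nball x0 rho x -> U x /\ n%:R * rnorm (1%:M - jac f x *m A) <= 1 / 2) ->
  (forall u : 'rV[C]_n, rnorm (u *m A) <= L / 2 * rnorm u) /\
  forall x y, nball x0 rho x -> nball x0 rho y ->
  rnorm (y - x) <= L * rnorm (f y - f x).
Proof.
pose L := 2 * (n%:R * rnorm A) + 1.
have LA (u : 'rV[C]_n) : rnorm (u *m A) <= L / 2 * rnorm u.
  by apply: le_trans (rnorm_mulmx _ _) _; have := rnorm_ge0 u; rewrite /L; lra.
exists L; first by rewrite ltr_wpDl // !mulr_ge0 ?rnorm_ge0.
move=> rho rhoP; split; first exact: LA.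
move=> x y xr yr; have h := newton_contraction rhoP xr yr.
have e : y - x = (phi y - phi x) + (f y - f x) *m A.
  rewrite /phi mulmxBl; move: (f y *m A) (f x *m A) => P Q.
  by apply/rowP => j; rewrite !mxE; ring.
have := rnormD (phi y - phi x) ((f y - f x) *m A); rewrite -e.
by move: h (LA (f y - f x)); rnorm_lra.
Qed.

(** The iterates of x |-> phi x + y A from the centre stay in the ball, for
    their k-th step is at most s / 2 ^ k with 4 s < rho. *)
Lemma local_solution (rho L r : R) (y : 'rV[C]_n) : 0 < rho -> 0 < L ->
  (forall x, nball x0 rho x -> U x /\ n%:R * rnorm (1%:M - jac f x *m A) <= 1 / 2) ->
  (forall u : 'rV[C]_n, rnorm (u *m A) <= L / 2 * rnorm u) ->
  2 * L * r <= rho -> nball (f x0) r y -> exists2 x, nball x0 rho x & f x = y.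
Proof.
move=> rho0 L0 rhoP LA Lr yr; have ctr := newton_contraction rhoP.
pose T x := phi x + y *m A.
have [u [u0 uS]] : exists u : nat -> 'rV[C]_n, u 0%N = x0 /\ forall k, u k.+1 = T (u k).
  by exists (fun k => iter k T x0).
have [s sE] : exists s, s = rnorm (u 1%N - x0) by eexists.
have TB a b : T a - T b = phi a - phi b
  by rewrite /T; move: (phi a) (phi b) (y *m A) => p q z; apply/rowP => j; rewrite !mxE; ring.
have s_small : 4 * s < rho.
  have -> : s = rnorm ((y - f x0) *m A).
    by rewrite sE uS u0 /T /phi mulmxBl addrAC [x0 - _ - _]addrAC subrr sub0r addrC.
  have := LA (y - f x0); move: yr L0 Lr; rewrite /nball /=; rnorm_nra.
have s0 : 0 <= s by rewrite sE; exact: rnorm_ge0.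
have half_ge0 k : 0 <= (2^-1 : R) ^+ k by rewrite exprn_ge0 // invr_ge0.
have uk k : nball x0 rho (u k) /\ rnorm (u k - x0) <= 2 * s * (1 - 2^-1 ^+ k) /\
   nball x0 rho (u k.+1) /\ rnorm (u k.+1 - u k) <= s * 2^-1 ^+ k.
  elim: k => [|k [H1 [H2 [H3 H4]]]].
    rewrite expr0 (subrr (1 : R)) mulr0 mulr1 u0 (subrr x0) rnorm0; split; first exact: nballxx.
    by split=> //; split; rewrite /nball /= -sE //; move: s_small s0; rnorm_lra.
  have e : 2^-1 ^+ k.+1 = 1 / 2 * 2^-1 ^+ k :> R by rewrite exprS div1r.
  have b1 : rnorm (u k.+1 - x0) <= 2 * s * (1 - 2^-1 ^+ k.+1).
    by have := rnorm_tri (u k.+1) (u k) x0; rewrite e; move: H2 H4; rnorm_lra.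
  have b2 : rnorm (u k.+2 - u k.+1) <= s * 2^-1 ^+ k.+1.
    have -> : u k.+2 - u k.+1 = phi (u k.+1) - phi (u k) by rewrite -TB -!uS.
    by have := ctr _ _ H1 H3; rewrite e; move: H4; rnorm_lra.
  split; first exact: H3.
  split; first exact: b1.
  split; last exact: b2.
  rewrite /nball /=.
  have := rnorm_tri (u k.+2) (u k.+1) x0; have := half_ge0 k.+1.
  move: b1 b2 s_small s0; move: (_ ^+ k.+1); rnorm_nra.
have [l lP] := mx_geometric_cvg (fun k => (uk k).2.2.2).
have lr : nball x0 rho l.
  have := lP 0%N; rewrite expr0 mulr1 u0 => h; rewrite /nball /=; move: h s_small; rnorm_lra.
exists l; first exact: lr.
have lT : rnorm (l - T l) <= 0.
  apply: (@le_of_geometric _ (4 * s)) => [|k]; first lra.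
  have h1 := lP k; have h2 := lP k.+1; rewrite exprS in h2.
  have h3 := ctr _ _ lr (uk k).1; have := rnorm_tri l (u k.+1) (T l).
  have -> : u k.+1 - T l = phi (u k) - phi l.
    by rewrite -TB -uS.
  rewrite rnormBC in h1; have : (2 : R)^-1 = 1 / 2 by rewrite div1r.
  by move=> hh; rewrite {1}hh in h2; move: h1 h2 h3; move: (_ ^+ k); rnorm_lra.
have /eqP := rnorm_eq0 (le_anti (introT andP (conj lT (rnorm_ge0 _)))).
rewrite /T /phi opprD opprB addrA addrCA subrr addr0 -mulmxBl => /eqP h.
have := congr1 (fun v => v *m jac f x0) h.
by rewrite -mulmxA AJ0 mulmx1 mul0mx => /eqP; rewrite subr_eq0 => /eqP.
Qed.

(** If v J = 0 then v = v (1 - J A), whose norm is at most half that of v. *)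
Lemma jac_unit_near (rho : R) : (forall x, nball x0 rho x ->
    U x /\ n%:R * rnorm (1%:M - jac f x *m A) <= 1 / 2) ->
  forall x, nball x0 rho x -> jac f x \in unitmx.
Proof.
move=> rhoP x /rhoP[Ux h]; apply: unit_inj => v vJ.
have e : v = v *m (1%:M - jac f x *m A) by rewrite mulmxBr mulmx1 mulmxA vJ mul0mx subr0.
have := rnorm_mulmx v (1%:M - jac f x *m A); rewrite -e mulrCA.
have := rnorm_ge0 v => v0 hh; apply: rnorm_eq0; move: v0 hh h; move: (n%:R : R); rnorm_nra.
Qed.

(** Once the inverse is known to be Lipschitz, it is differentiable with
    differential v |-> v J^-1 taken at the inverse image; this formula then
    raises its order of differentiability step by step. *)
Theorem inverse_function : exists rho r : R, exists g : 'rV[C]_n -> 'rV[C]_n,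
  [/\ 0 < rho /\ 0 < r, nball x0 rho `<=` U,
      (forall x, nball x0 rho x -> g (f x) = x),
      (forall y, nball (f x0) r y -> nball x0 rho (g y) /\ f (g y) = y) &
      holomorphic (nball (f x0) r) g].
Proof.
have [rho rho0 rhoP] := jac_near.
have [L L0 LP] := expansion_bound; have [LA Lip] := LP _ rhoP.
pose r := rho / (2 * L).
have L20 : 0 < 2 * L by rewrite mulr_gt0.
have r0 : 0 < r by rewrite divr_gt0.
have sol y : nball (f x0) r y -> exists2 x, nball x0 rho x & f x = y.
  by apply: (local_solution rho0 L0 rhoP LA); rewrite /r mulrC divfK // gt_eqF.
pose P y := [set x | nball x0 rho x /\ f x = y].
pose g y := xget x0 (P y).
have gP y : nball (f x0) r y -> P y (g y).
  by move=> /sol[x xr fx]; apply: (@xgetPex _ x0 (P y)); exists x.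
have gf x : nball x0 rho x -> g (f x) = x.
  move=> xr; have [gr fg] : P (f x) (g (f x)) by apply: (@xgetPex _ x0 (P (f x))); exists x.
  have := Lip _ _ xr gr; rewrite fg subrr rnorm0 mulr0 => h.
  by apply/eqP; rewrite -subr_eq0; apply/eqP/rnorm_eq0/le_anti; rewrite h rnorm_ge0.
have dg y : nball (f x0) r y ->
    differentiable g y /\ forall v, 'D_v g y = v *m invmx (jac f (g y)).
  move=> yr; have [xr fgy] := gP y yr; have [Ux _] := rhoP _ xr.
  set x := g y in xr fgy Ux *; set G := invmx _.
  have JG : jac f x *m G = 1%:M by exact: mulmxV (jac_unit_near rhoP xr).
  apply: rnorm_derive_mx => e e0.
  pose c := n%:R * rnorm G * L + 1.
  have c0 : 0 < c by rewrite ltr_wpDl // !mulr_ge0 ?rnorm_ge0 // ltW.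
  have [d d0 xd] := derive_rnorm (df Ux) (divr_gt0 e0 c0).
  have /open_rnormP/(_ _ yr)[d' d'0 yd'] := @open_nball R _ (f x0) r.
  exists (Num.min (d / L) d'); first by rewrite lt_min divr_gt0.
  move=> y'; rewrite lt_min ltr_pdivlMr // => /andP[yy' /yd' y'r].
  have [zr fgz] := gP y' y'r; rewrite -/x; set z := g y' in zr fgz *.
  have lip := Lip _ _ xr zr; rewrite fgy fgz in lip.
  have /xd : rnorm (z - x) < d by apply: le_lt_trans lip _; rewrite mulrC.
  rewrite fgy fgz (derive_jac _ (df Ux)) => est.
  have -> : z - x - (y' - y) *m G = - ((y' - y - (z - x) *m jac f x) *m G).
    by rewrite [in RHS]mulmxBl -(mulmxA (z - x)) JG mulmx1 opprB.
  rewrite rnormN; apply: le_trans (rnorm_mulmx _ _) _.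
  have eL : rnorm (y' - y - (z - x) *m jac f x) <= e / c * (L * rnorm (y' - y)).
    by apply: le_trans est _; rewrite ler_wpM2l // ltW // divr_gt0.
  have nG0 : 0 <= n%:R * rnorm G by rewrite mulr_ge0 ?rnorm_ge0.
  apply: (@le_trans _ _ (n%:R * rnorm G * (e / c * (L * rnorm (y' - y))))).
    rewrite [rnorm _ * rnorm G]mulrC (mulrA n%:R); exact: ler_wpM2l nG0 _ _ eL.
  have -> : n%:R * rnorm G * (e / c * (L * rnorm (y' - y))) =
            n%:R * rnorm G * L / c * (e * rnorm (y' - y)) by ring.
  rewrite ler_piMl ?mulr_ge0 ?rnorm_ge0 // ?ltW //.
  by rewrite ltr_pdivrMr // mul1r ltrDl.
exists rho, r, g; split=> //.
  by move=> x /rhoP[].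
move=> k; elim: k => [|k IH]; first by move=> y /dg[gy _]; exact: differentiable_continuous.
split=> [y /dg[]//|v].
have oB := @open_nball R _ (f x0) r; have oA := @open_nball R _ x0 rho.
have h : hol k (nball (f x0) r) ((fun x => v *m invmx (jac f x)) \o g).
  apply: (@hol_comp _ _ _ _ _ _ _ (nball x0 rho)) => //.
    by move=> _ [y /gP[? _] <-].
  apply: hol_mulmx => //; first exact: hol_cst.
  apply: (hol_invmx oA); first exact: jac_unit_near.
  apply: hol_jac => //; apply: (@hol_sub _ _ _ _ U); last exact: f_hol.
  by move=> x /rhoP[].
by apply: hol_eq oB _ h => y /dg[_ ->].
Qed.

End Local.
End InverseFunction.

(** * Local Lipschitz and Taylor bounds *)

Section Primitive.
Context {R : realType}.
Local Notation C := (Cplx R).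
Local Notation hol := holomorphic_upto.

(** Partial derivatives are bounded near [x0] by continuity, and the mean value
    inequality concludes on every small ball. *)
Lemma local_lipschitz n p q (f : 'rV[C]_n -> 'M[C]_(p, q)) (U : set 'rV[C]_n) x0 :
  open U -> U x0 -> hol 1 U f ->
  exists2 K : R, 0 <= K & \forall r \near (0 : R)^'+, forall x y,
    nball x0 r x -> nball x0 r y -> rnorm (f y - f x) <= K * rnorm (y - x).
Proof.
move=> oU Ux0 [df Df].
pose K : R := \sum_j (rnorm ('D_(delta_mx 0 j) f x0) + 1).
have K0 : 0 <= K by apply: sumr_ge0 => j _; rewrite addr_ge0 ?rnorm_ge0.
have near1 : \forall x \near x0, forall j : 'I_n,
    rnorm ('D_(delta_mx 0 j) f x) <= rnorm ('D_(delta_mx 0 j) f x0) + 1.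
  apply: (@filter_forall _ _ (fun (j : 'I_n) x => rnorm ('D_(delta_mx 0 j) f x) <=
    rnorm ('D_(delta_mx 0 j) f x0) + 1) _ (nbhs_filter x0)) => j.
  have [d d0 xd] := iffLR (continuous_rnormP _ _) (Df (delta_mx 0 j) x0 Ux0) 1 ltr01.
  have : nbhs x0 (nball x0 d) by exact: nball_nbhs.
  apply: filterS => y /xd h.
  exact: (rnorm_leD (ltW h)).
have near2 : nbhs x0 U by exact: open_nbhs_nbhs.
have [r r0 rP] := iffLR (nbhs_rnormP _ _) (filterI near1 near2).
exists K => //; near=> s.
have sr : s <= r by near: s; exact: nbhs_right_le.
move=> x y xs ys; apply: mx_mean_value => t t01.
have := convex_nball t01 xs ys; move: (x + _) => z; rewrite /nball /= => zs.
have [h Uz] := rP z (lt_le_trans zs sr); split; first exact: df.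
rewrite (derive_rowE _ (df _ Uz)) mulr_suml; apply: le_trans (rnorm_sum _) _.
apply: ler_sum => j _; rewrite rnormZ mulrC ler_pM ?rnorm_ge0 ?rnorm_entry //.
Unshelve. all: by end_near. Qed.

(** The mean value inequality for z |-> f z - 'D_z f x, whose derivative at z
    is controlled by the Lipschitz bound on the partial derivatives of [f]. *)
Lemma local_taylor n p q (f : 'rV[C]_n -> 'M[C]_(p, q)) (U : set 'rV[C]_n) x0 :
  open U -> U x0 -> hol 2 U f ->
  exists2 K : R, 0 <= K & \forall r \near (0 : R)^'+, forall x y,
    nball x0 r x -> nball x0 r y ->
    rnorm (f y - f x - 'D_(y - x) f x) <= K * rnorm (y - x) ^+ 2.
Proof.
move=> oU Ux0 [df Df].
have lip j := local_lipschitz oU Ux0 (Df (delta_mx 0 j)).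
pose k j : R := s2val (cid2 (lip j)).
have k0 j : 0 <= k j by exact: (s2valP (cid2 (lip j))).
pose K := \sum_j k j.
exists K; first exact: sumr_ge0.
have /nbhs_rnormP[r0 r00 rP] : nbhs x0 U by exact: open_nbhs_nbhs.
have lipr : \forall r \near (0 : R)^'+, forall j x y, nball x0 r x -> nball x0 r y ->
    rnorm ('D_(delta_mx 0 j) f y - 'D_(delta_mx 0 j) f x) <= k j * rnorm (y - x).
  by apply: filter_forall => j; exact: (s2valP' (cid2 (lip j))).
near=> r.
have rr0 : r <= r0 by near: r; exact: nbhs_right_le.
have liprr : forall j x y, nball x0 r x -> nball x0 r y ->
    rnorm ('D_(delta_mx 0 j) f y - 'D_(delta_mx 0 j) f x) <= k j * rnorm (y - x) by near: r.
move=> x y xr yr.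
have rU z : nball x0 r z -> U z by move=> zr; apply: rP; exact: lt_le_trans zr rr0.
pose L (z : 'rV[C]_n) := 'D_z f x.
have Llin : linear L by move=> a u v; exact: derive_linear (df _ (rU _ xr)).
have did z : differentiable (id : 'rV[C]_n -> _) z := @ex_diff _ _ _ _ _ _ _ (is_diff_id z).
have dL z := differentiable_lin_comp Llin (lin_mx_continuous Llin) (did z).
pose g z := f z - (L \o id) z.
have -> : f y - f x - 'D_(y - x) f x = g y - g x.
  rewrite -[X in _ - X]/(L (y - x)) /g /=.
  have -> : L (y - x) = L y - L x.
    exact: deriveBv (df _ (rU _ xr)).
  move: (L y) (L x) (f y) (f x) => a b c d.
  by apply/matrixP => i j; rewrite !mxE; ring.
apply: mx_mean_value => t t01.
have zx : rnorm (x + cofr t *: (y - x) - x) <= rnorm (y - x).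
  rewrite addrC addKr rnormZ rnorm_real; move/andP: t01 => [t0 t1].
  by rewrite ger0_norm // ler_piMl ?rnorm_ge0.
have := convex_nball t01 xr yr; move: (x + _) zx => z zx zr.
split; first exact: differentiableB (df _ (rU _ zr)) (dL z).1.
have -> : 'D_(y - x) g z = 'D_(y - x) f z - 'D_(y - x) f x.
  have E := deriveB (diff_derivable (df _ (rU _ zr))) (diff_derivable (dL z).1).
  by rewrite -[g]/(f - (L \o id)) E (dL z).2 derive_id.
rewrite (derive_rowE _ (df _ (rU _ zr))) (derive_rowE _ (df _ (rU _ xr))).
rewrite -sumrB expr2 mulr_suml; apply: le_trans (rnorm_sum _) _.
apply: ler_sum => j _; rewrite -scalerBr rnormZ mulrA mulrC.
rewrite ler_pM ?rnorm_ge0 ?rnorm_entry //; apply: le_trans (liprr j _ _ xr zr) _.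
by rewrite ler_wpM2l.
Unshelve. all: by end_near. Qed.

End Primitive.

(** * Primitives of closed holomorphic forms *)

Section Primitive.
Context {R : realType}.
Local Notation C := (Cplx R).
Local Notation hol := holomorphic_upto.
Variables (n m : nat).
Local Notation V := 'rV[C]_n.

Definition midpoint (a b : V) : V := cofr (1 / 2) *: (a + b).

Lemma half_half : cofr (1 / 2) + cofr (1 / 2) = 1 :> C.
Proof. by rewrite -cofrD -cofr1; congr cofr; lra. Qed.

Lemma midpointC a b : midpoint a b = midpoint b a.
Proof. by rewrite /midpoint addrC. Qed.

Lemma midpointBl a b : midpoint a b - a = cofr (1 / 2) *: (b - a).
Proof.
rewrite -[X in _ - X]scale1r -half_half; apply/rowP => j; rewrite !mxE; ring.
Qed.

Lemma midpointBr a b : b - midpoint a b = cofr (1 / 2) *: (b - a).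
Proof.
rewrite -[X in X - _]scale1r -half_half; apply/rowP => j; rewrite !mxE; ring.
Qed.

Lemma rnorm_half (W : normedModType C) (v : W) : rnorm (cofr (1 / 2) *: v) = 1 / 2 * rnorm v.
Proof. by rewrite rnormZ rnorm_real ger0_norm //; lra. Qed.

Lemma midpoint_ball (c a b : V) r : nball c r a -> nball c r b -> nball c r (midpoint a b).
Proof.
move=> ar br; have := @convex_nball R _ c a b r (1 / 2) _ ar br.
rewrite -midpointBl addrC subrK; apply; apply/andP; split; lra.
Qed.

Variable B : V -> 'M[C]_(n, m).

(** The midpoint rule for the line integral of the form v |-> v B(x) over the
    segment from a to b, cut into 2^k equal parts. *)
Fixpoint segment_sum k a b : 'rV[C]_m :=
  if k is k'.+1 then segment_sum k' a (midpoint a b) + segment_sum k' (midpoint a b) b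
  else (b - a) *m B (midpoint a b).

Lemma segment_sumN k a b : segment_sum k b a = - segment_sum k a b.
Proof.
elim: k a b => [|k IH] a b /=; first by rewrite midpointC -mulNmx opprB.
by rewrite (midpointC b a) (IH (midpoint a b) b) (IH a) opprD addrC.
Qed.

Definition triangle_sum k a b c :=
  segment_sum k a b + segment_sum k b c + segment_sum k c a.

(** The midpoints cut a triangle into four; the inner edges are run through in
    both directions, and their contributions cancel. *)
Lemma triangle_sumS k a b c : triangle_sum k.+1 a b c =
  triangle_sum k a (midpoint a b) (midpoint c a) +
  triangle_sum k (midpoint a b) b (midpoint b c) +
  triangle_sum k (midpoint c a) (midpoint b c) c +
  triangle_sum k (midpoint a b) (midpoint b c) (midpoint c a).
Proof.
rewrite /triangle_sum /=.
move: (segment_sum k) (@segment_sumN k) => I IN.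
move: (midpoint a b) (midpoint b c) (midpoint c a) => p q s.
rewrite (IN p q) (IN q s) (IN s p).
move: (I a p) (I p b) (I b q) (I q c) (I c s) (I s a) (I p q) (I q s) (I s p) => *.
by apply/rowP => j; rewrite !mxE; ring.
Qed.

Variables (x0 : V) (r K : R).
Hypotheses (K0 : 0 <= K) (r0 : 0 < r).
Hypothesis B_diff : forall x, nball x0 r x -> differentiable B x.
Hypothesis B_lip : forall x y, nball x0 r x -> nball x0 r y ->
  rnorm (B y - B x) <= K * rnorm (y - x).
Hypothesis B_taylor : forall x y, nball x0 r x -> nball x0 r y ->
  rnorm (B y - B x - 'D_(y - x) B x) <= K * rnorm (y - x) ^+ 2.
Hypothesis B_closed : forall x u v, nball x0 r x -> v *m 'D_u B x = u *m 'D_v B x.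

Let c1 := n%:R * K.
Let c1_ge0 : 0 <= c1. Proof. by rewrite mulr_ge0. Qed.

Lemma mul_lip (u : V) x y : nball x0 r x -> nball x0 r y ->
  rnorm (u *m B y - u *m B x) <= c1 * (rnorm u * rnorm (y - x)).
Proof.
move=> xr yr; rewrite -mulmxBr; apply: le_trans (rnorm_mulmx _ _) _.
rewrite /c1 -mulrA ler_wpM2l // mulrCA ler_wpM2l ?rnorm_ge0 //; exact: B_lip.
Qed.

(** Cutting in two divides the square of the length by 4 and doubles the number
    of segments, hence a geometric decay of ratio 1/2. *)
Lemma segment_sum_cauchy k a b : nball x0 r a -> nball x0 r b ->
  rnorm (segment_sum k.+1 a b - segment_sum k a b) <= c1 * rnorm (b - a) ^+ 2 * 2^-1 ^+ k.
Proof.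
elim: k a b => [|k IH] a b ar br; have mr := midpoint_ball ar br.
  rewrite expr0 mulr1 /=; set mid := midpoint a b in mr *.
  have -> : (mid - a) *m B (midpoint a mid) + (b - mid) *m B (midpoint mid b)
      - (b - a) *m B mid =
    (mid - a) *m B (midpoint a mid) - (mid - a) *m B mid +
    ((b - mid) *m B (midpoint mid b) - (b - mid) *m B mid).
    have -> : (b - a) *m B mid = (mid - a) *m B mid + (b - mid) *m B mid.
      by rewrite -mulmxDl [mid - a + _]addrC addrA subrK.
    by rewrite opprD addrACA.
  apply: le_trans (rnormD _ _) _.
  have h1 := mul_lip (mid - a) mr (midpoint_ball ar mr).
  have h2 := mul_lip (b - mid) mr (midpoint_ball mr br).
  have ma : rnorm (mid - a) = 1 / 2 * rnorm (b - a) by rewrite midpointBl rnorm_half.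
  have mb : rnorm (b - mid) = 1 / 2 * rnorm (b - a) by rewrite midpointBr rnorm_half.
  rewrite (rnormBC (midpoint a mid)) midpointBr rnorm_half ma in h1.
  rewrite (midpointBl mid) rnorm_half mb in h2.
  move: h1 h2; have := rnorm_ge0 (b - a); move: (rnorm (b - a)) => N N0 h1 h2.
  apply: le_trans (lerD h1 h2) _.
  have : 0 <= c1 * N ^+ 2 by rewrite mulr_ge0 // sqr_ge0.
  by clear h1 h2; rewrite expr2; lra.
have -> : segment_sum k.+2 a b - segment_sum k.+1 a b =
  (segment_sum k.+1 a (midpoint a b) - segment_sum k a (midpoint a b)) +
  (segment_sum k.+1 (midpoint a b) b - segment_sum k (midpoint a b) b).
  by rewrite [RHS]addrACA -opprD.
apply: le_trans (rnormD _ _) _; apply: le_trans (lerD (IH _ _ ar mr) (IH _ _ mr br)) _.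
rewrite midpointBl midpointBr rnorm_half (exprS _ k) -div1r.
move: (_ ^+ k) (rnorm _) => p N; lra.
Qed.

Lemma segment_sum_lim a b : exists l, nball x0 r a -> nball x0 r b ->
  forall k, rnorm (l - segment_sum k a b) <= 4 * (c1 * rnorm (b - a) ^+ 2) * 2^-1 ^+ k.
Proof.
have [[ar br]|nab] := pselect (nball x0 r a /\ nball x0 r b); last by exists 0 => ar br; case: nab.
have [l lP] := mx_geometric_cvg (fun k => segment_sum_cauchy k ar br).
by exists l.
Qed.

Definition segment_int a b : 'rV[C]_m := sval (cid (segment_sum_lim a b)).

Lemma segment_intP k a b : nball x0 r a -> nball x0 r b ->
  rnorm (segment_int a b - segment_sum k a b) <= 4 * (c1 * rnorm (b - a) ^+ 2) * 2^-1 ^+ k.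
Proof. by move=> ar br; exact: (svalP (cid (segment_sum_lim a b))). Qed.

Lemma segment_int_approx a b : nball x0 r a -> nball x0 r b ->
  rnorm (segment_int a b - (b - a) *m B a) <= 5 * c1 * rnorm (b - a) ^+ 2.
Proof.
move=> ar br; have mr := midpoint_ball ar br.
have h1 := segment_intP 0 ar br; have h2 := mul_lip (b - a) ar mr.
rewrite midpointBl rnorm_half in h2; rewrite expr0 mulr1 in h1.
apply: le_trans (rnorm_tri _ (segment_sum 0 a b) _) _.
apply: le_trans (lerD h1 h2) _; have := rnorm_ge0 (b - a).
move: (rnorm (b - a)) => N N0; have : 0 <= c1 * N ^+ 2 by rewrite mulr_ge0 // sqr_ge0.
by clear h1 h2; rewrite expr2; lra.
Qed.

(** In the first order expansion of the form at [a], the constant part sums to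
    zero on any triangle, and the linear part because the form is closed; what
    remains is the quadratic error multiplied by the length of the sides. *)
Lemma triangle_sum0_bound a b c d : nball x0 r a -> nball x0 r b -> nball x0 r c ->
  rnorm (b - a) <= d -> rnorm (c - b) <= d -> rnorm (a - c) <= d ->
  rnorm (triangle_sum 0 a b c) <= 3 * c1 * d ^+ 3.
Proof.
move=> ar br cr ba cb ac.
have d0 : 0 <= d by apply: le_trans ba; exact: rnorm_ge0.
pose E y := B y - B a - 'D_(y - a) B a.
have BE y : B y = B a + 'D_(y - a) B a + E y.
  by rewrite /E addrACA subrr addr0 [B a + _]addrC subrK.
have ED y (u : V) : nball x0 r y -> rnorm (y - a) <= d -> rnorm u <= d ->
    rnorm (u *m E y) <= c1 * d ^+ 3.
  move=> yr ya ud; apply: le_trans (rnorm_mulmx _ _) _; rewrite /c1 -mulrA ler_wpM2l //.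
  have := B_taylor ar yr; rewrite -/(E y) => h.
  rewrite exprS mulrCA ler_pM ?rnorm_ge0 //; apply: le_trans h _.
  by rewrite ler_wpM2l // !expr2 ler_pM ?rnorm_ge0.
have key : triangle_sum 0 a b c = (b - a) *m E (midpoint a b) +
    (c - b) *m E (midpoint b c) + (a - c) *m E (midpoint c a).
  rewrite /triangle_sum /= !(BE (midpoint _ _)).
  move: (E (midpoint a b)) (E (midpoint b c)) (E (midpoint c a)) => E1 E2 E3.
  have -> : midpoint a b - a = cofr (1 / 2) *: (b - a) by exact: midpointBl.
  have -> : midpoint c a - a = cofr (1 / 2) *: (c - a).
    by rewrite midpointC; exact: midpointBl.
  have -> : midpoint b c - a = cofr (1 / 2) *: ((b - a) + (c - a)).
    rewrite -[X in _ - X]scale1r -half_half; apply/rowP => j; rewrite !mxE; ring.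
  have -> : c - b = (c - a) - (b - a) by rewrite opprB addrA subrK.
  have -> : a - c = - (c - a) by rewrite opprB.
  move: (b - a) (c - a) => p q.
  have da := B_diff ar.
  rewrite !(deriveZv _ _ da) (deriveDv _ _ da).
  have := B_closed p q ar; move: ('D_p B a) ('D_q B a) (B a) => Dp Dq Ba pq.
  rewrite !mulmxDr !mulNmx !mulmxBl -!scalemxAr !mulmxDr pq.
  move: (p *m Ba) (q *m Ba) (p *m Dp) (p *m Dq) (q *m Dq)
    (p *m E1) (p *m E2) (q *m E2) (q *m E3) => *.
  by apply/rowP => j; rewrite !mxE; ring.
rewrite key.
have mab : rnorm (midpoint a b - a) <= d.
  by rewrite midpointBl rnorm_half; move: ba d0 (rnorm_ge0 (b - a)); rnorm_lra.
have mca : rnorm (midpoint c a - a) <= d.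
  by rewrite rnormBC midpointBr rnorm_half; move: ac d0 (rnorm_ge0 (a - c)); rnorm_lra.
have mbc : rnorm (midpoint b c - a) <= d.
  have -> : midpoint b c - a = cofr (1 / 2) *: ((b - a) + (c - a)).
    rewrite -[X in _ - X]scale1r -half_half; apply/rowP => j; rewrite !mxE; ring.
  rewrite rnorm_half; have := rnormD (b - a) (c - a); rewrite [rnorm (c - a)]rnormBC.
  by move: ba ac; rnorm_lra.
have h1 := ED _ _ (midpoint_ball ar br) mab ba.
have h2 := ED _ _ (midpoint_ball br cr) mbc cb.
have h3 := ED _ _ (midpoint_ball cr ar) mca ac.
have -> : 3 * c1 * d ^+ 3 = c1 * d ^+ 3 + c1 * d ^+ 3 + c1 * d ^+ 3 by ring.
apply: le_trans (rnormD _ _) (lerD _ h3).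
exact: le_trans (rnormD _ _) (lerD h1 h2).
Qed.

(** Goursat's argument: at depth k there are 4 ^ k triangles of size d / 2 ^ k,
    each contributing a cube of its size. *)
Lemma triangle_sum_bound k a b c d : nball x0 r a -> nball x0 r b -> nball x0 r c ->
  rnorm (b - a) <= d -> rnorm (c - b) <= d -> rnorm (a - c) <= d ->
  rnorm (triangle_sum k a b c) <= 3 * c1 * d ^+ 3 * 2^-1 ^+ k.
Proof.
elim: k a b c d => [|k IH] a b c d ar br cr ba cb ac.
  by rewrite expr0 mulr1; exact: triangle_sum0_bound.
rewrite triangle_sumS.
have rab := midpoint_ball ar br; have rbc := midpoint_ball br cr; have rca := midpoint_ball cr ar.
have hf (v : V) : rnorm v <= d -> rnorm (cofr (1 / 2) *: v) <= 1 / 2 * d.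
  by rewrite rnorm_half => ?; rewrite ler_wpM2l //; lra.
have e1 : midpoint c a - midpoint a b = cofr (1 / 2) *: (c - b).
  by apply/rowP => j; rewrite !mxE; ring.
have e2 : midpoint a b - midpoint b c = cofr (1 / 2) *: (a - c).
  by apply/rowP => j; rewrite !mxE; ring.
have e3 : midpoint b c - midpoint c a = cofr (1 / 2) *: (b - a).
  by apply/rowP => j; rewrite !mxE; ring.
have f1 := hf _ ba; have f2 := hf _ cb; have f3 := hf _ ac.
have m1 u v : rnorm (cofr (1 / 2) *: (v - u)) <= 1 / 2 * d -> rnorm (midpoint u v - u) <= 1 / 2 * d.
  by rewrite midpointBl.
have m2 u v : rnorm (cofr (1 / 2) *: (v - u)) <= 1 / 2 * d -> rnorm (v - midpoint u v) <= 1 / 2 * d.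
  by rewrite midpointBr.
have g1 : rnorm (midpoint c a - midpoint a b) <= 1 / 2 * d by rewrite e1; exact: f2.
have g2 : rnorm (midpoint a b - midpoint b c) <= 1 / 2 * d by rewrite e2; exact: f3.
have g3 : rnorm (midpoint b c - midpoint c a) <= 1 / 2 * d by rewrite e3; exact: f1.
pose w := 3 * c1 * (1 / 2 * d) ^+ 3 * 2^-1 ^+ k.
have h1 : rnorm (triangle_sum k a (midpoint a b) (midpoint c a)) <= w.
  exact: (IH _ _ _ _ ar rab rca (m1 a b f1) g1 (m2 c a f3)).
have h2 : rnorm (triangle_sum k (midpoint a b) b (midpoint b c)) <= w.
  exact: (IH _ _ _ _ rab br rbc (m2 a b f1) (m1 b c f2) g2).
have h3 : rnorm (triangle_sum k (midpoint c a) (midpoint b c) c) <= w.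
  exact: (IH _ _ _ _ rca rbc cr g3 (m2 b c f2) (m1 c a f3)).
have h4 : rnorm (triangle_sum k (midpoint a b) (midpoint b c) (midpoint c a)) <= w.
  rewrite rnormBC in g1; rewrite rnormBC in g2; rewrite rnormBC in g3.
  exact: (IH _ _ _ _ rab rbc rca g2 g3 g1).
have -> : 3 * c1 * d ^+ 3 * 2^-1 ^+ k.+1 = w + w + w + w.
  by rewrite /w (exprS _ k) -div1r; move: (_ ^+ k) => p; field.
apply: le_trans (rnormD _ _) (lerD _ h4).
apply: le_trans (rnormD _ _) (lerD _ h3).
exact: le_trans (rnormD _ _) (lerD h1 h2).
Qed.

(** The triangle sums over [x0], [x], [y] tend to zero. *)
Lemma segment_int_additive x y : nball x0 r x -> nball x0 r y ->
  segment_int x0 y - segment_int x0 x = segment_int x y.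
Proof.
move=> xr yr; have r00 := nballxx x0 r0.
apply/eqP; rewrite -subr_eq0; apply/eqP/rnorm_eq0/le_anti/andP; split; last exact: rnorm_ge0.
pose d := rnorm (x - x0) + rnorm (y - x) + rnorm (x0 - y).
have [N1 [N2 N3]] := conj (rnorm_ge0 (x - x0)) (conj (rnorm_ge0 (y - x)) (rnorm_ge0 (x0 - y))).
have d1 : rnorm (x - x0) <= d by rewrite /d; lra.
have d2 : rnorm (y - x) <= d by rewrite /d; lra.
have d3 : rnorm (x0 - y) <= d by rewrite /d; lra.
clearbody d; clear N1 N2 N3.
pose M := 4 * (c1 * rnorm (y - x0) ^+ 2) + 4 * (c1 * rnorm (x - x0) ^+ 2) +
  4 * (c1 * rnorm (y - x) ^+ 2) + 3 * c1 * d ^+ 3.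
have dd : 0 <= d by apply: le_trans d1; exact: rnorm_ge0.
have sq (t : R) : 0 <= 4 * (c1 * t ^+ 2).
  by apply: mulr_ge0 => //; apply: mulr_ge0 => //; exact: sqr_ge0.
apply: (@le_of_geometric _ M) => [|k].
  by rewrite !addr_ge0 // !mulr_ge0 // exprn_ge0.
have h1 := segment_intP k r00 yr; have h2 := segment_intP k r00 xr.
have h3 := segment_intP k xr yr; have h4 := triangle_sum_bound k r00 xr yr d1 d2 d3.
have -> : segment_int x0 y - segment_int x0 x - segment_int x y =
  (segment_int x0 y - segment_sum k x0 y) - (segment_int x0 x - segment_sum k x0 x)
  - (segment_int x y - segment_sum k x y) - triangle_sum k x0 x y.
  rewrite /triangle_sum (segment_sumN k x0 y).
  move: (segment_int x0 y) (segment_int x0 x) (segment_int x y) => p1 p2 p3.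
  move: (segment_sum k x0 y) (segment_sum k x0 x) (segment_sum k x y) => q1 q2 q3.
  by apply/rowP => j; rewrite !mxE; ring.
rewrite add0r.
rewrite /M; do 3 rewrite (mulrDl _ _ (2^-1 ^+ k)).
apply: le_trans (rnormB _ _) (lerD _ h4).
apply: le_trans (rnormB _ _) (lerD _ h3).
exact: le_trans (rnormB _ _) (lerD h1 h2).
Qed.

Lemma primitive_derive x : nball x0 r x -> differentiable (segment_int x0) x /\
  forall v, 'D_v (segment_int x0) x = v *m B x.
Proof.
move=> xr; apply: rnorm_derive_mx => e e0.
have /open_rnormP/(_ _ xr)[d d0 xd] := @open_nball R _ x0 r.
have c50 : 0 < 5 * c1 + 1 by rewrite ltr_wpDl // mulr_ge0.
exists (Num.min d (e / (5 * c1 + 1))); first by rewrite lt_min d0 divr_gt0.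
move=> y; rewrite lt_min => /andP[/xd yr]; rewrite ltr_pdivlMr // => ye.
rewrite (segment_int_additive xr yr); apply: le_trans (segment_int_approx xr yr) _.
have := rnorm_ge0 (y - x); move: ye; move: (rnorm (y - x)) => N ye N0.
rewrite expr2 mulrA ler_wpM2r //; apply: le_trans (ltW ye).
by rewrite mulrDr mulr1 mulrC lerDl.
Qed.

End Primitive.

Theorem closed_form_primitive (R : realType) n m (B : 'rV[Cplx R]_n -> 'M[Cplx R]_(n, m))
    (U : set 'rV[Cplx R]_n) x0 :
  open U -> U x0 -> holomorphic U B ->
  (forall x u v, U x -> v *m 'D_u B x = u *m 'D_v B x) ->
  exists2 r : R, 0 < r & exists2 P : 'rV[Cplx R]_n -> 'rV[Cplx R]_m,
    nball x0 r `<=` U & forall x, nball x0 r x ->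
      differentiable P x /\ forall v, 'D_v P x = v *m B x.
Proof.
move=> oU Ux0 hB cB.
have [K1 K10 lip] := local_lipschitz oU Ux0 (hB 1).
have [K2 K20 tay] := local_taylor oU Ux0 (hB 2).
have [d d0 dU] := iffLR (nbhs_rnormP x0 U) (open_nbhs_nbhs (conj oU Ux0)).
have [r [r0 rd lipr tayr]] : exists r : R, [/\ 0 < r, r <= d,
    (forall x y, nball x0 r x -> nball x0 r y -> rnorm (B y - B x) <= K1 * rnorm (y - x)) &
    (forall x y, nball x0 r x -> nball x0 r y ->
       rnorm (B y - B x - 'D_(y - x) B x) <= K2 * rnorm (y - x) ^+ 2)].
  have : \forall r \near (0 : R)^'+, 0 < r /\ r <= d.
    by near=> s; split; near: s; [exact: nbhs_right_gt|exact: nbhs_right_le].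
  by move=> /filterI/(_ lip)/filterI/(_ tay)/filter_ex[r [[[? ?] ?] ?]]; exists r.
have rU : nball x0 r `<=` U by move=> x xr; apply: dU; exact: lt_le_trans xr rd.
have K0 : 0 <= K1 + K2 by exact: addr_ge0.
have lip' x y : nball x0 r x -> nball x0 r y -> rnorm (B y - B x) <= (K1 + K2) * rnorm (y - x).
  move=> xr yr; apply: le_trans (lipr x y xr yr) _.
  by rewrite ler_wpM2r ?rnorm_ge0 // lerDl.
have tay' x y : nball x0 r x -> nball x0 r y ->
    rnorm (B y - B x - 'D_(y - x) B x) <= (K1 + K2) * rnorm (y - x) ^+ 2.
  move=> xr yr; apply: le_trans (tayr x y xr yr) _.
  by rewrite ler_wpM2r ?sqr_ge0 // lerDr.
have dB x : nball x0 r x -> differentiable B x by move=> /rU; exact: (hB 1).1.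
have cB' x u v : nball x0 r x -> v *m 'D_u B x = u *m 'D_v B x by move=> /rU; exact: cB.
exists r => //; eexists; first exact: rU.
exact: (primitive_derive K0 r0 dB lip' tay' cB').
Unshelve. all: by end_near. Qed.

(** * Semi-simple commutative algebras *)

Section BilinearProduct.
Variables (K : fieldType) (n : nat).
Local Notation vect := 'rV[K]_n.
Variable mu : vect -> vect -> vect.
Hypothesis mu_lin : forall a u v w, mu (a *: u + v) w = a *: mu u w + mu v w.

Let mu_linear w : linear (mu^~ w). Proof. by move=> a u v; rewrite mu_lin. Qed.
Let muL w : {linear vect -> vect} :=
  HB.pack (mu^~ w) (GRing.isLinear.Build _ _ _ _ _ (mu_linear w)).

Lemma muDl u v w : mu (u + v) w = mu u w + mu v w.
Proof. exact: (linearD (muL w)). Qed.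
Lemma muBl u v w : mu (u - v) w = mu u w - mu v w.
Proof. exact: (linearB (muL w)). Qed.
Lemma muZl a u w : mu (a *: u) w = a *: mu u w.
Proof. exact: (linearZZ (muL w)). Qed.
Lemma mu0l w : mu 0 w = 0.
Proof. exact: (linear0 (muL w)). Qed.
Lemma mu_suml (I : finType) (F : I -> vect) w : mu (\sum_i F i) w = \sum_i mu (F i) w.
Proof. exact: (linear_sum (muL w)). Qed.

Definition mult_mx v : 'M[K]_n := \matrix_i mu (delta_mx 0 i) v.

Lemma mult_mxE u v : u *m mult_mx v = mu u v.
Proof.
rewrite mulmx_sum_row [in RHS](row_sum_delta u) mu_suml.
by apply: eq_bigr => i _; rewrite rowK muZl.
Qed.

Lemma eq_mx_act (A B : 'M[K]_n) : (forall u : vect, u *m A = u *m B) -> A = B.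
Proof. by move=> AB; apply/row_matrixP => i; rewrite !rowE. Qed.

Hypothesis muC : forall u v, mu u v = mu v u.

Lemma muDr u v w : mu w (u + v) = mu w u + mu w v.
Proof. by rewrite muC muDl !(muC w). Qed.
Lemma muZr a u w : mu u (a *: w) = a *: mu u w.
Proof. by rewrite muC muZl muC. Qed.
Lemma mu0r w : mu w 0 = 0.
Proof. by rewrite muC mu0l. Qed.

Lemma mult_mxD a u v : mult_mx (a *: u + v) = a *: mult_mx u + mult_mx v.
Proof.
apply: eq_mx_act => w; rewrite mulmxDr -scalemxAr !mult_mxE.
by rewrite muC mu_lin !(muC w).
Qed.

Lemma mult_mx0 : mult_mx 0 = 0.
Proof. by apply: eq_mx_act => w; rewrite mulmx0 mult_mxE mu0r. Qed.

Hypothesis muA : forall u v w, mu u (mu v w) = mu (mu u v) w.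

Lemma mult_mxM u v : mult_mx (mu u v) = mult_mx u *m mult_mx v.
Proof. by apply: eq_mx_act => w; rewrite mulmxA !mult_mxE muA. Qed.

Variable one : vect.
Hypothesis mu1 : forall v, mu one v = v.

Lemma mult_mx1 : mult_mx one = 1%:M.
Proof. by apply: eq_mx_act => w; rewrite mult_mxE mulmx1 muC mu1. Qed.

Lemma mult_mx_inj u v : mult_mx u = mult_mx v -> u = v.
Proof. by move=> uv; rewrite -[u]mu1 -[v]mu1 -!mult_mxE uv. Qed.

End BilinearProduct.

Section ReducedAlgebra.
Variables (K : closedFieldType) (n' : nat).
Local Notation n := n'.+1.
Local Notation vect := 'rV[K]_n.
Variables (mu : vect -> vect -> vect) (one : vect).
Hypothesis mu_lin : forall a u v w, mu (a *: u + v) w = a *: mu u w + mu v w.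
Hypothesis muC : forall u v, mu u v = mu v u.
Hypothesis muA : forall u v w, mu u (mu v w) = mu (mu u v) w.
Hypothesis mu1 : forall v, mu one v = v.
Hypothesis mu_reduced : forall v, mu v v = 0 -> v = 0.
Local Notation mult_mx := (mult_mx mu).

Let mult0 : mult_mx 0 = 0 := mult_mx0 mu_lin muC.
Let multD := mult_mxD mu_lin muC.
Let multM := mult_mxM mu_lin muA.
Let multE := mult_mxE mu_lin.
Let mult_inj := mult_mx_inj mu_lin mu1.

Lemma mult_mx_horner v p : exists w, horner_mx (mult_mx v) p = mult_mx w.
Proof.
elim/poly_ind: p => [|p c [w IH]]; first by exists 0; rewrite raddf0 mult0.
exists (c *: one + mu w v); rewrite rmorphD rmorphM /= IH horner_mx_X horner_mx_C.
by rewrite multD multM (mult_mx1 mu_lin muC mu1) scalemx1 addrC.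
Qed.

(** A power with exponent 2 ^ k is an iterated square. *)
Lemma mult_mx_nilp v k : mult_mx v ^+ k = 0 -> v = 0.
Proof.
have sq j : forall u, mult_mx u ^+ (2 ^ j) = 0 -> u = 0.
  elim: j => [|j IH] u.
    by rewrite expn0 expr1 -mult0 => /mult_inj.
  rewrite expnS exprM expr2 -[_ * _]multM => /IH; exact: mu_reduced.
move=> vk; apply: (sq k); apply/eqP; have kk : (k <= 2 ^ k)%N by rewrite ltnW // ltn_expl.
by rewrite -(subnK kk) exprD vk mulr0.
Qed.

(** The squarefree part of the minimal polynomial takes a nilpotent value, which
    is again a multiplication operator and thus vanishes. *)
Lemma mult_mx_diagonalizable v : diagonalizable (mult_mx v).
Proof.
apply/diagonalizableP.
have [rs rsE] := closed_field_poly_normal (mxminpoly (mult_mx v)).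
rewrite (monicP (mxminpoly_monic _)) scale1r in rsE.
pose q : {poly K} := \prod_(z <- undup rs) ('X - z%:P).
exists (undup rs); first exact: undup_uniq.
have pq : mxminpoly (mult_mx v) %| q ^+ size rs.
  rewrite rsE; have : {subset rs <= undup rs} by move=> z; rewrite mem_undup.
  elim: rs {rsE} (undup rs) @q => [|z s IH] t q st; first by rewrite big_nil dvd1p.
  rewrite big_cons /= exprS; apply: dvdp_mul.
    rewrite /q (big_rem z) ?dvdp_mulr //; apply: st; exact: mem_head.
  by apply: IH => y ys; apply: st; rewrite inE ys orbT.
apply/mxminpoly_minP; have [w wE] := mult_mx_horner v q.
move/mxminpoly_minP: pq; rewrite rmorphXn /= -/q wE => /mult_mx_nilp ->.
exact: mult0.
Qed.

(** The multiplication operators commute, so that they are diagonalizable in a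
    common basis w_k: u w_k = chi_k(u) w_k. Computing w_k w_l in two ways gives
    chi_k(w_l) = 0 for k <> l, and w_k is a multiple of an idempotent because
    its square is not zero. *)
Theorem reduced_idempotents : exists eps : 'I_n -> vect,
  (forall k l, mu (eps k) (eps l) = if k == l then eps k else 0) /\
  \matrix_k eps k \in unitmx.
Proof.
pose As := [seq mult_mx (delta_mx 0 i) | i : 'I_n].
have /codiagonalizableP[P Punit /allP PAs] : {in As &, forall A B, comm_mx A B} /\
    {in As, forall A, diagonalizable A}.
  split=> [_ _ /mapP[i _ ->] /mapP[j _ ->]|_ /mapP[i _ ->]].
    by rewrite /comm_mx -!multM muC.
  exact: mult_mx_diagonalizable.
have diagE i : exists D : 'rV[K]_n, P *m mult_mx (delta_mx 0 i) = diag_mx D *m P.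
  have /PAs/diagonalizable_forPex[D /(simmxP Punit) PD] : mult_mx (delta_mx 0 i) \in As.
    by apply/mapP; exists i => //; rewrite mem_enum.
  by exists D.
pose D i := sval (cid (diagE i)); pose w k := row k P.
pose chi k (u : vect) := \sum_i u 0 i * D i 0 k.
have wchi k u : mu (w k) u = chi k u *: w k.
  rewrite muC [X in mu X _](row_sum_delta u) (mu_suml mu_lin) scaler_suml; apply: eq_bigr => i _.
  rewrite (muZl mu_lin) muC -multE -row_mul (svalP (cid (diagE i))) -/(D i).
  by rewrite row_mul row_diag_mx -scalemxAl -rowE scalerA.
have wfree (c : 'rV[K]_n) : c *m P = 0 -> c = 0.
  by move=> cP; rewrite -[c]mulmx1 -(mulmxV Punit) mulmxA cP mul0mx.
have wE i : w i = delta_mx 0 i *m P by exact: rowE.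
have w0 k : w k != 0.
  apply/negP => /eqP; rewrite wE => /wfree/rowP/(_ k)/eqP; rewrite !mxE !eqxx.
  by rewrite oner_eq0.
have chi_offdiag k l : k != l -> chi k (w l) = 0.
  move=> kl; have := wchi k (w l); rewrite muC (wchi l) => /eqP.
  rewrite -subr_eq0 !wE !scalemxAl -mulmxBl => /eqP/wfree/rowP/(_ k).
  rewrite !mxE !eqxx (negbTE kl) /= mulr0 mulr1 sub0r => /eqP.
  by rewrite oppr_eq0 -wE => /eqP.
have chi_diag k : chi k (w k) != 0.
  apply: contra (w0 k) => /eqP h; apply/eqP; apply: mu_reduced.
  by rewrite wchi h scale0r.
exists (fun k => (chi k (w k))^-1 *: w k); split=> [k l|].
  rewrite (muZl mu_lin) (muZr mu_lin muC) wchi; case: eqP => [->|/eqP kl].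
    by congr (_ *: _); rewrite scalerA mulVf ?chi_diag // scale1r.
  by rewrite (chi_offdiag _ _ kl) scale0r !scaler0.
have -> : \matrix_k ((chi k (w k))^-1 *: w k) =
    diag_mx (\row_k (chi k (w k))^-1) *m P.
  by apply/row_matrixP => k; rewrite rowK row_mul row_diag_mx -scalemxAl -rowE mxE.
rewrite unitmx_mul Punit andbT unitmxE det_diag unitfE.
by apply/prodf_neq0 => k _; rewrite mxE invr_eq0.
Qed.

End ReducedAlgebra.

Section SemisimpleAlgebra.
Variables (R : realType) (n : nat).
Local Notation C := (Cplx R).
Local Notation vect := 'rV[C]_n.
Variables (mu : vect -> vect -> vect) (one : vect).
Hypothesis mu_lin : forall a u v w, mu (a *: u + v) w = a *: mu u w + mu v w.
Hypothesis muC : forall u v, mu u v = mu v u.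
Hypothesis muA : forall u v w, mu u (mu v w) = mu (mu u v) w.
Hypothesis mu1 : forall v, mu one v = v.

(** If v v = 0, write 1 = a v + j along the ideal of v and a complement: both
    v (a v) and v j vanish, the latter lying in the two ideals, so v = v 1 = 0. *)
Lemma semisimple_reduced : semisimple mu -> forall v, mu v v = 0 -> v = 0.
Proof.
move=> ss v vv.
have lin : linear (mu^~ v) by move=> a u u'; rewrite mu_lin.
pose muL : {linear vect -> vect} :=
  HB.pack (mu^~ v) (GRing.isLinear.Build _ _ _ _ _ lin).
pose I := limg (linfun muL).
have memI u : u \in I -> exists a, u = mu a v.
  by move=> /memv_imgP[a _ ->]; exists a; rewrite lfunE.
have Imem a : mu a v \in I.
  by apply/memv_imgP; exists a; rewrite ?memvf // lfunE.
have idI : is_ideal mu I.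
  move=> u w /memI[a ->]; rewrite muA; exact: Imem.
have [J [idJ IJ IJ0]] := ss I idI.
have : one \in (I + J)%VS by rewrite IJ memvf.
move=> /memv_addP[i iI [j jJ oneE]].
have [a ia] := memI _ iI.
have vI : v \in I by rewrite -[v]mu1; exact: Imem.
have vj : mu v j = 0.
  apply/eqP; rewrite -memv0 -IJ0 memv_cap; apply/andP; split; last exact: idJ.
  by rewrite muC; exact: idI.
by rewrite -[v]mu1 muC oneE (muDr mu_lin muC) vj addr0 ia (muC a) muA vv (mu0l mu_lin).
Qed.

End SemisimpleAlgebra.

Theorem semisimple_idempotents (R : realType) (n : nat)
    (mu : 'rV[Cplx R]_n.+1 -> 'rV[Cplx R]_n.+1 -> 'rV[Cplx R]_n.+1) one :
  (forall a u v w, mu (a *: u + v) w = a *: mu u w + mu v w) ->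
  (forall u v, mu u v = mu v u) ->
  (forall u v w, mu u (mu v w) = mu (mu u v) w) ->
  (forall v, mu one v = v) -> semisimple mu ->
  exists eps : 'I_n.+1 -> 'rV[Cplx R]_n.+1,
  (forall k l, mu (eps k) (eps l) = if k == l then eps k else 0) /\
  \matrix_k eps k \in unitmx.
Proof.
move=> h1 h2 h3 h4 /(semisimple_reduced h1 h2 h3 h4) h5.
exact: (reduced_idempotents h1 h2 h3 h4 h5).
Qed.

(** * Products depending on a point *)

Section ProductCalculus.
Context {R : realType} {n : nat}.
Local Notation C := (Cplx R).
Local Notation hol := holomorphic_upto.
Local Notation vect := 'rV[C]_n.
Variables (A : set vect) (m : vect -> vect -> vect -> vect).
Hypothesis A_open : open A.
Hypothesis m_hol : forall u v, holomorphic A (fun x => m x u v).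
Hypothesis m_lin : forall x, A x -> forall a u v w,
  m x (a *: u + v) w = a *: m x u w + m x v w.
Hypothesis mC : forall x, A x -> forall u v, m x u v = m x v u.

(** The matrix of the multiplication by the j-th basis vector. *)
Definition mult_col j x : 'M[C]_n := \matrix_i m x (delta_mx 0 i) (delta_mx 0 j).

Lemma prod_expand x u v : A x -> m x u v = u *m (\sum_j v 0 j *: mult_col j x).
Proof.
move=> Ax; have ml := m_lin Ax; have mc := mC Ax.
have -> : m x u v = u *m mult_mx (m x) v by rewrite (mult_mxE ml).
congr (_ *m _); apply/row_matrixP => i; rewrite rowK.
rewrite [X in m x _ X](row_sum_delta v) mc (mu_suml ml) raddf_sum.
apply: eq_bigr => j _; rewrite (muZl ml) mc.
by apply/rowP => k; rewrite !mxE.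
Qed.

Lemma hol_mult_col k j : hol k A (mult_col j).
Proof.
apply: (hol_mx A_open) => i l.
apply: hol_eq A_open _ (hol_entry 0 l A_open (m_hol (delta_mx 0 i) (delta_mx 0 j) k)).
by move=> x _; rewrite !mxE.
Qed.

Lemma hol_prodm q k (B : set 'rV[C]_q) (p X Y : 'rV[C]_q -> vect) : open B ->
  p @` B `<=` A -> hol k B p -> hol k B X -> hol k B Y ->
  hol k B (fun z => m (p z) (X z) (Y z)).
Proof.
move=> oB pB hp hX hY.
have h : hol k B (fun z => X z *m (\sum_j (Y z) 0 j *: (mult_col j \o p) z)).
  apply: (hol_mulmx oB hX); apply: (hol_sum _ oB) => j.
  exact: (hol_scale oB (hol_entry 0 j oB hY) (hol_comp oB pB hp (hol_mult_col k j))).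
apply: hol_eq oB _ h => z Bz; rewrite -prod_expand //.
by apply: pB; exists z.
Qed.

(** The multiplication depends on the point, and contributes the first term. *)
Lemma prod_leibniz (X Y : vect -> vect) x u : A x ->
  differentiable X x -> differentiable Y x ->
  'D_u (fun y => m y (X y) (Y y)) x =
  'D_u (fun y => m y (X x) (Y x)) x + m x ('D_u X x) (Y x) + m x (X x) ('D_u Y x).
Proof.
move=> Ax dX dY.
have dM j : differentiable (mult_col j) x := (hol_mult_col 1 j).1 x Ax.
have dsum (Z : vect -> vect) : differentiable Z x ->
    differentiable (fun y => \sum_j (Z y) 0 j *: mult_col j y) x /\
    'D_u (fun y => \sum_j (Z y) 0 j *: mult_col j y) x =
    \sum_j (('D_u Z x) 0 j *: mult_col j x + (Z x) 0 j *: 'D_u (mult_col j) x).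
  move=> dZ.
  have dj j := differentiable_scale (differentiable_entry 0 j dZ).1 (dM j).
  have [d1 d2] := differentiable_fsum (index_enum 'I_n) (fun j => (dj j).1).
  split; first exact: d1.
  rewrite d2; apply: eq_bigr => j _; rewrite (dj j).2.
  by rewrite (differentiable_entry 0 j dZ).2.
have key (Z W : vect -> vect) : differentiable Z x -> differentiable W x ->
    'D_u (fun y => m y (Z y) (W y)) x = 'D_u Z x *m (\sum_j (W x) 0 j *: mult_col j x)
    + Z x *m (\sum_j (('D_u W x) 0 j *: mult_col j x + (W x) 0 j *: 'D_u (mult_col j) x)).
  move=> dZ dW; have [d1 d2] := dsum W dW; have [d3 d4] := differentiable_mulmx dZ d1.
  rewrite -d2 -d4; apply: near_eq_derive.
  have := open_nbhs_nbhs (conj A_open Ax); apply: filterS => y Ay.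
  by rewrite -prod_expand.
have fixed := key (cst (X x)) (cst (Y x)) (differentiable_cst _ _) (differentiable_cst _ _).
rewrite !derive_cst mul0mx add0r in fixed.
rewrite (key X Y dX dY) fixed !(prod_expand _ _ Ax) big_split /= mulmxDr.
have -> : \sum_j ((0 : vect) 0 j *: mult_col j x + cst (Y x) x 0 j *: 'D_u (mult_col j) x) =
   \sum_j (Y x) 0 j *: 'D_u (mult_col j) x.
  by apply: eq_bigr => j _; rewrite mxE scale0r add0r.
move: ('D_u X x *m _) (X x *m _) (X x *m _) => a b c.
by apply/rowP => j; rewrite !mxE; ring.
Qed.

End ProductCalculus.

(** * Extension of an idempotent *)

Section IdempotentExtension.
Context {R : realType} {n : nat}.
Local Notation C := (Cplx R).
Local Notation hol := holomorphic_upto.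
Local Notation vect := 'rV[C]_n.

Lemma rnorm_row_mx (u v : vect) : rnorm (row_mx u v) <= Num.max (rnorm u) (rnorm v).
Proof.
apply: rnorm_mx_le => [|i j]; first by rewrite le_max rnorm_ge0.
rewrite mxE le_max; case: (fintype.split j) => k; rewrite rnorm_entry ?orbT //.
Qed.

Lemma nball_row_mx (x u a v : vect) r : nball x r u -> nball a r v ->
  nball (row_mx x a) r (row_mx u v).
Proof.
rewrite /nball /= opp_row_mx add_row_mx => xu av.
by apply: le_lt_trans (rnorm_row_mx _ _) _; rewrite gt_max xu av.
Qed.

Lemma lsubmx_linear : linear (lsubmx : 'rV[C]_(n + n) -> vect).
Proof. by move=> a u v; apply/rowP => j; rewrite !mxE. Qed.

Lemma rsubmx_linear : linear (rsubmx : 'rV[C]_(n + n) -> vect).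
Proof. by move=> a u v; apply/rowP => j; rewrite !mxE. Qed.

Lemma row_mx_linear (u : vect) : linear (fun v : vect => row_mx (0 : vect) v).
Proof. by move=> a v w; rewrite scale_row_mx add_row_mx scaler0 addr0. Qed.

Variables (A : set vect) (m : vect -> vect -> vect -> vect).
Hypothesis A_open : open A.
Hypothesis m_hol : forall u v, holomorphic A (fun x => m x u v).
Hypothesis m_lin : forall x, A x -> forall a u v w,
  m x (a *: u + v) w = a *: m x u w + m x v w.
Hypothesis mC : forall x, A x -> forall u v, m x u v = m x v u.
Hypothesis mA : forall x, A x -> forall u v w, m x u (m x v w) = m x (m x u v) w.

(** The inverse function theorem for G (x, v) = (x, v v - v) at (x0, a). Its
    differential sends (0, w) to (0, 2 a w - w), and 2 a w = w gives a w = 0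
    after multiplication by a, hence w = 0. The injectivity of G near (x0, a)
    is the uniqueness statement. *)
Lemma idempotent_extension x0 a : A x0 -> m x0 a a = a ->
  exists2 rho : R, 0 < rho & exists2 e : vect -> vect,
  [/\ nball x0 rho `<=` A, holomorphic (nball x0 rho) e, e x0 = a &
      forall x, nball x0 rho x -> m x (e x) (e x) = e x] &
  forall x, nball x0 rho x -> forall v w, nball a rho v -> nball a rho w ->
    m x v v = v -> m x w w = w -> v = w.
Proof.
move=> Ax0 aa.
pose l : 'rV[C]_(n + n) -> vect := lsubmx.
pose s : 'rV[C]_(n + n) -> vect := rsubmx.
pose Q z := m (l z) (s z) (s z) - s z.
pose G (z : 'rV[C]_(n + n)) : 'rV[C]_(n + n) := row_mx (l z) (Q z).
pose U := l @^-1` A.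
have lc := lin_mx_continuous lsubmx_linear.
have sc := lin_mx_continuous rsubmx_linear.
have oU : open U by apply: open_comp => // z _; exact: lc.
have hl k : hol k U l by apply: (hol_lin oU lsubmx_linear lc (hol_id k oU)).
have hs k : hol k U s by apply: (hol_lin oU rsubmx_linear sc (hol_id k oU)).
have UA : l @` U `<=` A by move=> _ [z Uz <-].
have hQ k : hol k U Q.
  have h1 := hol_prodm A_open m_hol m_lin mC oU UA (hl k) (hs k) (hs k).
  have h2 := hol_scale oU (hol_cst k U (-1 : C)) (hs k).
  by apply: hol_eq oU _ (holD oU h1 h2) => z _; rewrite /Q /cst scaleN1r.
have hG : holomorphic U G.
  move=> k; apply: (hol_mx oU) => i j; rewrite /G.
  case: (splitP j) => j' jE.
    apply: hol_eq oU _ (hol_entry i j' oU (hl k)) => z _.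
    by have -> : j = lshift n j' by [apply: val_inj]; rewrite row_mxEl.
  apply: hol_eq oU _ (hol_entry i j' oU (hQ k)) => z _.
  by have -> : j = rshift n j' by [apply: val_inj]; rewrite row_mxEr.
pose z0 := row_mx x0 a.
have lz0 : l z0 = x0 by exact: row_mxKl.
have sz0 : s z0 = a by exact: row_mxKr.
have Uz0 : U z0 by rewrite /U /= lz0.
have ml := m_lin Ax0; have mc := mC Ax0; have ma := mA Ax0.
have dG : differentiable G z0 := (hG 1).1 _ Uz0.
have dQ : differentiable Q z0 := (hQ 1).1 _ Uz0.
have Ginj v : 'D_v G z0 = 0 -> v = 0.
  move=> Gv.
  have did : differentiable (id : 'rV[C]_(n + n) -> _) z0 := @ex_diff _ _ _ _ _ _ _ (is_diff_id z0).
  have lv : l v = 0.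
    have [_ d2] := differentiable_lin_comp lsubmx_linear lc dG.
    have := d2 v; rewrite Gv => h; transitivity (lsubmx (0 : 'rV[C]_(n + n))).
      rewrite -h; have -> : lsubmx \o G = l \o id by apply/funext => z; rewrite /= /G row_mxKl.
      by rewrite (differentiable_lin_comp lsubmx_linear lc did).2 derive_id.
    by apply/rowP => j; rewrite !mxE.
  have Qv : 'D_v Q z0 = 0.
    have [_ d2] := differentiable_lin_comp rsubmx_linear sc dG.
    have := d2 v; rewrite Gv => h; transitivity (rsubmx (0 : 'rV[C]_(n + n))).
      by rewrite -h; congr ('D_v _ z0); apply/funext => z; rewrite /= /G row_mxKr.
    by apply/rowP => j; rewrite !mxE.
  have vE : v = row_mx 0 (s v) by rewrite -[LHS]hsubmxK -/(l v) lv.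
  (* along (0, w), Q restricts to the polynomial map w |-> w w - w at x0 *)
  pose psi (w : vect) : 'rV[C]_(n + n) := row_mx 0 w + cst (row_mx x0 0) w.
  have rl := row_mx_linear 0.
  have dida : differentiable (id : vect -> _) a := @ex_diff _ _ _ _ _ _ _ (is_diff_id a).
  have [dr1 dr2] := differentiable_lin_comp rl (lin_mx_continuous rl) dida.
  have dpsi : differentiable psi a by exact: differentiableD dr1 (differentiable_cst _ _).
  have psia : psi a = z0 by rewrite /psi /cst add_row_mx add0r addr0.
  have Dpsi w : 'D_w psi a = row_mx 0 w.
    have := deriveD (diff_derivable dr1)
      (diff_derivable (differentiable_cst (row_mx x0 0) a)) => /(_ w).
    by move=> h; rewrite -[psi]/(((fun v : vect => row_mx (0 : vect) v) \o id) + cst (row_mx x0 0))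
      h derive_cst addr0 dr2 derive_id.
  have QpsiE : Q \o psi = (fun w => w *m mult_mx (m x0) w - w).
    apply/funext => w; rewrite /Q /psi /= /cst add_row_mx add0r addr0 /l /s.
    by rewrite row_mxKl row_mxKr (mult_mxE ml).
  have lM : linear (mult_mx (m x0)) by move=> c u w; exact: (mult_mxD ml mc).
  have [dM1 dM2] := differentiable_lin_comp lM (lin_mx_continuous lM) dida.
  have [dm1 dm2] := differentiable_mulmx dida dM1.
  have DQ w : 'D_(row_mx 0 w) Q z0 = m x0 w a + m x0 a w - w.
    have dQp : differentiable Q (psi a) by rewrite psia.
    rewrite -Dpsi -[X in 'D_('D_w psi a) Q X]psia -(derive_comp w dpsi dQp) QpsiE.
    have := deriveB (diff_derivable dm1) (diff_derivable dida) => /(_ w) h.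
    rewrite -[X in 'D_w X a]/((fun y => id y *m (mult_mx (m x0) \o id) y) - id) h.
    by rewrite dm2 dM2 derive_id /= !(mult_mxE ml).
  move: Qv; rewrite vE DQ; set w := s v => /eqP; rewrite subr_eq0 (mc w a) => /eqP ww.
  have aw : m x0 a w = 0.
    have := congr1 (m x0 a) ww; rewrite (muDr ml mc) ma aa => /eqP.
    by rewrite -subr_eq0 addrK => /eqP.
  by rewrite -ww aw addr0 row_mx0.
have [rho [r [g [[rho0 r0] rhoU gG Gg hg]]]] := inverse_function oU hG Uz0 Ginj.
have Gz0 : G z0 = row_mx x0 0 by rewrite /G /Q lz0 sz0 aa subrr.
rewrite Gz0 in Gg hg.
have in_r (x : vect) : nball x0 r x -> nball (row_mx x0 (0 : vect)) r (row_mx x (0 : vect)).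
  by move=> xr; exact: (nball_row_mx xr (nballxx (0 : vect) r0)).
pose emb (x : vect) : 'rV[C]_(n + n) := row_mx x 0.
have lemb : linear emb by move=> c u w; rewrite /emb scale_row_mx add_row_mx scaler0 addr0.
have oball (d : R) : open (nball x0 d) by exact: open_nball.
exists (Num.min rho r); first by rewrite lt_min rho0.
have rhor x : nball x0 (Num.min rho r) x -> nball x0 rho x /\ nball x0 r x.
  by rewrite /nball /= lt_min => /andP[].
exists (fun x => s (g (emb x))).
- split.
  + move=> x /rhor[xr _]; have := rhoU _ (nball_row_mx xr (nballxx a rho0)).
    by rewrite /U /= /l row_mxKl.
  + move=> k; apply: (hol_lin (oball _) rsubmx_linear sc).
    have hemb : hol k (nball x0 (Num.min rho r)) emb.
      exact: (hol_lin (oball _) lemb (lin_mx_continuous lemb) (hol_id k (oball _))).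
    apply: (hol_comp (oball _) _ hemb (hg k)) => _ [x /rhor[_ xr] <-].
    exact: in_r.
  + by rewrite /emb -Gz0 gG //; exact: nballxx.
  + move=> x /rhor[_ /in_r/Gg[_]]; rewrite -/(emb x) /G => h.
    have := congr1 lsubmx h; have := congr1 rsubmx h.
    rewrite !row_mxKl !row_mxKr /Q /l => h1 h2; rewrite h2 in h1.
    by apply/eqP; rewrite -subr_eq0 h1.
move=> x /rhor[xr _] v w vr wr vv ww.
have ball u : nball a (Num.min rho r) u -> nball z0 rho (row_mx x u).
  by rewrite {1}/nball /= lt_min => /andP[ur _]; exact: nball_row_mx.
have GE u : m x u u = u -> G (row_mx x u) = row_mx x 0.
  by move=> uu; rewrite /G /Q /l /s row_mxKl row_mxKr uu subrr.
have := gG _ (ball v vr); rewrite (GE _ vv) -(GE _ ww) (gG _ (ball w wr)).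
by move=> /eq_row_mx[].
Qed.

End IdempotentExtension.

(** * Idempotent frames and the potentiality identity *)

Section IdempotentFrame.
Context {R : realType} {n' : nat}.
Local Notation n := n'.+1.
Local Notation C := (Cplx R).
Local Notation hol := holomorphic_upto.
Local Notation vect := 'rV[C]_n.
Variables (A : set vect) (m : vect -> vect -> vect -> vect) (one : vect -> vect).
Hypothesis A_open : open A.
Hypothesis m_hol : forall u v, holomorphic A (fun x => m x u v).
Hypothesis m_lin : forall x, A x -> forall a u v w,
  m x (a *: u + v) w = a *: m x u w + m x v w.
Hypothesis mC : forall x, A x -> forall u v, m x u v = m x v u.
Hypothesis mA : forall x, A x -> forall u v w, m x u (m x v w) = m x (m x u v) w.
Hypothesis m1 : forall x, A x -> forall v, m x (one x) v = v.

(** Idempotents at [x0] extend one by one. The product of two distinct ones is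
    an idempotent close to 0, and 0 is the only such. *)
Theorem local_idempotent_frame x0 : A x0 -> semisimple (m x0) ->
  exists2 r : R, 0 < r & exists eps : 'I_n -> vect -> vect,
  [/\ nball x0 r `<=` A, forall k, holomorphic (nball x0 r) (eps k),
    forall x, nball x0 r x -> forall k l,
      m x (eps k x) (eps l x) = if k == l then eps k x else 0 &
    forall x, nball x0 r x -> \matrix_k eps k x \in unitmx].
Proof.
move=> Ax0 ss.
have [a [aa aU]] := semisimple_idempotents (m_lin Ax0) (mC Ax0) (mA Ax0) (m1 Ax0) ss.
have idem k : m x0 (a k) (a k) = a k by rewrite aa eqxx.
have ex k := idempotent_extension A_open m_hol m_lin mC mA Ax0 (idem k).
have [rho [e [rho0 eP]]] : exists rho : 'I_n -> R, exists e : 'I_n -> vect -> vect,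
    (forall k, 0 < rho k) /\ forall k,
    [/\ nball x0 (rho k) `<=` A, holomorphic (nball x0 (rho k)) (e k), e k x0 = a k &
    forall x, nball x0 (rho k) x -> m x (e k x) (e k x) = e k x].
  exists (fun k => s2val (cid2 (ex k))), (fun k => s2val (cid2 (s2valP' (cid2 (ex k))))).
  by split=> k; [exact: (s2valP (cid2 (ex k)))|exact: (s2valP (cid2 (s2valP' (cid2 (ex k)))))].
have m00 : m x0 0 0 = 0 by rewrite (mu0l (m_lin Ax0)).
have [d d0 [_ _ uniq0]] := idempotent_extension A_open m_hol m_lin mC mA Ax0 m00.
have near_rho : \forall x \near x0, forall k, nball x0 (rho k) x.
  apply: (@filter_forall _ _ (fun k x => nball x0 (rho k) x) _ (nbhs_filter x0)) => k.
  exact: nball_nbhs.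
have ec k k' : hol k (nball x0 (rho k')) (e k') by case: (eP k') => _ h _ _; exact: h.
have near_small : \forall x \near x0, forall kl : 'I_n * 'I_n, kl.1 != kl.2 ->
    nball 0 d (m x (e kl.1 x) (e kl.2 x)).
  apply: (@filter_forall _ _ (fun (kl : 'I_n * 'I_n) x => kl.1 != kl.2 ->
    nball 0 d (m x (e kl.1 x) (e kl.2 x))) _ (nbhs_filter x0)) => -[k l] /=.
  have [->|kl] := eqVneq k l; first exact: nearW.
  have [r [r0 rk rl]] : exists r, [/\ 0 < r, nball x0 r `<=` nball x0 (rho k) &
      nball x0 r `<=` nball x0 (rho l)].
    exists (Num.min (rho k) (rho l)); split; first by rewrite lt_min !rho0.
      by move=> x; rewrite /nball /= lt_min => /andP[].
    by move=> x; rewrite /nball /= lt_min => /andP[].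
  have oB : open (nball x0 r) by exact: open_nball.
  have rA : id @` nball x0 r `<=` A.
    by move=> _ [x /rk xr <-]; case: (eP k) => h _ _ _; exact: h.
  have h := hol_prodm A_open m_hol m_lin mC oB rA (hol_id 0 oB)
    (hol_sub rk (ec 0 k)) (hol_sub rl (ec 0 l)).
  have [d' d'0 xd'] := iffLR (continuous_rnormP _ _) (h x0 (nballxx _ r0)) d d0.
  apply: filterS (nball_nbhs x0 d'0) => x /xd' + _.
  have [[_ _ -> _] [_ _ -> _]] := (eP k, eP l).
  by rewrite aa (negbTE kl).
have near_det : \forall x \near x0, \det (\matrix_k e k x) != 0.
  have hdet : {for x0, continuous (fun x => \det (\matrix_k e k x) : C)}.
    have [r r0 rP] := iffLR (nbhs_rnormP _ _) near_rho.
    have oB : open (nball x0 r) by exact: open_nball.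
    have hM : hol 0 (nball x0 r) (fun x => \matrix_k e k x).
      apply: (hol_mx oB) => i j.
      have rk : nball x0 r `<=` nball x0 (rho i) by move=> x /rP.
      have h := hol_entry 0 j oB (hol_sub rk (ec 0 i)).
      by apply: hol_eq oB _ h => x _; rewrite mxE.
    exact: (hol_det oB hM _ (nballxx _ r0)).
  have det0 : 0 < rnorm (\det (\matrix_k e k x0)).
    rewrite lt_neqAle rnorm_ge0 andbT eq_sym; apply/negP => /eqP/rnorm_eq0 h.
    move: aU; rewrite unitmxE unitfE => /negP; apply; apply/eqP; rewrite -h; congr (\det _).
    by apply/row_matrixP => k; rewrite !rowK; case: (eP k).
  have [d' d'0 xd'] := iffLR (continuous_rnormP _ _) hdet _ det0.
  apply: filterS (nball_nbhs x0 d'0) => x /xd' h; apply/eqP => h0.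
  by move: h; rewrite h0 sub0r rnormN ltxx.
have [r r0 rP] := iffLR (nbhs_rnormP _ _)
  (filterI (filterI near_rho (nball_nbhs x0 d0)) (filterI near_small near_det)).
have {}rP x : nball x0 r x -> [/\ forall k, nball x0 (rho k) x, nball x0 d x,
    forall k l, k != l -> nball 0 d (m x (e k x) (e l x)) & \det (\matrix_k e k x) != 0].
  by move=> /rP[[h1 h2] [h3 h4]]; split=> // k l; exact: (h3 (k, l)).
have rA : nball x0 r `<=` A.
  by move=> x /rP[/(_ ord0) h _ _ _]; case: (eP ord0) => h' _ _ _; exact: h'.
exists r; first exact: r0.
exists e; split; first exact: rA.
- move=> k j; apply: (hol_sub _ (ec j k)) => x /rP[h _ _ _]; exact: h.
- move=> x xr k l; have [h1 h2 h3 _] := rP x xr; have Ax := rA x xr.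
  have ek i : m x (e i x) (e i x) = e i x by case: (eP i) => _ _ _ h; exact: h.
  have idem_prod (b c : vect) : m x b b = b -> m x c c = c ->
      m x (m x b c) (m x b c) = m x b c.
    move=> bb cc; rewrite -(mA Ax b c) (mC Ax c (m x b c)) -(mA Ax b c c) cc.
    by rewrite (mA Ax b b c) bb.
  case: eqVneq => [->|kl]; first exact: ek.
  apply: (uniq0 x h2 _ _ (h3 _ _ kl) (nballxx _ d0)); last by rewrite (mu0l (m_lin Ax)).
  exact: idem_prod (ek k) (ek l).
- by move=> x /rP[_ _ _ h]; rewrite unitmxE unitfE.
Qed.

End IdempotentFrame.

HB.lock Definition bil (K : fieldType) n (M : 'M[K]_n) (u v : 'rV[K]_n) : K :=
  (u *m M *m v^T) 0 0.
Arguments bil {K n} M u v.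

Section BilinearForm.
Variables (K : fieldType) (n : nat).
Implicit Types (M : 'M[K]_n) (u v w z : 'rV[K]_n).

Lemma bilE M u v : bil M u v = (u *m M *m v^T) 0 0.
Proof. by rewrite bil.unlock. Qed.

Lemma bilC M u v : M^T = M -> bil M u v = bil M v u.
Proof.
move=> Ms; rewrite !bilE -[in LHS](trmxK (u *m M *m v^T)) mxE.
by rewrite !trmx_mul trmxK Ms mulmxA.
Qed.

Lemma bilDl M u v w : bil M (u + v) w = bil M u w + bil M v w.
Proof. by rewrite !bilE !mulmxDl mxE. Qed.

Lemma bilNl M u w : bil M (- u) w = - bil M u w.
Proof. by rewrite !bilE !mulNmx mxE. Qed.

Lemma bil_sumr M u z : bil M u z = \sum_k z 0 k * bil M u (delta_mx 0 k).
Proof.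
rewrite {1}(row_sum_delta z) bilE linear_sum mulmx_sumr summxE.
by apply: eq_bigr => k _; rewrite bilE linearZ -scalemxAr mxE.
Qed.

Lemma bil_summ (a : 'rV[K]_n) (F : 'I_n -> 'M[K]_n) u v :
  bil (\sum_j a 0 j *: F j) u v = \sum_j a 0 j * bil (F j) u v.
Proof.
rewrite bilE mulmx_sumr mulmx_suml summxE; apply: eq_bigr => k _.
by rewrite bilE -scalemxAr -scalemxAl mxE.
Qed.

End BilinearForm.

Section CommutingFrame.
Context {R : realType} {n : nat}.
Local Notation C := (Cplx R).
Local Notation vect := 'rV[C]_n.
Variables (A : set vect) (m : vect -> vect -> vect -> vect) (g : vect -> 'M[C]_n).
Variables (e E : vect -> vect) (dm dg : C).
Hypothesis A_open : open A.
Hypothesis frob : frobenius_on A m g e E dm dg.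

Let dG x : A x -> differentiable g x.
Proof. exact: (frob_metric_holomorphic frob 1).1. Qed.

Lemma bil_derive x u v w : A x ->
  'D_u (inner g (cst v) (cst w)) x = bil ('D_u g x) v w.
Proof.
move=> /dG dg'; rewrite /inner /cst bilE.
have [d1 d2] := differentiable_mulmx (differentiable_cst v x) dg'.
have [d3 d4] := differentiable_mulmx d1 (differentiable_cst w^T x).
by rewrite (differentiable_entry 0 0 d3).2 d4 d2 !derive_cst mul0mx add0r mulmx0 addr0.
Qed.

Lemma metric_derive_sym x u : A x -> ('D_u g x)^T = 'D_u g x.
Proof.
move=> Ax; apply/matrixP => i j; rewrite mxE.
rewrite -(differentiable_entry j i (dG Ax)).2 -(differentiable_entry i j (dG Ax)).2.
apply: near_eq_derive; have := open_nbhs_nbhs (conj A_open Ax).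
by apply: filterS => y Ay; rewrite -[in LHS](frob_metric_sym frob Ay) mxE.
Qed.

(** The Koszul formula. *)
Lemma christoffel_bil x u v z : A x -> bil (g x) (christoffel g x u v) z =
  2^-1 * (bil ('D_u g x) v z + bil ('D_v g x) u z - bil ('D_z g x) u v).
Proof.
move=> Ax; have gU := frob_metric_unit frob Ax.
have -> : christoffel g x u v = 2^-1 *: (\row_k (bil ('D_u g x) v (delta_mx 0 k) +
   bil ('D_v g x) u (delta_mx 0 k) - bil ('D_(delta_mx 0 k) g x) u v)) *m invmx (g x).
  rewrite /christoffel; congr (_ *: _ *m _); apply/rowP => k; rewrite !mxE.
  by congr (_ + _ - _); exact: bil_derive.
have Dz := derive_rowE z (dG Ax).
have [D DE] : exists D : vect -> 'M[C]_n, forall w, 'D_w g x = D w.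
  by exists (fun w => 'D_w g x).
rewrite !DE in Dz *; under [in LHS]eq_mx do rewrite DE.
rewrite bilE -!scalemxAl mxE -[_ *m invmx _ *m _]mulmxA mulVmx // mulmx1.
congr (_ * _).
have -> : D z = \sum_j z 0 j *: D (delta_mx 0 j).
  by rewrite {1}Dz; apply: eq_bigr => j _; rewrite DE.
rewrite bil_summ (bil_sumr _ v z) (bil_sumr _ u z) !mxE.
rewrite -big_split -sumrB; apply: eq_bigr => k _ /=.
by rewrite !mxE mulrC mulrBr mulrDr.
Qed.

Lemma bil_inj x u v : A x -> (forall z, bil (g x) u z = bil (g x) v z) -> u = v.
Proof.
move=> Ax uv; have gU := frob_metric_unit frob Ax.
rewrite -[u](mulmxK gU) -[v](mulmxK gU); congr (_ *m _).
apply/rowP => k; have := uv (delta_mx 0 k).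
by rewrite !bilE trmx_delta -!colE !mxE.
Qed.

Lemma christoffelC x u v : A x -> christoffel g x u v = christoffel g x v u.
Proof.
move=> Ax; apply: (bil_inj Ax) => z.
apply: (etrans (christoffel_bil u v z Ax)).
apply: (etrans _ (esym (christoffel_bil v u z Ax))).
have arith (a b c d : C) : a = b -> 2^-1 * (c + d - a) = 2^-1 * (d + c - b).
  by move=> ->; rewrite [c + d]addrC.
exact: (arith _ _ _ _ (bilC u v (metric_derive_sym z Ax))).
Qed.

Lemma christoffel_metric x u p z : A x ->
  bil ('D_u g x) p z = bil (g x) (christoffel g x u p) z + bil (g x) p (christoffel g x u z).
Proof.
move=> Ax; have E1 := christoffel_bil u p z Ax.
have E2 := christoffel_bil u z p Ax.
have E3 := bilC p (christoffel g x u z) (frob_metric_sym frob Ax).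
have E4 := bilC p z (metric_derive_sym u Ax).
apply: (etrans _ (esym (congr2 +%R E1 (etrans E3 E2)))).
have arith (a b c d : C) : a = b -> a = 2^-1 * (a + c - d) + 2^-1 * (b + d - c).
  by move=> <-; field.
exact: (arith _ _ _ _ E4).
Qed.

(** Metric compatibility rewrites the covariant derivative of the tensor c as
    the one of the multiplication, paired with the last argument, of which
    nondegeneracy gets rid. In the symmetry in the first two arguments, the
    terms with [christoffel g x u v] cancel as there is no torsion. *)
Lemma potentiality x u v w : A x ->
  'D_u (fun y => m y v w) x + christoffel g x u (m x v w) - m x v (christoffel g x u w) =
  'D_v (fun y => m y u w) x + christoffel g x v (m x u w) - m x u (christoffel g x v w).
Proof.
move=> Ax; have ml := frob_mul_linear frob Ax; have mc := frob_mulC frob Ax.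
have nab a b y : A y -> nabla g (cst a) (cst b) y = christoffel g y a b.
  by move=> Ay; rewrite /nabla /cst derive_cst add0r.
have key a b c z : nabla_ctensor m g (cst a) (cst b) (cst c) (cst z) x =
    bil (g x) ('D_a (fun y => m y b c) x + christoffel g x a (m x b c)
      - m x (christoffel g x a b) c - m x b (christoffel g x a c)) z.
  rewrite /nabla_ctensor.
  have dbc : differentiable (fun y => m y b c) x := (frob_mul_holomorphic frob b c 1).1 x Ax.
  have [d1 d2] := differentiable_mulmx dbc (dG Ax).
  have [d3 d4] := differentiable_mulmx d1 (differentiable_cst z^T x).
  have -> : 'D_a (ctensor m g (cst b) (cst c) (cst z)) x =
     bil (g x) ('D_a (fun y => m y b c) x) z + bil ('D_a g x) (m x b c) z.
    rewrite /ctensor /inner /fmul /cst.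
    rewrite (differentiable_entry 0 0 d3).2 d4 d2 derive_cst mulmx0 addr0.
    by rewrite mulmxDl mxE !bilE.
  rewrite (christoffel_metric _ _ _ Ax) /ctensor /inner /fmul !nab //.
  rewrite -!bilE !bilDl !bilNl; ring.
have hc (a : vect) : holomorphic A (cst a) by move=> k; exact: hol_cst.
apply: (bil_inj Ax) => z.
have [h _ _] := frob_nabla_c_sym frob (hc u) (hc v) (hc w) (hc z) Ax.
have bil3 M (p q r : vect) : bil M (p + q - r) z = bil M p z + bil M q z - bil M r z.
  by rewrite !bilDl bilNl.
have bil4 M (p q s r : vect) :
    bil M (p + q - s - r) z = bil M p z + bil M q z - bil M s z - bil M r z.
  by rewrite !bilDl !bilNl.
have {}h := etrans (esym (key u v w z)) (etrans h (key v u w z)).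
have {}h := etrans (esym (bil4 _ _ _ _ _)) (etrans h (bil4 _ _ _ _ _)).
have tt := congr1 (fun y => bil (g x) (m x y w) z) (christoffelC u v Ax).
apply: (etrans (bil3 _ _ _ _)); apply: (etrans _ (esym (bil3 _ _ _ _))).
have cancel_t (a b t c a' b' t' c' : C) : a + b - t - c = a' + b' - t' - c' -> t = t' ->
    a + b - c = a' + b' - c'.
  move=> abc tt'; have -> : a + b - c = (a + b - t - c) + t by ring.
  by rewrite abc tt'; ring.
exact: (cancel_t _ _ _ _ _ _ _ _ h tt).
Qed.

End CommutingFrame.

(** * Canonical coordinates *)

Section IdempotentAlgebra.
Variables (K : fieldType) (n : nat).
Local Notation vect := 'rV[K]_n.
Variables (mu : vect -> vect -> vect) (one : vect) (e : 'I_n -> vect).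
Hypothesis mu_lin : forall a u v w, mu (a *: u + v) w = a *: mu u w + mu v w.
Hypothesis muC : forall u v, mu u v = mu v u.
Hypothesis muA : forall u v w, mu u (mu v w) = mu (mu u v) w.
Hypothesis mu1 : forall v, mu one v = v.
Hypothesis e_idem : forall k l, mu (e k) (e l) = if k == l then e k else 0.
Hypothesis e_basis : \matrix_k e k \in unitmx.

(** The operator of multiplication by [z] kills a basis, hence the unity. *)
Lemma annihilated_by_frame z : (forall k, mu z (e k) = 0) -> z = 0.
Proof.
move=> ze; have EM : (\matrix_k e k) *m mult_mx mu z = 0.
  by apply/row_matrixP => k; rewrite row_mul rowK (mult_mxE mu_lin) muC ze row0.
rewrite -[z]mu1 -(mult_mxE mu_lin).
by rewrite -[mult_mx mu z](mulKmx e_basis) EM mulmx0 mulmx0.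
Qed.

Lemma unity_sum_frame : one = \sum_k e k.
Proof.
apply/eqP; rewrite -subr_eq0; apply/eqP/annihilated_by_frame => l.
rewrite (muBl mu_lin) mu1 (mu_suml mu_lin) (bigD1 l) //= e_idem eqxx big1 ?addr0 ?subrr //.
by move=> k kl; rewrite e_idem (negbTE kl).
Qed.

(** Here [d i j] stands for the derivative of e_j along e_i, [P i j k] for the
    derivative along e_i of the product at fixed factors e_j, e_k, and [G] for
    the Christoffel symbols. The hypotheses are the derivative of e_j e_k and
    potentiality; multiplied by e_k, the second loses its Christoffel terms and
    the first turns P into - d, so that [e_i, e_j] e_k = 0 for all k. *)
Lemma frame_bracket (d : 'I_n -> 'I_n -> vect) (P : 'I_n -> 'I_n -> 'I_n -> vect)
    (G : vect -> vect -> vect) :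
  (forall u, G u 0 = 0) ->
  (forall i j k, P i j k + mu (d i j) (e k) + mu (e j) (d i k) =
     if j == k then d i j else 0) ->
  (forall i j k, P i j k + G (e i) (mu (e j) (e k)) - mu (e j) (G (e i) (e k)) =
     P j i k + G (e j) (mu (e i) (e k)) - mu (e i) (G (e j) (e k))) ->
  forall i j, d i j = d j i.
Proof.
move=> G0 HP HG i j; apply/eqP; rewrite -subr_eq0; apply/eqP/annihilated_by_frame => k.
have q1 p (X : vect) : mu (mu (e p) X) (e k) = if p == k then mu X (e k) else 0.
  rewrite (muC (e p)) -muA e_idem; case: eqP => [->//|_]; exact: (mu0r mu_lin muC).
have q2 (X : vect) : mu (mu X (e k)) (e k) = mu X (e k) by rewrite -muA e_idem eqxx.
have qP a b : mu (P a b k) (e k) = - mu (d a b) (e k).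
  have := congr1 (mu^~ (e k)) (HP a b k); rewrite /= !(muDl mu_lin) q1 q2.
  case: eqP => [->|_]; last first.
    by rewrite addr0 (mu0l mu_lin) => /eqP; rewrite addr_eq0 => /eqP.
  by rewrite -[X in _ = X]add0r => /addIr/eqP; rewrite addr_eq0 => /eqP.
have qG a b : mu (G (e a) (mu (e b) (e k)) - mu (e b) (G (e a) (e k))) (e k) = 0.
  rewrite (muBl mu_lin) q1 e_idem; case: eqP => [->|_]; first by rewrite subrr.
  by rewrite G0 (mu0l mu_lin) subrr.
have := congr1 (mu^~ (e k)) (HG i j k); rewrite /= -!addrA !(muDl mu_lin (P _ _ _)) !qG !addr0.
by rewrite !qP => /oppr_inj h; rewrite (muBl mu_lin) h subrr.
Qed.

End IdempotentAlgebra.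

Section CanonicalCoordinates.
Context {R : realType} {n' : nat}.
Local Notation n := n'.+1.
Local Notation C := (Cplx R).
Local Notation hol := holomorphic_upto.
Local Notation vect := 'rV[C]_n.
Variables (A : set vect) (m : vect -> vect -> vect -> vect) (g : vect -> 'M[C]_n).
Variables (e E : vect -> vect) (dm dg : C).
Hypothesis A_open : open A.
Hypothesis frob : frobenius_on A m g e E dm dg.

Lemma christoffel0r x u : A x -> christoffel g x u 0 = 0.
Proof.
move=> Ax; apply: (bil_inj frob Ax) => z.
have b0l (M : 'M[C]_n) w : bil M 0 w = 0 by rewrite bilE !mul0mx mxE.
have b0r (M : 'M[C]_n) w : bil M w 0 = 0 by rewrite bilE trmx0 mulmx0 mxE.
have b0m (w p : vect) : bil 0 w p = 0 by rewrite bilE mulmx0 mul0mx mxE.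
apply: (etrans (christoffel_bil frob u 0 z Ax)); apply: (etrans _ (esym (b0l _ _))).
have arith (a b c : C) : a = 0 -> b = 0 -> c = 0 -> 2^-1 * (a + b - c) = 0.
  by move=> -> -> ->; rewrite addr0 subrr mulr0.
exact: (arith _ _ _ (b0l _ _)
  (etrans (congr1 (fun M => bil M u z) (derive0 g x)) (b0m _ _)) (b0r _ _)).
Qed.

Section Frame.
Variables (x0 : vect) (r : R) (eps : 'I_n -> vect -> vect).
Hypothesis ball_A : nball x0 r `<=` A.
Hypothesis eps_hol : forall k, holomorphic (nball x0 r) (eps k).
Hypothesis eps_idem : forall x, nball x0 r x -> forall k l,
  m x (eps k x) (eps l x) = if k == l then eps k x else 0.
Hypothesis eps_basis : forall x, nball x0 r x -> \matrix_k eps k x \in unitmx.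

Let frame x : 'M[C]_n := \matrix_k eps k x.
Let deps k x : nball x0 r x -> differentiable (eps k) x.
Proof. exact: (eps_hol k 1).1. Qed.

Lemma frame_commute x i j : nball x0 r x -> 'D_(eps i x) (eps j) x = 'D_(eps j x) (eps i) x.
Proof.
move=> xr; have Ax := ball_A xr.
apply: (@frame_bracket _ _ _ (e x) (eps^~ x) (frob_mul_linear frob Ax)
  (frob_mulC frob Ax) (frob_mulA frob Ax) (frob_unity frob Ax) (eps_idem xr)
  (eps_basis xr) (fun i j => 'D_(eps i x) (eps j) x)
  (fun i j k => 'D_(eps i x) (fun y => m y (eps j x) (eps k x)) x) (christoffel g x)).
- by move=> u; exact: christoffel0r.
- move=> a b c.
  rewrite -(prod_leibniz A_open (frob_mul_holomorphic frob) (frob_mul_linear frob)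
     (frob_mulC frob) (eps a x) Ax (deps b xr) (deps c xr)).
  have -> : 'D_(eps a x) (fun y => m y (eps b y) (eps c y)) x =
     'D_(eps a x) (fun y => if b == c then eps b y else 0) x.
    apply: near_eq_derive; have := open_nbhs_nbhs (conj (@open_nball R _ x0 r) xr).
    by apply: filterS => y /eps_idem.
  by case: eqP => // _; exact: derive_cst.
- by move=> a b c; exact: (potentiality A_open frob).
Qed.

Let frame_hol k : hol k (nball x0 r) frame.
Proof.
apply: (hol_mx (@open_nball R _ x0 r)) => i j.
have := hol_entry 0 j (@open_nball R _ x0 r) (eps_hol i k).
by apply: (hol_eq (@open_nball R _ x0 r)) => x _; rewrite mxE.
Qed.

Lemma coframe_hol : holomorphic (nball x0 r) (fun x => invmx (frame x)).
Proof. by move=> k; exact: (hol_invmx (@open_nball R _ x0 r) eps_basis (frame_hol k)). Qed.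

(** With B inverse to the frame matrix E, dB = - B dE B; expanded in the frame,
    the two sides differ by brackets of the fields of the frame. *)
Lemma coframe_closed x u v : nball x0 r x ->
  v *m 'D_u (fun y => invmx (frame y)) x = u *m 'D_v (fun y => invmx (frame y)) x.
Proof.
move=> xr; have EU := eps_basis xr.
have dE : differentiable frame x := (frame_hol 1).1 x xr.
have dB : differentiable (fun y => invmx (frame y)) x := (coframe_hol 1).1 x xr.
have DB w : 'D_w (fun y => invmx (frame y)) x =
    - (invmx (frame x) *m 'D_w frame x *m invmx (frame x)).
  have [_ d2] := differentiable_mulmx dE dB.
  have h : 'D_w (fun y => frame y *m invmx (frame y)) x = 0.
    rewrite -(derive_cst (1%:M : 'M[C]_n) x w).
    apply: near_eq_derive; have := open_nbhs_nbhs (conj (@open_nball R _ x0 r) xr).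
    by apply: filterS => y /eps_basis yU; rewrite mulmxV.
  have /eqP := etrans (esym (d2 w)) h; rewrite addrC addr_eq0 => /eqP h'.
  by rewrite -[LHS](mulKmx EU) h' mulmxN mulmxA.
have flat (p q : vect) (B D1 D2 : 'M[C]_n) : p *m B *m D1 = q *m B *m D2 ->
    p *m - (B *m D1 *m B) = q *m - (B *m D2 *m B).
  by move=> pq; rewrite !mulmxN !mulmxA pq.
apply: (etrans (congr1 (mulmx v) (DB u))).
apply: (etrans _ (esym (congr1 (mulmx u) (DB v)))); apply: flat.
have rowD w k : row k ('D_w frame x) = 'D_w (eps k) x.
  apply/rowP => j; rewrite mxE -(differentiable_entry k j dE).2.
  rewrite -(differentiable_entry 0 j (deps k xr)).2; congr ('D_w _ x).
  by apply/funext => y; rewrite mxE.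
have expand (w : vect) : w = \sum_k (w *m invmx (frame x)) 0 k *: eps k x.
  rewrite -[LHS](mulmxKV EU) mulmx_sum_row; apply: eq_bigr => k _.
  by rewrite rowK.
have key (p q : vect) : p *m invmx (frame x) *m 'D_q frame x =
   \sum_k \sum_j ((p *m invmx (frame x)) 0 k * (q *m invmx (frame x)) 0 j)
      *: 'D_(eps j x) (eps k) x.
  rewrite mulmx_sum_row; apply: eq_bigr => k _.
  have Dq := etrans (congr1 (fun w => 'D_w (eps k) x) (expand q)) (derive_sumv _ _ (deps k xr)).
  apply: (etrans (congr1 (fun w => _ *: w) (etrans (rowD q k) Dq))).
  rewrite scaler_sumr.
  by apply: eq_bigr => j _; rewrite scalerA.
apply: (etrans (key v u)); apply: (etrans _ (esym (key u v))).
rewrite exchange_big; apply: eq_bigr => k _; apply: eq_bigr => j _.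
have fc := frame_commute j k xr.
by apply: (etrans (congr1 (fun a => a *: _) (mulrC _ _)));
  exact: (congr1 (fun w => _ *: w) (esym fc)).
Qed.

End Frame.

(** The components of [P] are the canonical coordinates: their differentials
    form the coframe dual to the idempotents. *)
Theorem canonical_coordinates x0 : A x0 -> semisimple (m x0) ->
  exists2 r : R, 0 < r & exists eps : 'I_n -> vect -> vect, exists P : vect -> vect,
  [/\ nball x0 r `<=` A /\ (forall k, holomorphic (nball x0 r) (eps k)),
    forall x, nball x0 r x -> forall k l,
      m x (eps k x) (eps l x) = if k == l then eps k x else 0,
    forall x, nball x0 r x -> \matrix_k eps k x \in unitmx,
    forall x, nball x0 r x -> e x = \sum_k eps k x &
    holomorphic (nball x0 r) P /\ forall x, nball x0 r x ->
      forall v, 'D_v P x = v *m invmx (\matrix_k eps k x)].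
Proof.
move=> Ax0 ss.
have [r1 r10 [eps [rA epsH epsI epsB]]] := local_idempotent_frame A_open
  (frob_mul_holomorphic frob) (frob_mul_linear frob) (frob_mulC frob)
  (frob_mulA frob) (frob_unity frob) Ax0 ss.
have [r r0 [P rr1 PP]] := closed_form_primitive (@open_nball R _ x0 r1)
  (nballxx x0 r10) (coframe_hol epsH epsB) (coframe_closed rA epsH epsI epsB).
have oB : open (nball x0 r) by exact: open_nball.
exists r => //; exists eps, P; split.
- split; first by move=> x /rr1; exact: rA.
  by move=> k j; exact: (hol_sub rr1 (epsH k j)).
- by move=> x /rr1; exact: epsI.
- by move=> x /rr1; exact: epsB.
- move=> x /rr1 xr; have Ax := rA x xr.
  exact: (unity_sum_frame (frob_mul_linear frob Ax) (frob_mulC frob Ax)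
    (frob_unity frob Ax) (epsI x xr) (epsB x xr)).
split; last by move=> x xr v; rewrite (PP x xr).2.
case=> [|k]; first by move=> x xr; exact: differentiable_continuous (PP x xr).1.
split=> [x xr|v]; first exact: (PP x xr).1.
have h := hol_mulmx oB (hol_cst k _ v) (hol_sub rr1 (coframe_hol epsH epsB k)).
by apply: (hol_eq oB _ h) => x xr; rewrite (PP x xr).2.
Qed.

End CanonicalCoordinates.

(** * Charts, frames on manifolds, connectedness *)

Section Charts.
Context {R : realType} {n : nat} (M : complex_manifold R n).
Local Notation C := (Cplx R).
Local Notation hol := holomorphic_upto.
Local Notation vect := 'rV[C]_n.
Implicit Types (i j k : chart_index M) (p : M).

Lemma chart_imageP i p : chart_dom i p -> (chart i @` chart_dom i) (chart i p).
Proof. by move=> ip; exists p. Qed.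

Lemma open_chart_preimage i (B : set vect) : open B ->
  open [set p : M | chart_dom i p /\ B (chart i p)].
Proof.
move=> oB; rewrite openE => p [ip Bp].
apply: filterI; first exact: (open_nbhs_nbhs (conj (chart_dom_open i) ip)).
exact: (chart_continuous ip) (open_nbhs_nbhs (conj oB Bp)).
Qed.

Lemma open_chart_image i (W : set M) : open W -> open (chart i @` (chart_dom i `&` W)).
Proof.
move=> oW; rewrite openE => x [p [ip Wp] <-].
have ix := chart_imageP ip.
have h1 := open_nbhs_nbhs (conj (@chart_image_open _ _ M i) ix).
have Wx : nbhs (unchart i (chart i p)) W.
  by apply: open_nbhs_nbhs; split; rewrite // (chartK ip).
have h2 := unchart_continuous ix Wx.
apply: filterS (filterI h1 h2) => y [[q iq <-]].
by rewrite /= (chartK iq) => Wq; exists q.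
Qed.

Lemma transitionE i j p : chart_dom i p -> transition i j (chart i p) = chart j p.
Proof. by move=> ip; rewrite /transition /= (chartK ip). Qed.

Lemma open_overlap i j : open (chart i @` (chart_dom i `&` chart_dom j)).
Proof. exact: (open_chart_image (i:=i) (chart_dom_open j)). Qed.

Lemma transition_diff i j p : chart_dom i p -> chart_dom j p ->
  differentiable (transition i j) (chart i p).
Proof.
move=> ip jp; apply: (transition_holomorphic i j 1).1.
by exists p.
Qed.

Lemma transition_chain i j k p v : chart_dom i p -> chart_dom j p -> chart_dom k p ->
  'D_v (transition i k) (chart i p) =
  'D_('D_v (transition i j) (chart i p)) (transition j k) (chart j p).
Proof.
move=> ip jp kp.
have d1 := transition_diff ip jp.
have d2 : differentiable (transition j k) (transition i j (chart i p)).
  by rewrite (transitionE j ip); exact: transition_diff.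
have h := derive_comp v d1 d2; rewrite (transitionE j ip) in h.
apply: (etrans _ h); apply: near_eq_derive.
have o1 := @open_overlap i j; have := open_nbhs_nbhs (conj o1 (ex_intro2 _ _ p (conj ip jp) erefl)).
apply: filterS => _ [q [iq jq] <-].
by rewrite /= (transitionE k iq) (transitionE j iq) (transitionE k jq).
Qed.

Lemma transition_id i p v : chart_dom i p -> 'D_v (transition i i) (chart i p) = v.
Proof.
move=> ip; apply: (etrans _ (derive_id (chart i p) v)); apply: near_eq_derive.
have := open_nbhs_nbhs (conj (@chart_image_open _ _ M i) (chart_imageP ip)).
by apply: filterS => _ [q iq <-]; rewrite (transitionE i iq).
Qed.

Lemma transition_inj i j p v : chart_dom i p -> chart_dom j p ->
  'D_v (transition i j) (chart i p) = 0 -> v = 0.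
Proof.
move=> ip jp h; rewrite -(transition_id v ip) (transition_chain v ip jp ip) h.
exact: derive0.
Qed.

End Charts.

Section FrameExtension.
Context {R : realType} {n : nat} (M : complex_manifold R n) (F : frobenius_structure M).
Local Notation C := (Cplx R).
Local Notation hol := holomorphic_upto.
Local Notation vect := 'rV[C]_n.
Variables (j0 : chart_index M) (B : set vect) (eps0 : 'I_n -> vect -> vect).
Hypothesis B_open : open B.
Hypothesis eps0_hol : forall k, holomorphic B (eps0 k).
Hypothesis eps0_idem : forall x, B x -> forall k l,
  frob_mul F j0 x (eps0 k x) (eps0 l x) = if k == l then eps0 k x else 0.
Hypothesis eps0_basis : forall x, B x -> \matrix_k eps0 k x \in unitmx.

Let N : set M := [set p | chart_dom j0 p /\ B (chart j0 p)].

(** The transport of a frame from the chart [j0] to the chart [j]. *)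
Definition frame_from_chart (k : 'I_n) (j : chart_index M) (y : vect) : vect :=
  'D_(eps0 k (transition j j0 y)) (transition j0 j) (transition j j0 y).

Lemma frame_from_chartE k j p : chart_dom j p ->
  frame_from_chart k j (chart j p) =
  'D_(eps0 k (chart j0 p)) (transition j0 j) (chart j0 p).
Proof. by move=> jp; rewrite /frame_from_chart (transitionE j0 jp). Qed.

Lemma frame_from_chart0 k p : chart_dom j0 p ->
  frame_from_chart k j0 (chart j0 p) = eps0 k (chart j0 p).
Proof. by move=> jp; rewrite (frame_from_chartE _ jp) transition_id. Qed.

Lemma frame_from_chart_idempotent : idempotent_frame F N frame_from_chart.
Proof.
have oN : open N by exact: open_chart_preimage.
split.
- move=> k; split.
    move=> i l; pose D := chart i @` (chart_dom i `&` N).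
    have oD : open D by exact: open_chart_image.
    have DO : D `<=` chart i @` (chart_dom i `&` chart_dom j0).
      by move=> _ [p [ip [jp _]] <-]; exists p.
    have ht : hol l D (transition i j0) := hol_sub DO (transition_holomorphic i j0 l).
    have DB : transition i j0 @` D `<=` B.
      by move=> _ [_ [p [ip [jp Bp]] <-] <-]; rewrite (transitionE j0 ip).
    have DI : transition i j0 @` D `<=` chart j0 @` (chart_dom j0 `&` chart_dom i).
      by move=> _ [_ [p [ip [jp Bp]] <-] <-]; rewrite (transitionE j0 ip); exists p.
    have h1 := hol_comp oD DB ht (eps0_hol k l).
    have hj := hol_jac (@open_overlap _ _ M j0 i) (transition_holomorphic j0 i l.+1).
    have h2 := hol_comp oD DI ht hj.
    apply: hol_eq oD _ (hol_mulmx oD h1 h2) => _ [p [ip [jp Bp]] <-].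
    have dT := transition_diff jp ip.
    by rewrite (frame_from_chartE k ip) (derive_jac _ dT) /= (transitionE j0 ip).
  move=> i j p [j0p Bp] ip jp; rewrite (frame_from_chartE k ip) (frame_from_chartE k jp).
  exact: transition_chain.
- move=> i p [j0p Bp] ip k l; rewrite !(frame_from_chartE _ ip).
  rewrite -(frob_mul_transition F j0p ip) eps0_idem //.
  by case: eqP => // _; exact: derive0.
- move=> i p [j0p Bp] ip.
  have dT := transition_diff j0p ip.
  have -> : \matrix_k frame_from_chart k i (chart i p) =
      (\matrix_k eps0 k (chart j0 p)) *m jac (transition j0 i) (chart j0 p).
    apply/row_matrixP => k; rewrite row_mul !rowK (frame_from_chartE k ip).
    exact: derive_jac.
  rewrite unitmx_mul eps0_basis //=; apply: unit_inj => v.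
  by rewrite -(derive_jac v dT); exact: transition_inj.
Qed.

End FrameExtension.

Section ConvexConnected.
Context {R : realType}.
Local Notation C := (Cplx R).

Lemma segment_continuous (V : normedModType C) (x v : V) :
  continuous (fun t : R => x + cofr t *: v).
Proof.
move=> t; apply: (iffRL (@cvg_rnormP R _ _ (nbhs_filter t) _ _ _)) => e e0.
have v0 : 0 < rnorm v + 1 by rewrite ltr_wpDl ?rnorm_ge0.
have : nbhs t (ball t (e / (rnorm v + 1))) by apply: nbhsx_ballx; rewrite divr_gt0.
apply: filterS => s; rewrite /ball /= distrC ltr_pdivlMr // => h.
have -> : x + cofr s *: v - (x + cofr t *: v) = cofr (s - t) *: v.
  by rewrite cofrB scalerBl opprD addrACA subrr add0r.
rewrite rnormZ rnorm_real; apply: le_lt_trans h.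
by rewrite ler_wpM2l // lerDl.
Qed.

Lemma convex_connected (V : normedModType C) (X : set V) :
  (forall x y (t : R), 0 <= t <= 1 -> X x -> X y -> X (x + cofr t *: (y - x))) ->
  connected X.
Proof.
move=> cX; have [->|/set0P[x Xx]] := eqVneq X set0; first exact: connected0.
pose seg y := (fun t : R => x + cofr t *: (y - x)) @` `[0, 1]%classic.
have -> : X = \bigcup_(y in X) seg y.
  apply/seteqP; split=> [y Xy|_ [y Xy [t + <-]]].
    exists y => //; exists 1; first by rewrite /= in_itv /= lexx ler01.
    by rewrite cofr1 scale1r addrC subrK.
  by rewrite /= in_itv /= => t01; exact: cX.
apply: bigcup_connected => [|y _].
  exists x => y Xy; exists 0; first by rewrite /= in_itv /= lexx ler01.
  by rewrite cofr0 scale0r addr0.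
apply: connected_continuous_connected; first exact: segment_connected.
by apply: continuous_subspaceT; exact: segment_continuous.
Qed.

(** Locally constant by the mean value inequality, so that its level sets are
    open and closed. *)
Lemma derive0_constant m n (D : set C) (psi : C -> 'M[C]_(m, n)) : open D ->
  connected D -> (forall t, D t -> differentiable psi t /\ 'D_1 psi t = 0) ->
  forall s t, D s -> D t -> psi s = psi t.
Proof.
move=> oD cD dpsi s t Ds Dt.
have D0 u v : D u -> 'D_v psi u = 0.
  move=> Du; have -> : v = v *: (1 : C) by rewrite [RHS]mulr1.
  by rewrite (deriveZv _ _ (dpsi u Du).1) (dpsi u Du).2 scaler0.
have loc u : D u -> exists2 e : R, 0 < e & forall v, nball u e v -> D v /\ psi v = psi u.
  move=> Du; have [e e0 eD] := iffLR (open_rnormP D) oD u Du; exists e => // v ve.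
  split; first exact: eD.
  apply/eqP; rewrite -subr_eq0; apply/eqP/rnorm_eq0/le_anti/andP; split; last exact: rnorm_ge0.
  apply: mx_mean_value => w w01.
  have Dw : D (u + cofr w *: (v - u)).
    by apply: eD; exact: (convex_nball w01 (nballxx u e0) ve).
  by split; [exact: (dpsi _ Dw).1|rewrite D0 // rnorm0].
pose X := [set u | D u /\ psi u = psi s].
pose Y := [set u | D u /\ psi u != psi s].
have oX : open X.
  apply/open_rnormP => u [Du us]; have [e e0 h] := loc u Du; exists e => // v /h[Dv vu].
  by split; rewrite // vu.
have oY : open Y.
  apply/open_rnormP => u [Du us]; have [e e0 h] := loc u Du; exists e => // v /h[Dv vu].
  by split; rewrite // vu.
have XD : X = D.
  apply: cD; first by exists s.
    by exists X => //; apply/seteqP; split=> [u [Du us]|u [_ //]].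
  exists (~` Y); first exact: open_closedC.
  apply/seteqP; split=> [u [Du us]|u [Du nYu]]; first by split=> // -[_]; rewrite us eqxx.
  by split=> //; apply: contrapT => /eqP us; apply: nYu.
by have [_ ->] : X t by rewrite XD.
Qed.

End ConvexConnected.

(** * The model web of parallel lines *)

Section WebMatrix.
Variable K : fieldType.

(** Rows (1, 0), (-1, 1), (0, -1): the change from canonical coordinates
    (u_0, u_1, u_2) to the unity-invariant functions (u_0 - u_1, u_1 - u_2). *)
Definition web_mx : 'M[K]_(3, 2) :=
  \matrix_(i, j) ((i == j :> nat)%:R - (i == j.+1 :> nat)%:R).

Lemma mul_web_mx (u : 'rV[K]_3) :
  (u *m web_mx) 0 0 = u 0 0 - u 0 1 /\ (u *m web_mx) 0 1 = u 0 1 - u 0 (inord 2).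
Proof.
rewrite !mxE !big_ord_recl !big_ord0 !mxE /= !addr0 !subr0 !sub0r !mulr1 !mulr0 !mulrN1.
have -> : lift ord0 ord0 = 1 :> 'I_3 by apply: val_inj.
have -> : lift ord0 (lift ord0 ord0) = inord 2 :> 'I_3 by apply: val_inj; rewrite /= inordK.
have -> : ord0 = 0 :> 'I_3 by apply: val_inj.
by rewrite ?add0r ?addr0.
Qed.

Lemma web_mx_ker (u : 'rV[K]_3) : u *m web_mx = 0 -> exists t, u = t *: const_mx 1.
Proof.
move=> uW; have [] := mul_web_mx u; rewrite uW !mxE => /esym/eqP; rewrite subr_eq0 => /eqP u01.
move=> /esym/eqP; rewrite subr_eq0 => /eqP u12.
exists (u 0 0); apply/rowP => k; rewrite !mxE mulr1.
have : [\/ k = 0, k = 1 | k = inord 2].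
  case: k => [[|[|[|//]]] kk]; [apply: Or31|apply: Or32|apply: Or33]; apply: val_inj => //=.
  by rewrite inordK.
by case=> ->; rewrite // u01 // u12.
Qed.

(** The functions u_0 - u_1 and u_1 - u_2 are constant along the unity. *)
Lemma web_mx_unity : (const_mx 1 : 'rV[K]_3) *m web_mx = 0.
Proof.
apply/rowP => j; have [h0 h1] := mul_web_mx (const_mx 1).
have : j = 0 \/ j = 1 by case: j => [[|[|//]] jj]; [left|right]; apply: val_inj.
by case=> ->; rewrite ?h0 ?h1 !mxE subrr.
Qed.

Lemma web_mx_rows_free (k l : 'I_3) : k != l -> free [:: row k web_mx; row l web_mx].
Proof.
move=> kl; rewrite free_cons span_seq1 seq1_free.
have h (a b : 'I_3) (c : K) : a != b -> row a web_mx = c *: row b web_mx -> False.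
  move=> ab; rewrite !rowE scalemxAl => /eqP; rewrite -subr_eq0 -mulmxBl.
  move=> /eqP/web_mx_ker[t uE].
  have /card_gt0P[d] : (0 < #|~: [set a; b]|)%N.
    by rewrite cardsCs finset.setCK cards2 card_ord; case: (a != b).
  rewrite !inE negb_or => /andP[da db].
  have := congr1 (fun v : 'rV_3 => v 0 d) uE; have := congr1 (fun v : 'rV_3 => v 0 a) uE.
  rewrite !mxE !eqxx (negbTE da) (negbTE db) (negbTE ab) /= !mulr0 !subr0 !mulr1.
  by move=> <- /esym/eqP; rewrite oner_eq0.
apply/andP; split; last by apply/eqP => l0; apply: (h l k 0); rewrite 1?eq_sym // scale0r.
by apply/negP => /vlineP[c]; exact: h.
Qed.

Lemma web_mx_row_neq0 (k : 'I_3) : row k web_mx != 0.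
Proof.
have : (0 < #|~: [set k]|)%N by rewrite cardsCs finset.setCK cards1 card_ord.
move=> /card_gt0P[l]; rewrite !inE => lk.
by have := web_mx_rows_free lk; rewrite free_cons seq1_free => /andP[].
Qed.

(** The determinant with [a], as a linear form. *)
Definition line_form (a : 'rV[K]_2) : 'cV[K]_2 :=
  \col_i (if i == 0 then a 0 1 else - a 0 0).

Lemma mul_line_form (u a : 'rV[K]_2) :
  (u *m line_form a) 0 0 = u 0 0 * a 0 1 - u 0 1 * a 0 0.
Proof.
rewrite !mxE !big_ord_recl big_ord0 !mxE /= addr0 mulrN.
have -> : lift ord0 ord0 = 1 :> 'I_2 by apply: val_inj.
by have -> : ord0 = 0 :> 'I_2 by apply: val_inj.
Qed.

Lemma line_form_self (a : 'rV[K]_2) : a *m line_form a = 0.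
Proof.
by apply/rowP => j; rewrite [j]ord1 mul_line_form mulrC subrr mxE.
Qed.

Lemma line_equation (a u : 'rV[K]_2) : a != 0 ->
  u *m line_form a = 0 -> exists c, u = c *: a.
Proof.
move=> a0 /rowP/(_ 0); rewrite mul_line_form mxE.
move=> /eqP; rewrite subr_eq0 => /eqP uv.
have dec (j : 'I_2) : j = 0 \/ j = 1.
  by case: j => [[|[|//]] jj]; [left|right]; apply: val_inj.
have [a00|a00] := eqVneq (a 0 0) 0.
  have a01 : a 0 1 != 0.
    apply: contra a0 => /eqP h; apply/eqP/rowP => j; rewrite mxE.
    by case: (dec j) => ->.
  exists (u 0 1 / a 0 1); apply/rowP => j; rewrite mxE; case: (dec j) => ->.
    by apply: (mulIf a01); rewrite uv a00 !mulr0 mul0r.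
  by rewrite divfK.
exists (u 0 0 / a 0 0); apply/rowP => j; rewrite mxE; case: (dec j) => ->.
  by rewrite divfK.
by apply: (mulIf a00); rewrite -uv mulrAC divfK // mulrC.
Qed.

End WebMatrix.

(** * Flattening the booklet web *)

Section BookletWeb.
Context {R : realType} (M : complex_manifold R 3) (F : frobenius_structure M).
Context (S : complex_manifold R 2) (f : S -> M).
Local Notation C := (Cplx R).
Local Notation hol := holomorphic_upto.
Hypothesis f_immersion : immersion f.
Hypothesis f_transverse : transverse_to_unity F f.

Lemma preimage_open (W : set M) : open W -> open (f @^-1` W).
Proof. by move=> oW; apply: open_comp => // q _; exact: f_immersion.1.1. Qed.

Definition local_map i j : 'rV[C]_2 -> 'rV[C]_3 := chart j \o f \o unchart i.

Lemma local_mapE i j q : chart_dom i q -> local_map i j (chart i q) = chart j (f q).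
Proof. by move=> iq; rewrite /local_map /= (chartK iq). Qed.

Lemma local_map_hol i j : holomorphic
  (chart i @` (chart_dom i `&` f @^-1` chart_dom j)) (local_map i j).
Proof. exact: f_immersion.1.2. Qed.

Lemma local_map_diff i j q : chart_dom i q -> chart_dom j (f q) ->
  differentiable (local_map i j) (chart i q).
Proof. by move=> iq jq; apply: (local_map_hol i j 1).1; exists q. Qed.

(** By the chain rule, both sides are the derivative of the expression of [f] in
    the charts [i] and [j']. *)
Lemma tangent_map_transition i j i' j' q v : chart_dom i q -> chart_dom i' q ->
  chart_dom j (f q) -> chart_dom j' (f q) ->
  tangent_map f i' j' q ('D_v (transition i i') (chart i q)) =
  'D_(tangent_map f i j q v) (transition j j') (chart j (f q)).
Proof.
move=> iq iq' jq jq'; rewrite /tangent_map -!/(local_map _ _).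
have dt := transition_diff iq iq'.
have df' : differentiable (local_map i' j') (transition i i' (chart i q)).
  by rewrite (transitionE i' iq); exact: local_map_diff.
have df := local_map_diff iq jq.
have dt' : differentiable (transition j j') (local_map i j (chart i q)).
  by rewrite (local_mapE j iq); exact: transition_diff.
have h1 := derive_comp v dt df'; rewrite (transitionE i' iq) in h1.
have h2 := derive_comp v df dt'; rewrite (local_mapE j iq) in h2.
apply: (etrans (esym h1)); apply: (etrans _ h2); apply: near_eq_derive.
have o1 : open (chart i @` (chart_dom i `&`
    (chart_dom i' `&` f @^-1` (chart_dom j `&` chart_dom j')))).
  apply: open_chart_image; apply: openI; first exact: chart_dom_open.
  by apply: preimage_open; apply: openI; exact: chart_dom_open.
have := open_nbhs_nbhs
  (conj o1 (ex_intro2 _ _ q (conj iq (conj iq' (conj jq jq'))) erefl)).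
apply: filterS => _ [s [Hi [Hi' [Hj Hj']]] <-] /=.
by rewrite (transitionE i' Hi) (local_mapE j' Hi') (local_mapE j Hi) (transitionE j' Hj).
Qed.

Variables (i0 : chart_index S) (j0 : chart_index M) (x0 : 'rV[C]_3) (r : R).
Variables (eps0 : 'I_3 -> 'rV[C]_3 -> 'rV[C]_3) (P : 'rV[C]_3 -> 'rV[C]_3).
Let B : set 'rV[C]_3 := nball x0 r.
Let frame x : 'M[C]_3 := \matrix_k eps0 k x.
Hypothesis eps0_hol : forall k, holomorphic B (eps0 k).
Hypothesis eps0_idem : forall x, B x -> forall k l,
  frob_mul F j0 x (eps0 k x) (eps0 l x) = if k == l then eps0 k x else 0.
Hypothesis eps0_basis : forall x, B x -> frame x \in unitmx.
Hypothesis unity_sum : forall x, B x -> frob_e F j0 x = \sum_k eps0 k x.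
Hypothesis P_hol : holomorphic B P.
Hypothesis P_derive : forall x, B x -> forall v, 'D_v P x = v *m invmx (frame x).

Let N : set M := [set q | chart_dom j0 q /\ B (chart j0 q)].
Let eps := frame_from_chart j0 eps0.
Let phi := local_map i0 j0.
Let Om := chart i0 @` (chart_dom i0 `&` f @^-1` N).
(** The map to be inverted: u_0 - u_1 and u_1 - u_2 in the chart [i0]. *)
Let h0 s := P (phi s) *m web_mx C.

Let B_open : open B. Proof. exact: open_nball. Qed.
Let N_open : open N. Proof. exact: open_chart_preimage. Qed.
Let Om_open : open Om. Proof. by apply: open_chart_image; exact: preimage_open. Qed.

Let phi_hol : holomorphic Om phi.
Proof.
move=> k; apply: (hol_sub _ (local_map_hol i0 j0 k)).
by move=> _ [q [iq [jq _]] <-]; exists q.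
Qed.

Let phi_B : phi @` Om `<=` B.
Proof. by move=> _ [_ [q [iq [_ Bq]] <-] <-]; rewrite /phi (local_mapE j0 iq). Qed.

Lemma flat_map_hol : holomorphic Om h0.
Proof.
move=> k; apply: (hol_mulmx Om_open) (hol_cst k Om (web_mx C)).
exact: (hol_comp Om_open phi_B (phi_hol k) (P_hol k)).
Qed.

Lemma flat_map_derive s v : Om s ->
  'D_v h0 s = 'D_v phi s *m invmx (frame (phi s)) *m web_mx C.
Proof.
move=> Os; have Bs : B (phi s) by apply: phi_B; exists s.
have dphi : differentiable phi s := (phi_hol 1).1 s Os.
have dP : differentiable P (phi s) := (P_hol 1).1 _ Bs.
have [_ d2] := differentiable_mulmx (differentiable_comp dphi dP) (differentiable_cst (web_mx C) s).
apply: (etrans (d2 v)); rewrite derive_cst mulmx0 addr0; congr (_ *m _).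
by apply: (etrans (derive_comp v dphi dP)); exact: P_derive.
Qed.

Lemma unity_frame x : B x -> frob_e F j0 x = const_mx 1 *m frame x.
Proof.
move=> Bx; rewrite unity_sum // mulmx_sum_row; apply: eq_bigr => k _.
by rewrite mxE scale1r rowK.
Qed.

(** In the frame the unity has components (1, 1, 1), which span the kernel of
    [web_mx]: the plane of the unity and e_k is seen after multiplication. *)
Lemma plane_criterion x k w : B x ->
  (w \in (<[frob_e F j0 x]> + <[eps0 k x]>)%VS) <->
  exists c, w *m invmx (frame x) *m web_mx C = c *: row k (web_mx C).
Proof.
move=> Bx; have EU := eps0_basis Bx.
have ek : eps0 k x = delta_mx 0 k *m frame x by rewrite -rowE rowK.
split.
  move=> /memv_addP[_ /vlineP[a ->] [_ /vlineP[b ->] ->]]; exists b.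
  rewrite (unity_frame Bx) ek !scalemxAl -mulmxDl mulmxK // mulmxDl.
  by rewrite -!scalemxAl web_mx_unity scaler0 add0r -rowE.
move=> [c]; rewrite rowE scalemxAl => /eqP; rewrite -subr_eq0 -mulmxBl =>
  /eqP/web_mx_ker[t] /eqP; rewrite subr_eq => /eqP h.
apply/memv_addP; exists (t *: frob_e F j0 x); first by rewrite memvZ ?memv_line.
exists (c *: eps0 k x); first by rewrite memvZ ?memv_line.
apply: (etrans (esym (mulmxKV EU w))); apply: (etrans (congr1 (mulmx^~ (frame x)) h)).
apply: (etrans (mulmxDl _ _ _)); rewrite -!scalemxAl.
exact: (congr2 +%R (congr1 ( *:%R t) (esym (unity_frame Bx))) (congr1 ( *:%R c) (esym ek))).
Qed.

(** A tangent vector killed by the invariant functions is a multiple of the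
    unity, and transversality leaves only zero. *)
Lemma flat_map_immersive q v : chart_dom i0 q -> N (f q) -> 'D_v h0 (chart i0 q) = 0 -> v = 0.
Proof.
move=> iq [jq Bq] h; have Os : Om (chart i0 q) by exists q.
rewrite (flat_map_derive v Os) in h; rewrite /phi (local_mapE j0 iq) in h.
have [t tE] := web_mx_ker h.
have vE : tangent_map f i0 j0 q v = t *: frob_e F j0 (chart j0 (f q)).
  rewrite /tangent_map -/(local_map i0 j0) -[LHS](mulmxKV (eps0_basis Bq)) tE.
  by rewrite (unity_frame Bq) scalemxAl.
have [t0|t0] := eqVneq t 0.
  by apply: (f_immersion.2 q i0 j0 iq jq); rewrite vE t0 scale0r.
have := @f_transverse q i0 j0 iq jq (t^-1 *: v).
rewrite /tangent_map -/(local_map i0 j0) (deriveZv _ _ (local_map_diff iq jq)).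
by rewrite -[X in _ *: X]/(tangent_map f i0 j0 q v) vE scalerA mulVf // scale1r.
Qed.

Section Chart.
Variables (s0 : 'rV[C]_2) (rho r' : R) (g : 'rV[C]_2 -> 'rV[C]_2).
Let T : set 'rV[C]_2 := nball s0 rho.
Let W : set 'rV[C]_2 := nball (h0 s0) r'.
Hypothesis T_Om : T `<=` Om.
Hypothesis gK : forall s, T s -> g (h0 s) = s.
Hypothesis Kg : forall y, W y -> T (g y) /\ h0 (g y) = y.
Hypothesis g_hol : holomorphic W g.

Let V : set S := [set q | chart_dom i0 q /\ (T (chart i0 q) /\ W (h0 (chart i0 q)))].
Let h : S -> 'rV[C]_2 := h0 \o chart i0.
Let hinv : 'rV[C]_2 -> S := unchart i0 \o g.

Let W_open : open W. Proof. exact: open_nball. Qed.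
Let T_open : open T. Proof. exact: open_nball. Qed.

Lemma flat_disc_open : open [set s | T s /\ W (h0 s)].
Proof.
rewrite openE => s [Ts Ws]; have n1 := open_nbhs_nbhs (conj T_open Ts).
have [e e0 eW] := iffLR (open_rnormP _) W_open _ Ws.
have [d d0 dh] := iffLR (continuous_rnormP _ _) (@flat_map_hol 0 s (T_Om Ts)) _ e0.
by apply: filterS2 n1 (nball_nbhs s d0) => z Tz /dh /eW.
Qed.

Lemma flat_nbhd_open : open V.
Proof. exact: (open_chart_preimage i0 flat_disc_open). Qed.

Lemma flat_nbhd_frame q : V q -> N (f q).
Proof.
move=> [iq [Tq _]]; have [q' [iq' Nq'] qq'] := T_Om Tq.
by rewrite -(chartK iq) -qq' (chartK iq').
Qed.

Lemma flat_lift y : W y -> [/\ V (hinv y), chart i0 (hinv y) = g y & h (hinv y) = y].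
Proof.
move=> Wy; have [Tg hg] := Kg Wy; have [q [iq Nq] qg] := T_Om Tg.
have hq : hinv y = q by rewrite /hinv /= -qg (chartK iq).
by rewrite /h /V /= hq qg hg; split.
Qed.

Lemma flat_chart_image : h @` V = W.
Proof.
apply/seteqP; split=> [_ [q [iq [_ Wq]] <-] //|y Wy].
by have [Vy _ hy] := flat_lift Wy; exists (hinv y).
Qed.

Lemma flat_chartK q : V q -> hinv (h q) = q.
Proof. by move=> [iq [Tq Wq]]; rewrite /hinv /h /= gK // (chartK iq). Qed.

Lemma flat_chart_biholomorphic : biholomorphic V h hinv.
Proof.
split.
- by rewrite flat_chart_image; split; [exact: flat_nbhd_open|exact: W_open].
- exact: flat_chartK.
- split=> [q [iq [Tq _]]|y].
    apply: continuous_comp; first exact: (chart_continuous iq).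
    exact: (@flat_map_hol 0 _ (T_Om Tq)).
  rewrite flat_chart_image => Wy; have [Tg _] := Kg Wy.
  apply: continuous_comp; first exact: (@g_hol 0 y Wy).
  by apply: unchart_continuous; have [q [iq _] <-] := T_Om Tg; exists q.
- move=> i k; have oD := open_chart_image (i := i) flat_nbhd_open.
  have DO : chart i @` (chart_dom i `&` V) `<=` chart i @` (chart_dom i `&` chart_dom i0).
    by move=> _ [q [iq [i0q _]] <-]; exists q.
  have DT : transition i i0 @` (chart i @` (chart_dom i `&` V)) `<=` Om.
    by move=> _ [_ [q [iq [i0q [Tq _]]] <-] <-]; rewrite (transitionE i0 iq); exact: T_Om.
  exact: (hol_comp oD DT (hol_sub DO (transition_holomorphic i i0 k)) (flat_map_hol k)).
move=> i k; pose D := [set y | W y /\ (chart i0 @` (chart_dom i0 `&` chart_dom i)) (g y)].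
have DE : h @` (chart_dom i `&` V) = D.
  apply/seteqP; split=> [_ [q [iq [i0q [Tq Wq]]] <-]|y [Wy [q [i0q iq] qg]]].
    by split=> //; exists q => //; rewrite /h /= gK.
  have [Vy cy hy] := flat_lift Wy; exists (hinv y) => //; split=> //.
  by rewrite /hinv /= -qg (chartK i0q).
have oD : open D.
  rewrite openE => y [Wy gy]; apply: filterI; first exact: (open_nbhs_nbhs (conj W_open Wy)).
  have gc : {for y, continuous g} by exact: (@g_hol 0 y Wy).
  exact: (gc _ (open_nbhs_nbhs (conj (@open_overlap _ _ S i0 i) gy))).
rewrite DE.
have DW : D `<=` W by move=> y [].
have DO : g @` D `<=` chart i0 @` (chart_dom i0 `&` chart_dom i) by move=> _ [y [_ ?] <-].
exact: (hol_comp oD DO (hol_sub DW (g_hol k)) (transition_holomorphic i0 i k)).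
Qed.

Let a (k : 'I_3) : 'rV[C]_2 := row k (web_mx C).

Lemma eps_j0 k q : N (f q) -> eps k j0 (chart j0 (f q)) = eps0 k (chart j0 (f q)).
Proof. by move=> [jq _]; exact: frame_from_chart0. Qed.

(** By [plane_criterion], the linear form with kernel spanned by [a k] has zero
    derivative along the curve, the domain of which is connected. *)
Lemma web_curve_line k D gamma s t : web_curve F f eps k V D gamma -> D s -> D t ->
  exists c, h (gamma t) = h (gamma s) + c *: a k.
Proof.
move=> [oD cD DV [gc gh] gD] Ds Dt.
have Vg u : D u -> V (gamma u) by move=> Du; apply: DV; exists u.
pose c : C -> 'rV[C]_2 := chart i0 \o gamma.
have Dc : D `<=` D `&` gamma @^-1` chart_dom i0 by move=> u Du; split=> //; case: (Vg u Du).
have c_hol : holomorphic D c by move=> l; exact: (hol_sub Dc (gh i0 l)).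
pose lam := line_form (a k).
have alam : a k *m lam = 0 by exact: line_form_self.
pose psi u : 'M[C]_(1, 1) := (h0 \o c) u *m lam.
have dpsi u : D u -> differentiable psi u /\ 'D_1 psi u = 0.
  move=> Du; have [i0u [Tu Wu]] := Vg u Du; have [jq Bq] := flat_nbhd_frame (Vg u Du).
  have dc : differentiable c u := (c_hol 1).1 u Du.
  have dh : differentiable h0 (c u) := (flat_map_hol 1).1 _ (T_Om Tu).
  have [d1 d2] := differentiable_mulmx (differentiable_comp dc dh) (differentiable_cst lam u).
  split; first exact: d1.
  have [_ mem] := gD u i0 j0 Du i0u jq; rewrite (eps_j0 k (conj jq Bq)) in mem.
  have [b bE] := (plane_criterion k _ Bq).1 mem.
  have Dh : 'D_1 (h0 \o c) u = b *: a k.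
    apply: (etrans (derive_comp (1 : C) dc dh)); apply: (etrans (flat_map_derive _ (T_Om Tu))).
    by rewrite /phi (local_mapE j0 i0u); exact: bE.
  by apply: (etrans (d2 (1 : C))); rewrite derive_cst mulmx0 addr0 Dh -scalemxAl alam scaler0.
have pst := derive0_constant oD cD dpsi Dt Ds.
have : (h (gamma t) - h (gamma s)) *m lam = 0.
  by rewrite mulmxBl; apply/eqP; rewrite subr_eq0; apply/eqP; exact: pst.
move=> /(line_equation (web_mx_row_neq0 _ k))[b bE]; exists b.
by rewrite -[LHS](subrK (h (gamma s))) bE addrC.
Qed.

Let lin k y (s : C) : 'rV[C]_2 := y + s *: a k.

Lemma model_line_diff k y s : differentiable (lin k y) s /\ 'D_1 (lin k y) s = a k.
Proof.
have l : linear (fun s : C => s *: a k) by move=> b u v; rewrite /= scalerDl scalerA.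
have dids : differentiable (id : C -> C) s := @ex_diff _ _ _ _ _ _ _ (is_diff_id s).
have lc : continuous (fun s : C => s *: a k) by exact: scalel_continuous.
have [d1 d2] := differentiable_lin_comp l lc dids.
split; first exact: (differentiableD (differentiable_cst y s) d1).
have := deriveD (diff_derivable (differentiable_cst y s)) (diff_derivable d1) => /(_ 1) e.
by apply: (etrans e); rewrite derive_cst add0r d2 derive_id scale1r.
Qed.

Lemma model_line_hol k y (D : set C) : open D -> holomorphic D (lin k y).
Proof.
by move=> oD l; exact: (holD oD (hol_cst l D y) (hol_Zl (a k) oD (hol_id l oD))).
Qed.

(** Conversely the lines of the model web lift, through the inverse of the flat
    chart, to curves tangent to the web. *)
Lemma line_web_curve k y : let D := [set s | W (lin k y s)] in
  web_curve F f eps k V D (hinv \o lin k y).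
Proof.
move=> D; have linc : continuous (lin k y).
  by move=> s; apply: differentiable_continuous; exact: (model_line_diff k y s).1.
have oD : open D by apply: open_comp => // s _; exact: linc.
have Vg s : D s -> V (hinv (lin k y s)) by move=> /flat_lift[].
split=> //.
- apply: convex_connected => u v t t01 Du Dv; rewrite /D /=.
  have -> : lin k y (u + cofr t *: (v - u)) = lin k y u + cofr t *: (lin k y v - lin k y u).
    rewrite /lin; apply/rowP => j; rewrite !mxE; rewrite /GRing.scale /=; ring.
  exact: (convex_nball t01 Du Dv).
- by move=> _ [s Ds <-]; exact: Vg.
- have [_ _ [_ hic] _ hih] := flat_chart_biholomorphic.
  split=> [s Ds|i l].
    by apply: continuous_comp; [exact: linc|apply: hic; rewrite flat_chart_image].
  pose D' := D `&` (hinv \o lin k y) @^-1` chart_dom i.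
  have E : D' = lin k y @^-1` (h @` (chart_dom i `&` V)).
    apply/seteqP; split=> [s [Ds si]|s [q [iq Vq] qs]].
      by have [Vs _ hs] := flat_lift Ds; exists (hinv (lin k y s)).
    rewrite /D' /D /= -qs flat_chartK //; split=> //.
    by rewrite -flat_chart_image; exists q.
  have oE : open (h @` (chart_dom i `&` V)).
    rewrite openE => _ [q [iq Vq] <-].
    have hq : (h @` V) (h q) by exists q.
    have oc : nbhs (hinv (h q)) (chart_dom i).
      by rewrite flat_chartK //; exact: (open_nbhs_nbhs (conj (chart_dom_open i) iq)).
    have n1 : nbhs (h q) (hinv @^-1` chart_dom i) by exact: (hic _ hq _ oc).
    have n2 : nbhs (h q) W by apply: open_nbhs_nbhs; split; rewrite // -flat_chart_image.
    apply: (filterS _ (filterI n1 n2)) => z [iz Wz]; have [Vz _ hz] := flat_lift Wz.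
    by exists (hinv z).
  have oD' : open D' by rewrite E; apply: open_comp => // s _; exact: linc.
  have im : lin k y @` D' `<=` h @` (chart_dom i `&` V) by rewrite E => _ [s + <-].
  exact: (hol_comp oD' im (model_line_hol k y oD' l) (hih i l)).
move=> s i j Ds iq jq v x.
have [[i0q [Tq Wq]] cq hq] := flat_lift Ds; have [j0q Bq] := flat_nbhd_frame (Vg s Ds).
set q := hinv (lin k y s) in i0q Tq Wq cq hq j0q Bq.
have [dl Dl] := model_line_diff k y s.
have dg : differentiable g (lin k y s) := (g_hol 1).1 _ Ds.
pose c : C -> 'rV[C]_2 := g \o lin k y.
have cs : c s = chart i0 q by rewrite cq.
have dc : differentiable c s := differentiable_comp dl dg.
pose v0 := 'D_1 c s.
have h0v : 'D_v0 h0 (chart i0 q) = a k.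
  have dh : differentiable h0 (c s) by rewrite cs; exact: (flat_map_hol 1).1 _ (T_Om Tq).
  rewrite -cs; apply: (etrans (esym (derive_comp (1 : C) dc dh))); apply: (etrans _ Dl).
  apply: near_eq_derive; have := open_nbhs_nbhs (conj oD Ds).
  by apply: filterS => u /Kg[_ gu].
have vE : v = 'D_v0 (transition i0 i) (chart i0 q).
  have dt : differentiable (transition i0 i) (c s) by rewrite cs; exact: transition_diff.
  by rewrite -cs; exact: (derive_comp (1 : C) dc dt).
split.
  apply/eqP => v00; have := web_mx_row_neq0 C k; rewrite -/(a k) -h0v.
  by rewrite (transition_inj i0q iq (etrans (esym vE) v00)) derive0 eqxx.
rewrite vE (tangent_map_transition v0 i0q iq j0q jq).
have := flat_map_derive v0 (T_Om Tq); rewrite h0v /phi (local_mapE j0 i0q) => hE.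
have : tangent_map f i0 j0 q v0 \in
    (<[frob_e F j0 (chart j0 (f q))]> + <[eps0 k (chart j0 (f q))]>)%VS.
  by apply/(plane_criterion k _ Bq); exists 1; rewrite scale1r -[row k _]/(a k) hE.
move=> /memv_addP[_ /vlineP[b1 ->] [_ /vlineP[b2 ->] ->]].
have dT := transition_diff j0q jq.
rewrite (deriveDv _ _ dT) !(deriveZv _ _ dT).
have eE : 'D_(frob_e F j0 (chart j0 (f q))) (transition j0 j) (chart j0 (f q)) = frob_e F j x.
  by rewrite ((frob_e_field F).2 j0 j (f q) I j0q jq).
have epsE : 'D_(eps0 k (chart j0 (f q))) (transition j0 j) (chart j0 (f q)) = eps k j x.
  by rewrite /eps (frame_from_chartE j0 eps0 k jq).
apply: memv_add; apply/vlineP.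
  by exists b1; exact: (congr1 ( *:%R b1) eE).
by exists b2; exact: (congr1 ( *:%R b2) epsE).
Qed.

(** The image of the chart is a ball, which meets a line in a convex set. *)
Lemma leaf_image k q : V q -> h @` web_leaf F f eps k V q =
  connected_component (h @` V `&` [set h q + t *: a k | t in [set: C]]) (h q).
Proof.
move=> Vq; have Wq : W (h q) by rewrite -flat_chart_image; exists q.
rewrite flat_chart_image connected_component_id; last 2 first.
- by split=> //; exists 0 => //; rewrite scale0r addr0.
- apply: convex_connected => x y t t01 [Wx [b1 _ b1E]] [Wy [b2 _ b2E]].
  split; first exact: (convex_nball t01 Wx Wy).
  exists (b1 + cofr t * (b2 - b1)); first exact: I.
  rewrite -b1E -b2E; move: (h q) => y'.
  by apply/rowP => j; rewrite !mxE; ring.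
apply/seteqP; split.
  move=> _ [s [D [gamma [wc [t1 Dt1 t1q] [t2 Dt2 t2s]]]] <-].
  have [_ _ DV _ _] := wc; split.
    have Vs : V s by apply: DV; exists t2.
    by have [_ [_ Ws]] := Vs; exact: Ws.
  have [b bE] := web_curve_line wc Dt1 Dt2.
  by exists b; [exact: I|rewrite -t1q -t2s bE].
move=> y [Wy [t _ ty]]; have [Vy _ hy] := flat_lift Wy.
exists (hinv y) => //; exists [set s | W (lin k (h q) s)], (hinv \o lin k (h q)).
split; first exact: line_web_curve.
  by exists 0; rewrite /= /lin scale0r addr0 // flat_chartK.
by exists t; rewrite /= /lin ty.
Qed.

End Chart.
End BookletWeb.

Theorem theorem1 (R : realType)
    (M : complex_manifold R 3) (F : frobenius_structure M)
    (U : set M) (U_open : open U)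
    (U_semisimple : forall p, U p -> semisimple_at F p)
    (S : complex_manifold R 2) (f : S -> M)
    (f_inj : injective f) (f_immersion : immersion f)
    (f_in_U : range f `<=` U) (f_transverse : transverse_to_unity F f) :
  forall p : S, booklet_web_hexagonal_at F f p.
Proof.
move=> p; have [i0 ip] := chart_dom_cover p; have [j0 jp] := chart_dom_cover (f p).
have ss : semisimple (frob_mul F j0 (chart j0 (f p))).
  by apply: U_semisimple jp; apply: f_in_U; exists p.
have [r r0 [eps0 [P [[BA epsH] epsI epsB unity [PH PD]]]]] :=
  canonical_coordinates (@chart_image_open _ _ M j0) (frob_axioms F j0) (chart_imageP jp) ss.
pose N := [set q | chart_dom j0 q /\ nball (chart j0 (f p)) r (chart j0 q)].
have Np : N (f p) by split; [exact: jp|exact: nballxx].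
pose Om := chart i0 @` (chart_dom i0 `&` f @^-1` N).
pose h0 := fun s => P (local_map f i0 j0 s) *m web_mx (Cplx R).
have oN : open N by exact: (open_chart_preimage j0 (@open_nball R _ (chart j0 (f p)) r)).
have oOm : open Om by exact: (open_chart_image (preimage_open f_immersion oN)).
have Omp : Om (chart i0 p) by exists p.
have h0H : holomorphic Om h0 by exact: (flat_map_hol f_immersion i0 j0 PH).
have h0I v : 'D_v h0 (chart i0 p) = 0 -> v = 0.
  exact: (flat_map_immersive f_immersion f_transverse epsB unity PH PD ip Np).
have [rho [r' [g [[rho0 r'0] TOm gK Kg gH]]]] := inverse_function oOm h0H Omp h0I.
exists N, (frame_from_chart j0 eps0).
(* the domain is cut so that its image under the chart is a ball *)
exists [set q | chart_dom i0 q /\ (nball (chart i0 p) rho (chart i0 q) /\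
   nball (h0 (chart i0 p)) r' (h0 (chart i0 q)))].
exists (h0 \o chart i0), (unchart i0 \o g), (fun k => row k (web_mx (Cplx R))).
split.
- split; first exact: oN.
  exact: (frame_from_chart_idempotent (@open_nball R _ _ r) epsH epsI epsB).
- split; first by split; [exact: ip|split; exact: nballxx].
  by move=> _ [q Vq <-]; exact: (flat_nbhd_frame TOm Vq).
- exact: (flat_chart_biholomorphic f_immersion PH TOm gK Kg gH).
- by move=> k l; exact: web_mx_rows_free.
- by move=> k q Vq; exact: (leaf_image f_immersion epsB unity PH PD TOm gK Kg gH k Vq).
Qed.
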